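(* Let $1<p<\infty$ and $-1<\alpha<\infty$. If $f=h+\overline g$ is a complex-valued harmonic function in $a^p_\alpha$, then $$\int_{-1}^{1}(1-|x|)^{\alpha+1}|f(x)|^p\,dx\le \pi\,\sec^{p}\!\left(\frac{\pi}{2p}\right)\int_{\mathbb{D}}|f(z)|^p\,dA_\alpha(z).$$
   Context: $\mathbb{D}=\{z\in\mathbb{C}:|z|<1\}$. $dA(z)=\frac1\pi\,dx\,dy$ is normalized area measure, and for $\alpha>-1$, $dA_\alpha(z)=(\alpha+1)(1-|z|^2)^\alpha\,dA(z)$. $a^p_\alpha$ is the space of all complex-valued harmonic functions $f$ on $\mathbb{D}$ with $\|f\|_{a^p_\alpha}:=\left(\int_{\mathbb{D}}|f(z)|^p\,dA_\alpha(z)\right)^{1/p}<\infty$. Here $f=h+\overline g$ is the canonical decomposition of a harmonic function, with $h,g$ analytic in $\mathbb{D}$ and $g(0)=0$. *)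

(* Defs.v *)
From HB Require Import structures.
From mathcomp Require Import all_boot all_order all_algebra.
From mathcomp Require Import all_classical all_reals all_analysis.
From mathcomp Require Import complex.
Set Implicit Arguments.
Unset Strict Implicit.
Unset Printing Implicit Defensive.
Import Order.TTheory GRing.Theory Num.Theory.
Import numFieldNormedType.Exports.
Export ComplexField.Normc.

Local Open Scope classical_set_scope.
Local Open Scope complex_scope.
Local Open Scope ring_scope.

(* The plane R * R carries the topology and the Lebesgue measure; its points
   are identified with complex numbers through [of_coord]. *)
Definition of_coord (R : realType) (w : R * R) : R[i] := w.1 +i* w.2.

(* [normc] is the modulus with values in R, whereas `|z| lives in R[i]. *)
Definition unit_disk (R : realType) : set R[i] := [set z | normc z < 1].

Section PlaneCalculus.
Context {R : realType}.
Implicit Types (D : set (R * R)) (u : R * R -> R).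

Definition partial_x u : R * R -> R := fun w => 'D_((1, 0) : R * R) u w.
Definition partial_y u : R * R -> R := fun w => 'D_((0, 1) : R * R) u w.

Definition C1_on D u : Prop :=
  forall w, D w ->
    [/\ derivable u w (1, 0), derivable u w (0, 1),
        {for w, continuous (partial_x u)} & {for w, continuous (partial_y u)}].

Definition C2_on D u : Prop :=
  [/\ C1_on D u, C1_on D (partial_x u) & C1_on D (partial_y u)].

Definition laplacian u : R * R -> R :=
  fun w => partial_x (partial_x u) w + partial_y (partial_y u) w.

Definition real_harmonic_on D u : Prop :=
  C2_on D u /\ forall w, D w -> laplacian u w = 0.

End PlaneCalculus.

(* For complex-valued f, [C^2 and Delta f = 0] is understood componentwise. *)
Definition harmonic_on (R : realType) (D : set R[i]) (f : R[i] -> R[i]) : Prop :=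
  real_harmonic_on (@of_coord R @^-1` D) (fun w => complex.Re (f (of_coord w))) /\
  real_harmonic_on (@of_coord R @^-1` D) (fun w => complex.Im (f (of_coord w))).

(* \int_D F dA_alpha, with dA_alpha = (alpha + 1) (1 - |z|^2)^alpha dx dy / pi *)
Definition disk_integral (R : realType) (alpha : R) (F : R[i] -> R) : \bar R :=
  ((pi^-1)%:E *
   \int[(@lebesgue_measure R \x @lebesgue_measure R)%E]_(w in
       @of_coord R @^-1` @unit_disk R)
     ((alpha + 1) * (1 - normc (of_coord w) ^+ 2) `^ alpha
       * F (of_coord w))%:E)%E.

Definition bergman_norm (R : realType) (p alpha : R) (f : R[i] -> R[i]) :
    \bar R :=
  (disk_integral alpha (fun z => normc (f z) `^ p)%R `^ (p^-1)%R)%E.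

(* The space a^p_alpha; only the values of f on the disk matter. *)
Definition harmonic_bergman (R : realType) (p alpha : R) (f : R[i] -> R[i]) :
    Prop :=
  harmonic_on (@unit_disk R) f /\ (bergman_norm p alpha f < +oo)%E.

Definition sec (R : realType) (x : R) : R := (cos x)^-1.

(* Main.v *)
Require Import Defs.
From mathcomp Require Import all_boot all_order all_algebra.
From mathcomp Require Import all_classical all_reals all_analysis.
From mathcomp Require Import complex measurable_realfun.
From mathcomp Require Import ring lra.

(** Put [s = 1 / p] and [M = sec (pi s / 2)]. The upper half circle is
    parametrized by [z(t) = sin t + i cos t], and [P(x, t)] denotes the Poisson
    kernel of the disk at the point [x] of the diameter.

    If [f] is harmonic near the closed disk, then [|f|] is subharmonic, so
    [pi |f(x)| <= int P(x, t) m(t) dt], where [m(t)] is the mean of [|f|] at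
    [z(t)] and at its conjugate ([modulus_poisson_le]). This positive operator
    is bounded on [L^p] by a Schur test whose weights are powers of [1 - z^2],
    of modulus [2 cos t] on the circle and [1 - x^2] on the diameter:

      [int P(x, t) (2 cos t)^(- s) dt <= pi M (1 - x^2)^(- s)],
      [int P(x, t) (1 - x^2)^(s - 1) dx <= pi M (2 cos t)^(s - 1)]

    ([poisson_powR_le] and [diameter_powR_le]). The secant comes from a single
    observation: if [|arg w| <= pi / 2] then [cos (s pi / 2) |w|^s <= Re (w^s)],
    and the Poisson integral of the harmonic function [Re (w^s)] is known. It is
    used for [w = 1 - z^2] and, after a substitution in the second integral, for
    [w = (1 - z^2) / (1 + z^2)]. With the weighted inequality of Hoelder
    ([hoelder_weight]) the two estimates give the inequality of Riesz and Fejer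
    ([riesz_fejer]): the integral of [|f|^p] over the diameter is at most [M^p]
    times the integral of [m^p] over the half circle.

    Applied to the dilates of [f], this bounds the integral of [|f|^p] over
    [[- r, r]] by [M^p] times a mean over the circle of radius [r]. Now integrate
    in [r] against [(alpha + 1) 2 r (1 - r^2)^alpha] ([weighted_area_le]). On the
    right polar coordinates produce the integral over the disk. On the left, by
    Tonelli, [|f(x)|^p] is multiplied by the integral of this weight over
    [[|x|, 1]], which is [(1 - x^2)^(alpha + 1) >= (1 - |x|)^(alpha + 1)].

    The Poisson formula itself ([poisson_formula_even]) is proved on the diameter
    only, for functions even in [y]: it holds for [Re z^n] by a recursion, every
    continuous even function on the circle is a uniform limit of combinations of
    these by the theorem of Weierstrass, and the maximum principle carries the
    approximation into the disk. *)

Set Implicit Arguments.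
Unset Strict Implicit.
Unset Printing Implicit Defensive.
Import Order.TTheory GRing.Theory Num.Theory.
Import numFieldNormedType.Exports.

Local Open Scope classical_set_scope.
Local Open Scope ring_scope.

(** * One-variable calculus: the second derivative at a maximum *)

(** If [g2 > 0], then [g'] is positive just to the right of its zero [x], where
    [g] would therefore exceed [g x]. *)
Lemma second_derivative_at_max (R : realType) (g g' : R -> R) (g2 x e : R) :
  0 < e -> (forall t, `|t - x| < e -> is_derive t 1 g (g' t)) ->
  is_derive x 1 g' g2 -> (forall t, `|t - x| < e -> g t <= g x) -> g2 <= 0.
Proof.
move=> e0 dg dg' gmax.
have xx : `|x - x| < e by rewrite subrr normr0.
have in_e t : t \in `]x - e, x + e[%R -> `|t - x| < e.
  by rewrite in_itv/= ltr_norml => /andP[? ?]; apply/andP; split; lra.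
have g'x : g' x = 0.
  have [dgx] := @derive1_at_max _ g (x - e) (x + e) x ltac:(lra)
    (fun t h => @ex_derive _ _ _ _ _ _ _ (dg t (in_e t h))) ltac:(rewrite in_itv/=; lra)
    (fun t h => gmax t (in_e t h)).
  by have [_ ->] := dg x xx.
rewrite leNgt; apply/negP => g2_gt0.
have [dg'x g'xE] := dg'.
have cv : h^-1 *: (g' (h *: 1 + x) - g' x) @[h --> 0^'] --> g2.
  by rewrite -g'xE; exact: dg'x.
have [d /= d0 dP] := cvgr_gt _ cv _ g2_gt0.
have g'pos h : 0 < h -> h < d -> 0 < g' (x + h).
  move=> h0 hd; have := dP h; rewrite /ball/= sub0r normrN gtr0_norm//.
  move=> /(_ hd (lt0r_neq0 h0)) /=.
  by rewrite g'x subr0 [h *: 1]mulr1 [h + x]addrC pmulr_rgt0// invr_gt0.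
pose h := Num.min d e / 2.
have h0 : 0 < h by rewrite /h divr_gt0// lt_min d0 e0.
have hd : h < d.
  have : Num.min d e <= d by rewrite ge_min lexx.
  by rewrite /h; lra.
have he : h < e.
  have : Num.min d e <= e by rewrite ge_min lexx orbT.
  by rewrite /h; lra.
have dgh t : t \in `[x, x + h]%R -> is_derive t 1 g (g' t).
  by rewrite in_itv/= => /andP[? ?]; apply: dg; rewrite ltr_norml; apply/andP; split; lra.
have xh : x < x + h by lra.
have cg : {within `[x, x + h], continuous g}.
  by apply: derivable_within_continuous => t th; have [] := dgh t th.
have dgo t : t \in `]x, (x + h)[%R -> is_derive t 1 g (g' t).
  by move=> th; apply: dgh; exact: subset_itv_oo_cc.
have [c ch gE] := MVT xh dgo cg.
have : g (x + h) <= g x by apply: gmax; rewrite addrAC subrr add0r gtr0_norm.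
rewrite -subr_le0 gE addrAC subrr add0r leNgt => /negP; apply.
rewrite mulr_gt0//; move: ch; rewrite in_itv/= => /andP[xc cxh].
have -> : c = x + (c - x) by ring.
by apply: g'pos; lra.
Qed.

(** * Harmonic functions and the maximum principle *)

(** Harmonicity on the disk of radius [a]. Only the restrictions of [u] to
    horizontal and vertical lines are differentiated, so that everything reduces
    to calculus in one variable; joint continuity is then a separate clause. *)
Definition axis_harmonic (R : realType) (a : R) (u : R -> R -> R) : Prop :=
  (forall x y : R, x ^+ 2 + y ^+ 2 < a ^+ 2 ->
     {for (x, y), continuous (fun w : R * R => u w.1 w.2)}) /\
  exists ux uxx uy uyy : R -> R -> R,
  forall x y : R, x ^+ 2 + y ^+ 2 < a ^+ 2 ->
    [/\ is_derive x 1 (u ^~ y) (ux x y), is_derive x 1 (ux ^~ y) (uxx x y),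
        is_derive y 1 (u x) (uy x y), is_derive y 1 (uy x) (uyy x y) &
        uxx x y + uyy x y = 0].

Lemma continuous_comp2 (R : realType) (T : topologicalType) (u : R -> R -> R)
    (f g : T -> R) t :
  {for (f t, g t), continuous (fun w : R * R => u w.1 w.2)} ->
  {for t, continuous f} -> {for t, continuous g} ->
  {for t, continuous (fun x => u (f x) (g x))}.
Proof.
move=> cu cf cg.
exact: (cvg_comp (fun x => (f x, g x)) (fun w : R * R => u w.1 w.2) (cvg_pair cf cg) cu).
Qed.

Lemma is_derive_lin (R : realType) (c : R) (f g : R -> R) (x df dg : R) :
  is_derive x 1 f df -> is_derive x 1 g dg ->
  is_derive x 1 (fun t => f t + c * g t) (df + c * dg).
Proof.
move=> hf hg; exact: (@is_deriveD _ _ _ f (c \*: g) x 1 df (c *: dg)).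
Qed.

Lemma is_derive_sqrD (R : realType) (c x : R) :
  is_derive x 1 (fun t : R => t ^+ 2 + c) (2 * x).
Proof.
have := is_deriveD (is_deriveX 2 (is_derive_id x (1 : R))) (is_derive_cst c x 1).
by rewrite addr0 expr1 [_%:A]mulr1 exprfctE.
Qed.

Lemma is_derive_compN (R : realType) (f : R -> R) (x df : R) :
  is_derive (- x) 1 f df -> is_derive x 1 (fun t => f (- t)) (- df).
Proof.
move=> hf; rewrite -mulrN1.
exact: (@is_derive1_comp R f -%R x df (-1) hf (is_deriveNid x 1)).
Qed.

Lemma axis_harmonic_lin (R : realType) (a c : R) u v :
  axis_harmonic a u -> axis_harmonic a v ->
  axis_harmonic a (fun x y => u x y + c * v x y).
Proof.
move=> [cu [ux [uxx [uy [uyy Hu]]]]] [cv [vx [vxx [vy [vyy Hv]]]]]; split.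
  move=> x y xy; apply: (@continuousD _ _ _ (fun w : R * R => u w.1 w.2)
    (fun w : R * R => c * v w.1 w.2)); first exact: cu.
  by apply: (@continuousM _ _ (cst c)); [exact: cst_continuous|exact: cv].
exists (fun x y => ux x y + c * vx x y), (fun x y => uxx x y + c * vxx x y),
  (fun x y => uy x y + c * vy x y), (fun x y => uyy x y + c * vyy x y) => x y xy.
have [u1 u2 u3 u4 u5] := Hu x y xy; have [v1 v2 v3 v4 v5] := Hv x y xy.
by split; [exact: is_derive_lin..|rewrite addrACA -mulrDr u5 v5 mulr0 addr0].
Qed.

Lemma axis_harmonic_conj (R : realType) (a : R) u :
  axis_harmonic a u -> axis_harmonic a (fun x y => u x (- y)).
Proof.
move=> [cu [ux [uxx [uy [uyy Hu]]]]]; split.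
  move=> x y xy; have := cu x (- y); rewrite sqrrN => /(_ xy) cuxy.
  have c1 : {for (x, y), continuous (fun w : R * R => w.1)} by exact: cvg_fst.
  have c2 : {for (x, y), continuous (fun w : R * R => - w.2)}.
    by apply: cvgN; exact: cvg_snd.
  exact: (@continuous_comp2 R _ u (fun w => w.1) (fun w => - w.2) (x, y) cuxy c1 c2).
exists (fun x y => ux x (- y)), (fun x y => uxx x (- y)),
  (fun x y => - uy x (- y)), (fun x y => uyy x (- y)) => x y xy.
have := Hu x (- y); rewrite sqrrN => /(_ xy)[u1 u2 u3 u4 u5]; split => //.
- exact: (is_derive_compN u3).
- rewrite -[uyy _ _]opprK.
  exact: (is_deriveN (is_derive_compN u4)).
Qed.

Lemma closed_disk_compact (R : realType) :
  compact [set w : R * R | w.1 ^+ 2 + w.2 ^+ 2 <= 1].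
Proof.
pose I : set R := `[(-1)%R, 1%R]%classic.
have cI : compact (I `*` I) by apply: compact_setX; exact: segment_compact.
apply: subclosed_compact cI _.
- apply: (@preimage_closed _ _ (fun w : R * R => w.1 ^+ 2 + w.2 ^+ 2) [set x | x <= 1]).
    move=> w _; apply: cvgD; rewrite expr2; apply: cvgM; first [exact: cvg_fst|exact: cvg_snd].
  exact: closed_le.
- move=> [x y] /=; rewrite /I /setX/= !in_itv/= => xy.
  by split; apply/andP; split; nra.
Qed.

(** The weak maximum principle: adding [eps * |z|^2] to [u] makes its Laplacian
    positive, which excludes an interior maximum. *)
Lemma maximum_principle (R : realType) (a m : R) u : 1 < a ->
  axis_harmonic a u -> (forall x y : R, x ^+ 2 + y ^+ 2 = 1 -> u x y <= m) ->
  forall x y : R, x ^+ 2 + y ^+ 2 <= 1 -> u x y <= m.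
Proof.
move=> a1 [cu [ux [uxx [uy [uyy Hu]]]]] um x0 y0 xy0.
rewrite leNgt; apply/negP => mu0.
pose e := (u x0 y0 - m) / 2.
have e0 : 0 < e by rewrite divr_gt0// subr_gt0.
pose v (w : R * R) := u w.1 w.2 + e * (w.1 ^+ 2 + w.2 ^+ 2).
pose D := [set w : R * R | w.1 ^+ 2 + w.2 ^+ 2 <= 1].
have inD (x y : R) : x ^+ 2 + y ^+ 2 <= 1 -> x ^+ 2 + y ^+ 2 < a ^+ 2 by move=> ?; nra.
have cv : {within D, continuous v}.
  apply: continuous_in_subspaceT => -[x y]; rewrite inE /D/= => xy.
  apply: (@continuousD _ _ _ (fun w : R * R => u w.1 w.2)); first exact: (cu _ _ (inD _ _ xy)).
  apply: (@continuousM _ _ (cst e)); first exact: cst_continuous.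
  apply: cvgD; rewrite expr2; apply: cvgM; first [exact: cvg_fst|exact: cvg_snd].
have [|[x1 y1]] := compact_EVT_max _ (@closed_disk_compact R) cv.
  by exists (x0, y0).
rewrite inE /= => xy1 vmax.
have v01 : v (x0, y0) <= v (x1, y1) by apply: vmax; rewrite inE.
have xy1_lt : x1 ^+ 2 + y1 ^+ 2 < 1.
  rewrite lt_neqAle xy1 andbT; apply/eqP => xyE.
  have := um _ _ xyE; move: v01; rewrite /v /= xyE.
  have : 0 <= x0 ^+ 2 + y0 ^+ 2 by nra.
  have : u x0 y0 = m + 2 * e by rewrite /e; field.
  by nra.
pose d := (1 - (x1 ^+ 2 + y1 ^+ 2)) / 4.
have d0 : 0 < d by rewrite /d; lra.
have ngb (s t : R) : `|s| < d -> t ^+ 2 <= 1 -> (t + s) ^+ 2 <= t ^+ 2 + 4 * d.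
  rewrite ltr_norml => /andP[s1 s2] t1.
  have d14 : d <= 1 / 4 by rewrite /d; nra.
  have /andP[t2 t3] : -1 <= t <= 1 by apply/andP; split; nra.
  by nra.
have ux2 : uxx x1 y1 + 2 * e <= 0.
  apply: (@second_derivative_at_max _ (fun t => v (t, y1))
    (fun t => ux t y1 + 2 * e * t) _ x1 d) => //.
  - move=> t td; have : t ^+ 2 + y1 ^+ 2 <= 1.
      have := ngb (t - x1) x1 td; rewrite addrC subrK => /(_ ltac:(nra)).
      by rewrite /d; lra.
    move=> /inD /Hu[u1 _ _ _ _]; rewrite /v/=.
    rewrite [2 * e * t](_ : _ = e * (2 * t)); last by ring.
    exact: (is_derive_lin e u1 (is_derive_sqrD (y1 ^+ 2) t)).
  - have [_ u2 _ _ _] := Hu _ _ (inD _ _ xy1).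
    by have := @is_derive_lin _ (2 * e) _ id _ _ _ u2 (is_derive_id _ (1 : R)); rewrite mulr1.
  - move=> t td; apply: vmax; rewrite inE/=.
    have := ngb (t - x1) x1 td; rewrite addrC subrK => /(_ ltac:(nra)).
    by rewrite /d; lra.
have uy2 : uyy x1 y1 + 2 * e <= 0.
  apply: (@second_derivative_at_max _ (fun t => v (x1, t))
    (fun t => uy x1 t + 2 * e * t) _ y1 d) => //.
  - move=> t td; have : x1 ^+ 2 + t ^+ 2 <= 1.
      have := ngb (t - y1) y1 td; rewrite [y1 + _]addrC subrK => /(_ ltac:(nra)).
      by rewrite /d; lra.
    move=> /inD /Hu[_ _ u1 _ _]; rewrite /v/=.
    rewrite [2 * e * t](_ : _ = e * (2 * t)); last by ring.
    rewrite (_ : (fun s => _) = (fun s => u x1 s + e * (s ^+ 2 + x1 ^+ 2))); last first.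
      by apply/funext => s; rewrite [x1 ^+ 2 + _]addrC.
    exact: (is_derive_lin e u1 (is_derive_sqrD (x1 ^+ 2) t)).
  - have [_ _ _ u2 _] := Hu _ _ (inD _ _ xy1).
    by have := @is_derive_lin _ (2 * e) _ id _ _ _ u2 (is_derive_id _ (1 : R)); rewrite mulr1.
  - move=> t td; apply: vmax; rewrite inE/=.
    have := ngb (t - y1) y1 td; rewrite [y1 + _]addrC subrK => /(_ ltac:(nra)).
    by rewrite /d; lra.
have [_ _ _ _ lap] := Hu _ _ (inD _ _ xy1).
by lra.
Qed.

(** * Weierstrass approximation *)

(** The Bernstein operator [g |-> sum_k g(k) C(n, k) x^k (1 - x)^(n - k)],
    given by the binomial walk that generates it: positivity and the variance
    then follow by induction on the number of steps. *)
Fixpoint bernstein (R : realType) (n : nat) (g : nat -> R) : {poly R} :=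
  if n is n'.+1 then
    'X * bernstein n' (g \o S) + (1 - 'X) * bernstein n' g
  else (g 0%N)%:P.

Arguments bernstein : simpl never.

Lemma bernsteinS (R : realType) n (g : nat -> R) (x : R) :
  (bernstein n.+1 g).[x] =
  x * (bernstein n (g \o S)).[x] + (1 - x) * (bernstein n g).[x].
Proof. by rewrite /bernstein -/bernstein !hornerE. Qed.

Lemma le_bernstein (R : realType) n (g1 g2 : nat -> R) (x : R) : 0 <= x <= 1 ->
  (forall k, (k <= n)%N -> g1 k <= g2 k) ->
  (bernstein n g1).[x] <= (bernstein n g2).[x].
Proof.
move=> /andP[x0 x1]; elim: n g1 g2 => [|n IH] g1 g2 g12.
  by rewrite !hornerC; exact: g12.
rewrite !bernsteinS; apply: lerD; apply: ler_wpM2l => //; rewrite ?subr_ge0//.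
  by apply: IH => k kn; exact: g12.
by apply: IH => k kn; apply: g12; exact: leqW.
Qed.

Lemma bernstein_quadratic (R : realType) n (A B c x : R) :
  (bernstein n (fun k => A + B * (k%:R - c) ^+ 2)).[x] =
  A + B * (n%:R * (x * (1 - x)) + (n%:R * x - c) ^+ 2).
Proof.
elim: n c => [|n IH] c; first by rewrite hornerC; ring.
rewrite bernsteinS IH.
rewrite (_ : _ \o S = fun k => A + B * (k%:R - (c - 1)) ^+ 2); last first.
  by apply/funext => k /=; rewrite -[k.+1]addn1 natrD; ring.
by rewrite IH -[n.+1]addn1 natrD; ring.
Qed.

Lemma segment_unif_continuous (R : realType) (h : R -> R) (a b : R) :
  {within `[a, b], continuous h} -> forall e, 0 < e ->
  exists2 d, 0 < d & forall x y, x \in `[a, b] -> y \in `[a, b] ->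
    `|x - y| < d -> `|h x - h y| < e.
Proof.
move=> ch e e0.
have /compact_near_coveringP cover := @segment_compact _ a b.
pose P (d x : R) := forall y, y \in `[a, b] -> `|x - y| < d -> `|h x - h y| < e.
have e20 : 0 < e / 2 by rewrite divr_gt0.
have [x xab|d /= d0 hd] := cover R (0^'+) (fun d x => x \in `[a, b] -> P d x) _.
    have /subspace_continuousP /(_ x xab) /cvgrPdist_lt /(_ _ e20) := ch.
    rewrite /prop_near1 /within /= => /nbhs_ballP[d /= d0 hd].
    have d20 : 0 < d / 2 by rewrite divr_gt0.
    exists (ball x (d / 2), [set t | t < d / 2]).
      split; first exact: nbhsx_ballx.
      by exists (d / 2) => //= t; rewrite /ball/= sub0r normrN => td t0; rewrite (le_lt_trans _ td)// ler_norm.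
    move=> [x' t] /= [xx' td] x'ab y yab x'y.
    have hx' : `|h x - h x'| < e / 2.
      by apply: hd => //; apply: lt_trans xx' _; rewrite ltr_pdivrMr// ltr_pMr// ltr1n.
    have hy : `|h x - h y| < e / 2.
      apply: hd => //; rewrite /ball/= (_ : x - y = (x - x') + (x' - y)); last by ring.
      rewrite (le_lt_trans (ler_normD _ _))// [d]splitr ltrD//.
      by rewrite (lt_trans x'y).
    rewrite (_ : h x' - h y = - (h x - h x') + (h x - h y)); last by ring.
    by rewrite (le_lt_trans (ler_normD _ _))// normrN [e]splitr ltrD.
exists (d / 2); first by rewrite divr_gt0.
move=> x y xab yab xy; apply: (hd (d / 2)) => //=.
- by rewrite sub0r normrN gtr0_norm ?divr_gt0// ltr_pdivrMr// ltr_pMr// ltr1n.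
- by rewrite divr_gt0.
Qed.

(** Weierstrass approximation: [|h x - h y| <= e / 2 + (2 B / d^2) (x - y)^2]
    where [B] bounds [|h|] and [d] is a modulus of continuity for [e / 2]; the
    Bernstein operator turns this into an estimate by its variance. *)
Lemma weierstrass (R : realType) (h : R -> R) (e : R) : 0 < e ->
  {within `[0, 1], continuous h} ->
  exists p : {poly R}, forall x, 0 <= x <= 1 -> `|h x - p.[x]| <= e.
Proof.
move=> e0 ch.
have e20 : 0 < e / 2 by rewrite divr_gt0.
have [d d0 hd] := segment_unif_continuous ch e20.
have [M1 _ hM1] := EVT_max (@ler01 R) ch.
have [M2 _ hM2] := EVT_min (@ler01 R) ch.
pose B := `|h M1| + `|h M2|.
have B0 : 0 <= B by rewrite addr_ge0.
have hB x : x \in `[0, 1] -> `|h x| <= B.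
  move=> x01; have := hM1 x x01; have := hM2 x x01.
  have := ler_norm (h M1); have := ler_norm (- h M2); have := normr_ge0 (h M1).
  by have := normr_ge0 (h M2); rewrite normrN ler_norml /B => *; apply/andP; split; lra.
pose K := 2 * B / d ^+ 2.
have K0 : 0 <= K by rewrite divr_ge0 ?sqr_ge0// mulr_ge0.
have key x y : x \in `[0, 1] -> y \in `[0, 1] ->
    `|h x - h y| <= e / 2 + K * (x - y) ^+ 2.
  move=> x01 y01; have [/(hd x y x01 y01)/ltW xy|dxy] := ltP `|x - y| d.
    by rewrite (le_trans xy)// lerDl mulr_ge0// sqr_ge0.
  rewrite (le_trans (ler_normB _ _))// (@le_trans _ _ (2 * B))//.
    by rewrite mulr_natl mulr2n lerD// hB.
  apply: (@le_trans _ _ (K * (x - y) ^+ 2)); last by rewrite lerDr ltW.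
  rewrite /K mulrAC ler_pdivlMr ?exprn_gt0// ler_wpM2l ?mulr_ge0//.
  by rewrite -(real_normK (num_real (x - y))) lerXn2r// ?nnegrE// ltW.
have [n Kn] : exists n, K < e / 2 * n.+1%:R.
  exists (Num.truncn (K / (e / 2))); rewrite mulrC -ltr_pdivrMr//.
  exact: truncnS_gt.
have n0 : 0 < n.+1%:R :> R by [].
exists (bernstein n.+1 (fun k => h (k%:R / n.+1%:R))) => x x01.
have kn k : (k <= n.+1)%N -> `|h x - h (k%:R / n.+1%:R)| <=
    e / 2 + K / n.+1%:R ^+ 2 * (k%:R - n.+1%:R * x) ^+ 2.
  move=> kn; apply: le_trans (key x _ _ _) _; rewrite ?in_itv//=.
    by rewrite divr_ge0//= ler_pdivrMr// mul1r ler_nat.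
  rewrite le_eqVlt; apply/orP; left; apply/eqP; congr (_ + _).
  by field; rewrite lt0r_neq0.
have var : n.+1%:R * (x * (1 - x)) * (K / n.+1%:R ^+ 2) <= e / 2.
  have /andP[x0 x1] := x01.
  rewrite (_ : _ * _ = (x * (1 - x)) * (K / n.+1%:R)); last by field; rewrite lt0r_neq0.
  have : K / n.+1%:R <= e / 2 by rewrite ler_pdivrMr// ltW.
  have : 0 <= K / n.+1%:R by rewrite divr_ge0.
  have : x * (1 - x) <= 1 by nra.
  have : 0 <= x * (1 - x) by rewrite mulr_ge0// subr_ge0.
  set A := x * _; set C := K / _; nra.
rewrite mulrC in var.
have quad (A L : R) := bernstein_quadratic n.+1 A L (n.+1%:R * x) x.
pose g k := h (k%:R / n.+1%:R).
pose q (k : nat) := K / n.+1%:R ^+ 2 * (k%:R - n.+1%:R * x) ^+ 2.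
have gn k : (k <= n.+1)%N -> `|h x - g k| <= e / 2 + q k by exact: kn.
rewrite -/g ler_norml; apply/andP; split.
- have le1 k : (k <= n.+1)%N -> g k <= (h x + e / 2) + q k.
    by move=> /gn; rewrite ler_norml => /andP[+ _]; lra.
  have := le_bernstein x01 le1; rewrite /q quad subrr expr0n /= addr0.
  by move: var; move: (_ / _ * (_ * _)) (_.[x]) => V W; lra.
- have le2 k : (k <= n.+1)%N ->
      (h x - e / 2) + (- (K / n.+1%:R ^+ 2)) * (k%:R - n.+1%:R * x) ^+ 2 <= g k.
    by move=> /gn; rewrite mulNr -/(q k) ler_norml => /andP[_ +]; lra.
  have := le_bernstein x01 le2; rewrite quad subrr expr0n /= addr0 mulNr.
  by move: var; move: (_ / _ * (_ * _)) (_.[x]) => V W; lra.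
Qed.

(** * Derivatives and powers of a complex number *)

Section pointwise_derivation_rules.
Context {R : realType}.
Implicit Types (f g : R -> R) (x df dg : R).

Lemma is_derive_addf f g x df dg : is_derive x 1 f df -> is_derive x 1 g dg ->
  is_derive x 1 (fun t => f t + g t) (df + dg).
Proof. by move=> hf hg; exact: (is_deriveD hf hg). Qed.

Lemma is_derive_oppf f x df : is_derive x 1 f df ->
  is_derive x 1 (fun t => - f t) (- df).
Proof. by move=> hf; exact: (is_deriveN hf). Qed.

Lemma is_derive_mulf f g x df dg : is_derive x 1 f df -> is_derive x 1 g dg ->
  is_derive x 1 (fun t => f t * g t) (df * g x + f x * dg).
Proof.
move=> hf hg; rewrite addrC [df * _]mulrC.
exact: (is_deriveM hf hg).
Qed.

Lemma is_derive_invf f x df : f x != 0 -> is_derive x 1 f df ->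
  is_derive x 1 (fun t => (f t)^-1) (- df / f x ^+ 2).
Proof.
move=> f0 hf; rewrite mulNr mulrC -mulNr.
exact: (is_deriveV f0 hf).
Qed.

Lemma is_derive_compf f g x df dg : is_derive (g x) 1 f df ->
  is_derive x 1 g dg -> is_derive x 1 (fun t => f (g t)) (df * dg).
Proof. by move=> hf hg; exact: (is_derive1_comp hf hg). Qed.

Lemma is_derive_cstf (c x : R) : is_derive x 1 (fun=> c) 0.
Proof. exact: is_derive_cst. Qed.

Lemma is_derive_idf x : is_derive x 1 (fun t : R => t) 1.
Proof. exact: is_derive_id. Qed.

Lemma is_derive_eqf f x df dg : is_derive x 1 f df -> df = dg ->
  is_derive x 1 f dg.
Proof. by move=> + <-. Qed.

Lemma is_derive_continuous f x df : is_derive x 1 f df -> {for x, continuous f}.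
Proof.
by move=> [fx _]; apply/differentiable_continuous/derivable1_diffP.
Qed.

End pointwise_derivation_rules.

(** [derive] computes a derivative by structural rules and leaves the equality
    with the announced value, preceded by the non-vanishing of denominators. *)
Ltac derive_step := first
  [ eassumption | eapply is_derive_idf | eapply is_derive_cstf
  | eapply is_derive_addf | eapply is_derive_oppf
  | eapply is_derive_mulf
  | eapply is_derive_sin | eapply is_derive_cos
  | eapply (@is_derive_compf _ sin); [eapply is_derive_sin|]
  | eapply (@is_derive_compf _ cos); [eapply is_derive_cos|]
  | eapply (@is_derive_compf _ expR); [eapply is_derive_expR|]
  | eapply (@is_derive_compf _ atan); [eapply is_derive1_atan|]
  | eapply is_derive_invf; [shelve|] ].
Ltac derive := eapply is_derive_eqf; [ unshelve (repeat derive_step) | cbv beta ].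

Section zpow.
Context {R : realType}.
Implicit Types (x y t : R) (n : nat).

(** Real and imaginary part of [(x + i y) ^ n]. *)
Fixpoint zpow n x y : R * R :=
  if n is n'.+1 then
    (x * (zpow n' x y).1 - y * (zpow n' x y).2,
     x * (zpow n' x y).2 + y * (zpow n' x y).1)
  else (1, 0).

Lemma is_derive_zpow_x n x y :
  is_derive x 1 (fun s => (zpow n s y).1) (n%:R * (zpow n.-1 x y).1) /\
  is_derive x 1 (fun s => (zpow n s y).2) (n%:R * (zpow n.-1 x y).2).
Proof.
elim: n => [|n [IH1 IH2]].
  by rewrite !mul0r; split; exact: is_derive_cstf.
have [n0|n0] := eqVneq n 0%N.
  by subst n; split; derive; rewrite /=; ring.
have E : zpow n x y = (x * (zpow n.-1 x y).1 - y * (zpow n.-1 x y).2,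
     x * (zpow n.-1 x y).2 + y * (zpow n.-1 x y).1) by case: n n0 {IH1 IH2}.
by split => /=; derive; rewrite /= E/= -[n.+1]addn1 natrD; ring.
Qed.

Lemma is_derive_zpow_y n x y :
  is_derive y 1 (fun s => (zpow n x s).1) (- (n%:R * (zpow n.-1 x y).2)) /\
  is_derive y 1 (fun s => (zpow n x s).2) (n%:R * (zpow n.-1 x y).1).
Proof.
elim: n => [|n [IH1 IH2]].
  by rewrite !mul0r oppr0; split; exact: is_derive_cstf.
have [n0|n0] := eqVneq n 0%N.
  by subst n; split; derive; rewrite /=; ring.
have E : zpow n x y = (x * (zpow n.-1 x y).1 - y * (zpow n.-1 x y).2,
     x * (zpow n.-1 x y).2 + y * (zpow n.-1 x y).1) by case: n n0 {IH1 IH2}.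
by split => /=; derive; rewrite /= E/= -[n.+1]addn1 natrD; ring.
Qed.

Lemma continuous_zpow n :
  continuous (fun w : R * R => (zpow n w.1 w.2).1) /\
  continuous (fun w : R * R => (zpow n w.1 w.2).2).
Proof.
elim: n => [|n [IH1 IH2]]; first by split => w; exact: cst_continuous.
have c1 : continuous (fun w : R * R => w.1) by move=> w; exact: cvg_fst.
have c2 : continuous (fun w : R * R => w.2) by move=> w; exact: cvg_snd.
split => w /=.
  apply: cvgB; apply: cvgM;
    [exact: c1|exact: IH1|exact: c2|exact: IH2].
apply: cvgD; apply: cvgM;
    [exact: c1|exact: IH2|exact: c2|exact: IH1].
Qed.

Lemma axis_harmonic_zpow (a : R) n : axis_harmonic a (fun x y => (zpow n x y).1).
Proof.
split; first by move=> x y _; exact: (continuous_zpow n).1.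
exists (fun x y => n%:R * (zpow n.-1 x y).1),
  (fun x y => n%:R * (n.-1%:R * (zpow n.-2 x y).1)),
  (fun x y => - (n%:R * (zpow n.-1 x y).2)),
  (fun x y => - (n%:R * (n.-1%:R * (zpow n.-2 x y).1))) => x y _.
have [h1 _] := is_derive_zpow_x n x y.
have [h2 _] := is_derive_zpow_x n.-1 x y.
have [h3 _] := is_derive_zpow_y n x y.
have [_ h4] := is_derive_zpow_y n.-1 x y.
split => //; [by derive; ring|by derive; ring|by rewrite subrr].
Qed.

(** The recurrence of the Chebyshev polynomials: on the unit circle [Re z^n] is
    the polynomial [T_n] in [Re z]. *)
Lemma zpow_chebyshev n x y : x ^+ 2 + y ^+ 2 = 1 ->
  (zpow n.+2 x y).1 = 2 * x * (zpow n.+1 x y).1 - (zpow n x y).1.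
Proof.
move=> xy /=; set c := (zpow n x y).1; set d := (zpow n x y).2.
transitivity (2 * x * (x * c - y * d) - (x ^+ 2 + y ^+ 2) * c); first by ring.
by rewrite xy; ring.
Qed.

Lemma is_derive_zpow_circle n t :
  is_derive t 1 (fun t => (zpow n (sin t) (cos t)).1)
    (n%:R * (zpow n (sin t) (cos t)).2) /\
  is_derive t 1 (fun t => (zpow n (sin t) (cos t)).2)
    (- (n%:R * (zpow n (sin t) (cos t)).1)).
Proof.
elim: n => [|n [IH1 IH2]].
  by rewrite !mul0r oppr0; split; exact: is_derive_cstf.
by split => /=; derive; rewrite -[n.+1]addn1 natrD; ring.
Qed.

Lemma zpow_real n x : (zpow n x 0).1 = x ^+ n /\ (zpow n x 0).2 = 0.
Proof.
elim: n => [|n [IH1 IH2]] //=.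
by rewrite IH1 IH2 !mul0r mulr0 subr0 addr0 exprS.
Qed.

End zpow.

(** * The Poisson kernel on the upper half circle *)

Section half_circle_integral.
Context {R : realType}.
Implicit Types (f g F : R -> R) (c : R).

(** The upper half circle is parametrized by [t |-> (sin t, cos t)] with [t] in
    [[-pi/2, pi/2]]; its end points are -1 and 1. *)
Definition arc : set R := `[- (pi / 2), pi / 2]%classic.

Definition arc_integral g : R := \int[@lebesgue_measure R]_(t in arc) g t.

Lemma measurable_arc : measurable arc. Proof. exact: measurable_itv. Qed.

Lemma arc_integrable g : continuous g ->
  (@lebesgue_measure R).-integrable arc (EFin \o g).
Proof.
move=> cg; apply: continuous_compact_integrable; first exact: segment_compact.
exact: continuous_subspaceT.
Qed.

Lemma arc_integral_lin f g c : continuous f -> continuous g ->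
  arc_integral (fun t => f t + c * g t) = arc_integral f + c * arc_integral g.
Proof.
move=> cf cg; have cc : continuous (fun t => c * g t).
  by move=> t; apply: cvgM; [exact: cst_continuous|exact: cg].
rewrite /arc_integral RintegralD//; [|exact: measurable_arc|exact: arc_integrable..].
by rewrite RintegralZl//; [exact: measurable_arc|exact: arc_integrable].
Qed.

Lemma arc_integralZ f c : continuous f ->
  arc_integral (fun t => c * f t) = c * arc_integral f.
Proof.
by move=> cf; rewrite /arc_integral RintegralZl//;
  [exact: measurable_arc|exact: arc_integrable].
Qed.

Lemma le_arc_integral f g : continuous f -> continuous g ->
  (forall t, - (pi / 2) <= t <= pi / 2 -> f t <= g t) ->
  arc_integral f <= arc_integral g.
Proof.
move=> cf cg fg; apply: le_Rintegral; [exact: measurable_arc|exact: arc_integrable..|].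
by move=> t; rewrite /arc/= in_itv/= => /fg.
Qed.

Lemma arc_integral_FTC f F : continuous f ->
  (forall t : R, is_derive t 1 F (f t)) ->
  arc_integral f = F (pi / 2) - F (- (pi / 2)).
Proof.
move=> cf dF; have pi0 := pi_gt0 R.
have cF : continuous F by move=> t; exact: (is_derive_continuous (dF t)).
rewrite /arc_integral /Rintegral (@continuous_FTC2 _ f F)//.
- by lra.
- exact: continuous_subspaceT.
- split => [t _||]; first by have [] := dF t.
  + by apply: cvg_at_right_filter; exact: cF.
  + by apply: cvg_at_left_filter; exact: cF.
- by move=> t _; rewrite derive1E; have [_ ->] := dF t.
Qed.

End half_circle_integral.

Section poisson_kernel.
Context {R : realType}.
Implicit Types (x t : R) (n : nat).

Definition poisson_kernel x t : R := (1 - x ^+ 2) / (1 - 2 * x * sin t + x ^+ 2).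

Lemma poisson_denom_gt0 x t : -1 < x < 1 -> 0 < 1 - 2 * x * sin t + x ^+ 2.
Proof.
move=> /andP[x0 x1]; have := sin_geN1 t; have := sin_le1 t => s1 s2.
have -> : 1 - 2 * x * sin t + x ^+ 2 =
  (1 + sin t) / 2 * (1 - x) ^+ 2 + (1 - sin t) / 2 * (1 + x) ^+ 2 by field.
have h1 : 0 < (1 - x) ^+ 2 by rewrite exprn_gt0//; lra.
have h2 : 0 < (1 + x) ^+ 2 by rewrite exprn_gt0//; lra.
have [s0|s0] := leP 0 (sin t).
  by apply: ltr_wpDr; [apply: mulr_ge0; [lra|exact: ltW]|rewrite mulr_gt0//; lra].
by apply: ltr_wpDl; [apply: mulr_ge0; [lra|exact: ltW]|rewrite mulr_gt0//; lra].
Qed.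

Lemma poisson_kernel_ge0 x t : -1 < x < 1 -> 0 <= poisson_kernel x t.
Proof.
move=> x1; rewrite divr_ge0//; last exact/ltW/poisson_denom_gt0.
by have /andP[? ?] := x1; nra.
Qed.

Lemma continuous_poisson_kernel x : -1 < x < 1 -> continuous (poisson_kernel x).
Proof.
move=> x1 t.
have d0 := lt0r_neq0 (poisson_denom_gt0 t x1).
have h : is_derive t 1 (poisson_kernel x)
    (0 * (1 - 2 * x * sin t + x ^+ 2)^-1 + (1 - x ^+ 2) *
      (- (- (2 * x * cos t)) / (1 - 2 * x * sin t + x ^+ 2) ^+ 2)).
  rewrite /poisson_kernel; derive; first exact: d0.
  by congr (_ + _ * (- _ / _)); ring.
exact: is_derive_continuous h.
Qed.

Lemma continuous_zpow_circle n : continuous (fun t : R => (zpow n (sin t) (cos t)).1).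
Proof. by move=> t; apply: is_derive_continuous (is_derive_zpow_circle n t).1. Qed.

Lemma continuousM_fun (f g : R -> R) :
  continuous f -> continuous g -> continuous (fun t => f t * g t).
Proof. by move=> cf cg t; apply: cvgM; [exact: cf|exact: cg]. Qed.

Lemma arc_integral_zpow n : arc_integral (fun t : R => (zpow n.+1 (sin t) (cos t)).1) = 0.
Proof.
pose F (t : R) := - (n.+1%:R^-1 * (zpow n.+1 (sin t) (cos t)).2).
have dF (t : R) : is_derive t 1 F ((zpow n.+1 (sin t) (cos t)).1).
  have [_ h] := is_derive_zpow_circle n.+1 t; rewrite /F.
  by derive; rewrite mul0r add0r mulrN opprK mulrA mulVf ?pnatr_eq0// mul1r.
rewrite (arc_integral_FTC (@continuous_zpow_circle n.+1) dF) /F.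
rewrite sinN cosN sin_pihalf cos_pihalf.
by rewrite !(zpow_real _ _).2 !mulr0 subrr.
Qed.

(** [t + 2 arg (1 - x z)] is a primitive of the kernel, since the kernel is
    the real part of [1 + 2 sum_(n > 0) (x z)^n] and [dz = - i z dt]. *)
Lemma arc_integral_poisson x : -1 < x < 1 -> arc_integral (poisson_kernel x) = pi.
Proof.
move=> x1; pose F (t : R) := t - 2 * atan (x * cos t * (1 - x * sin t)^-1).
have dF (t : R) : is_derive t 1 F (poisson_kernel x t).
  have /andP[x0 x2] := x1.
  have d0 : 1 - x * sin t != 0.
    have := sin_geN1 t; have := sin_le1 t => s1 s2.
    by apply: lt0r_neq0; have [x3|x3] := leP 0 x; nra.
  have e0 := lt0r_neq0 (poisson_denom_gt0 t x1).
  have cs := cos2Dsin2 t.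
  rewrite /F; derive; first exact: d0.
  rewrite /poisson_kernel.
  have E : (1 - x * sin t) ^+ 2 + (x * cos t) ^+ 2 = 1 - 2 * x * sin t + x ^+ 2.
    transitivity (1 - 2 * x * sin t + x ^+ 2 * (cos t ^+ 2 + sin t ^+ 2)); first by ring.
    by rewrite cs mulr1.
  have E0 : (1 - x * sin t) ^+ 2 + (x * cos t) ^+ 2 != 0 by rewrite E.
  rewrite -E.
  have -> : 1 - x ^+ 2 = 1 - x ^+ 2 * (cos t ^+ 2 + sin t ^+ 2) by rewrite cs mulr1.
  by field; rewrite d0 E0.
rewrite (arc_integral_FTC (continuous_poisson_kernel x1) dF) /F.
rewrite sinN cosN sin_pihalf cos_pihalf !mulr0 !mul0r atan0.
by field.
Qed.

(** The kernel times its denominator is the constant [1 - x^2]; integrating this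
    identity against [Re z^n] and linearizing [2 sin t Re z^n] by
    [zpow_chebyshev] gives a recurrence in [n] that [pi x^n] satisfies. *)
Lemma arc_integral_poisson_zpow x n : -1 < x < 1 ->
  arc_integral (fun t => poisson_kernel x t * (zpow n (sin t) (cos t)).1) =
  pi * x ^+ n.
Proof.
move=> x1.
pose I n := arc_integral (fun t => poisson_kernel x t * (zpow n (sin t) (cos t)).1).
pose J n := arc_integral (fun t : R => (zpow n (sin t) (cos t)).1).
have cP := continuous_poisson_kernel x1.
have cz k := @continuous_zpow_circle k.
have cPz k := continuousM_fun cP (cz k).
have I0 : I 0%N = pi.
  rewrite -(arc_integral_poisson x1); congr arc_integral; apply/funext => t /=.
  by rewrite mulr1.
have J0 : J 0%N = pi.
  have := @arc_integral_FTC R _ (fun t => t) (cz 0%N) (fun t => is_derive_idf t).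
  by rewrite /J => -> /=; field.
have JS k : J k.+1 = 0 by exact: arc_integral_zpow.
have den0 t := lt0r_neq0 (poisson_denom_gt0 t x1).
have cZ (f : R -> R) c : continuous f -> continuous (fun t => c * f t).
  by move=> cf; apply: (@continuousM_fun (cst c)) => //; exact: cst_continuous.
have rec0 : (1 + x ^+ 2) * I 0%N - 2 * x * I 1%N = (1 - x ^+ 2) * pi.
  have E1 := arc_integral_lin (- (2 * x)) (cZ _ (1 + x ^+ 2) (cPz 0%N)) (cPz 1%N).
  have E0 := arc_integralZ (1 - x ^+ 2) (cz 0%N).
  rewrite arc_integralZ// -/(I 0%N) -/(I 1%N) in E1.
  rewrite -/(J 0%N) J0 in E0.
  rewrite -mulNr -E1 -E0.
  congr arc_integral; apply/funext => t.
  by rewrite /poisson_kernel /=; field.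
have recS k : (1 + x ^+ 2) * I k.+1 + (- x) * (I k.+2 + 1 * I k) = 0.
  have cPzz : continuous (fun t => poisson_kernel x t * (zpow k.+2 (sin t) (cos t)).1 +
      1 * (poisson_kernel x t * (zpow k (sin t) (cos t)).1)).
    by move=> t; apply: cvgD; [exact: (cPz k.+2 t)|exact: (cZ _ 1 (cPz k) t)].
  have E2 := arc_integral_lin 1 (cPz k.+2) (cPz k).
  have E1 := arc_integral_lin (- x) (cZ _ (1 + x ^+ 2) (cPz k.+1)) cPzz.
  have E0 := arc_integralZ (1 - x ^+ 2) (cz k.+1).
  rewrite -/(I k.+2) -/(I k) in E2.
  rewrite E2 arc_integralZ// -/(I k.+1) in E1.
  rewrite -/(J k.+1) JS mulr0 in E0.
  rewrite -E1 -[RHS]E0.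
  congr arc_integral; apply/funext => t.
  rewrite zpow_chebyshev; last by rewrite addrC cos2Dsin2.
  by rewrite /poisson_kernel; field.
rewrite -/(I n).
have [x0|x0] := eqVneq x 0.
  have IJ : I n = J n.
    congr arc_integral; apply/funext => t.
    by rewrite /poisson_kernel x0 expr0n/= mulr0 mul0r !subr0 addr0 divr1 mul1r.
  by rewrite IJ x0; case: n {IJ} => [|n]; rewrite ?JS ?J0 ?expr0 ?mulr1// expr0n mulr0.
elim/ltn_ind: n => -[|[|n]] IH.
- by rewrite I0 mulr1.
- apply: (mulfI x0); move: rec0; rewrite I0 expr1 => h.
  have : 2 * x * I 1%N = (1 + x ^+ 2) * pi - (1 - x ^+ 2) * pi by rewrite -h; ring.
  by move=> h2; apply: (@mulfI _ 2) => //; rewrite mulrA h2; ring.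
- apply: (mulfI x0).
  have := recS n; rewrite (IH n.+1)// (IH n)// !exprS => h.
  by rewrite -[LHS]addr0 -h; ring.
Qed.

End poisson_kernel.

(** * The Poisson formula for functions even in y *)

Section poisson_formula.
Context {R : realType}.
Implicit Types (u v : R -> R -> R) (x y a e : R).

(** Combinations of the [Re z^n], generated inductively so that a linear property
    only has to be checked on [Re z^n]. *)
Inductive harmonic_polynomial : (R -> R -> R) -> Prop :=
| harmonic_polynomial_zpow n : harmonic_polynomial (fun x y => (zpow n x y).1)
| harmonic_polynomial_lin c u v :
    harmonic_polynomial u -> harmonic_polynomial v ->
    harmonic_polynomial (fun x y => u x y + c * v x y).

Lemma harmonic_polynomial_harmonic a u : harmonic_polynomial u -> axis_harmonic a u.
Proof.
elim=> [n|c v w _ IHv _ IHw]; first exact: axis_harmonic_zpow.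
exact: axis_harmonic_lin.
Qed.

Lemma continuous_circle u a : 1 < a -> axis_harmonic a u ->
  continuous (fun t : R => u (sin t) (cos t)).
Proof.
move=> a1 [cu _] t.
have h : (sin t) ^+ 2 + (cos t) ^+ 2 < a ^+ 2 by rewrite addrC cos2Dsin2; nra.
exact: (@continuous_comp2 R _ u sin cos t (cu _ _ h) (@continuous_sin R t)
  (@continuous_cos R t)).
Qed.

Lemma harmonic_polynomial_poisson u x : -1 < x < 1 -> harmonic_polynomial u ->
  arc_integral (fun t => poisson_kernel x t * u (sin t) (cos t)) = pi * u x 0.
Proof.
move=> x1; elim=> [n|c v w hv IHv hw IHw].
  by rewrite arc_integral_poisson_zpow// (zpow_real n x).1.
have a12 : 1 < 2 :> R by rewrite ltr1n.
have cP := continuous_poisson_kernel x1.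
have cv := continuousM_fun cP (continuous_circle a12 (harmonic_polynomial_harmonic 2 hv)).
have cw := continuousM_fun cP (continuous_circle a12 (harmonic_polynomial_harmonic 2 hw)).
rewrite mulrDr -IHv mulrCA -IHw -(arc_integral_lin c cv cw).
by congr arc_integral; apply/funext => t; ring.
Qed.

(** On the circle [x Re z^n] is the mean of [Re z^(n + 1)] and [Re z^(n - 1)], so
    that all polynomials in [x] are reached. *)
Lemma harmonic_polynomial_mulx u : harmonic_polynomial u ->
  exists2 v, harmonic_polynomial v &
    forall x y, x ^+ 2 + y ^+ 2 = 1 -> v x y = x * u x y.
Proof.
elim=> [[|n]|c v w _ [v' hv' v'E] _ [w' hw' w'E]].
- exists (fun x y => (zpow 1 x y).1); first exact: harmonic_polynomial_zpow.
  by move=> x y _ /=; ring.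
- exists (fun x y => (zpow n x y).1 +
    2^-1 * ((zpow n.+2 x y).1 + (-1) * (zpow n x y).1)).
    by do 2!(apply: harmonic_polynomial_lin; first exact: harmonic_polynomial_zpow);
      exact: harmonic_polynomial_zpow.
  by move=> x y xy; rewrite zpow_chebyshev//; field.
- exists (fun x y => v' x y + c * w' x y); first exact: harmonic_polynomial_lin.
  by move=> x y xy; rewrite v'E// w'E//; ring.
Qed.

Lemma harmonic_polynomial_horner (p : {poly R}) :
  exists2 u, harmonic_polynomial u &
    forall x y, x ^+ 2 + y ^+ 2 = 1 -> u x y = p.[x].
Proof.
elim/poly_ind: p => [|p c [u hu uE]].
  exists (fun x y => (zpow 0 x y).1 + (-1) * (zpow 0 x y).1).
    by apply: harmonic_polynomial_lin; exact: harmonic_polynomial_zpow.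
  by move=> x y _ /=; rewrite horner0; ring.
have [v hv vE] := harmonic_polynomial_mulx hu.
exists (fun x y => v x y + c * (zpow 0 x y).1).
  by apply: harmonic_polynomial_lin => //; exact: harmonic_polynomial_zpow.
by move=> x y xy; rewrite vE// uE// !hornerE/=; ring.
Qed.

(** An even function on the circle is a continuous function of [x] alone, and the
    segment [[-1, 1]] is rescaled to [[0, 1]] for the theorem of Weierstrass. *)
Lemma harmonic_polynomial_approx a u e : 1 < a -> axis_harmonic a u ->
  (forall x y, u x (- y) = u x y) -> 0 < e ->
  exists2 v, harmonic_polynomial v &
    forall x y, x ^+ 2 + y ^+ 2 = 1 -> `|u x y - v x y| <= e.
Proof.
move=> a1 hu ueven e0.
pose h (s : R) := u (2 * s - 1) (Num.sqrt (1 - (2 * s - 1) ^+ 2)).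
have ch : {within `[0, 1], continuous h}.
  apply: continuous_in_subspaceT => s; rewrite inE/= in_itv/= => s01.
  have c1 : {for s, continuous (fun s : R => 2 * s - 1)}.
    by apply: (@is_derive_continuous _ _ _ 2); derive; ring.
  have c2 : {for s, continuous (fun s : R => Num.sqrt (1 - (2 * s - 1) ^+ 2))}.
    apply: (@continuous_comp _ _ _ (fun s : R => 1 - (2 * s - 1) ^+ 2) Num.sqrt).
      apply: (@is_derive_continuous _ _ _ (- (4 * (2 * s - 1)))).
      by rewrite (_ : (fun _ => _) = (fun s : R => 1 - (2 * s - 1) * (2 * s - 1)));
        [derive; rewrite /=; ring|apply/funext => r; ring].
    exact: sqrt_continuous.
  have xy : (2 * s - 1) ^+ 2 + (Num.sqrt (1 - (2 * s - 1) ^+ 2)) ^+ 2 < a ^+ 2.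
    by rewrite sqr_sqrtr; nra.
  exact: (@continuous_comp2 R _ u _ _ s (hu.1 _ _ xy) c1 c2).
have [p hp] := weierstrass e0 ch.
have [v hv vE] := harmonic_polynomial_horner (p \Po (2^-1 *: ('X + 1))).
exists v => // x y xy; rewrite vE// horner_comp !hornerE.
have -> : u x y = h (2^-1 * (x + 1)).
  have E1 : 2 * (2^-1 * (x + 1)) - 1 = x by field.
  have E2 : Num.sqrt (1 - x ^+ 2) = `|y| by rewrite -xy addrAC subrr add0r sqrtr_sqr.
  rewrite /h E1 E2; have [y0|y0] := leP 0 y; first by rewrite ger0_norm.
  by rewrite ltr0_norm// ueven.
by apply: hp; apply/andP; split; nra.
Qed.

(** The Poisson formula on the real diameter for functions even in [y]: both
    sides are continuous for the uniform norm on the disk, by the maximum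
    principle, and agree on harmonic polynomials. *)
Lemma poisson_formula_even a u x : 1 < a -> axis_harmonic a u ->
  (forall x y, u x (- y) = u x y) -> -1 < x < 1 ->
  arc_integral (fun t => poisson_kernel x t * u (sin t) (cos t)) = pi * u x 0.
Proof.
move=> a1 hu ueven x1; have pi0 := pi_gt0 R.
set A := arc_integral _.
suff AB e : 0 < e -> `|A - pi * u x 0| <= e.
  apply/eqP; rewrite -subr_eq0 -normr_le0.
  by apply/ler_addgt0Pr => e e0; rewrite add0r; exact: AB.
move=> e0; pose d := e / (2 * pi).
have d0 : 0 < d by rewrite divr_gt0// mulr_gt0.
have [v hv uv] := harmonic_polynomial_approx a1 hu ueven d0.
have hva := harmonic_polynomial_harmonic a hv.
have disk : x ^+ 2 + 0 ^+ 2 <= 1 by rewrite expr0n addr0; have /andP[? ?] := x1; nra.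
have le1 : u x 0 + (-1) * v x 0 <= d.
  apply: (maximum_principle a1 (axis_harmonic_lin (-1) hu hva)) disk => s t st.
  by have := uv s t st; rewrite ler_norml => /andP[_]; lra.
have le2 : v x 0 + (-1) * u x 0 <= d.
  apply: (maximum_principle a1 (axis_harmonic_lin (-1) hva hu)) disk => s t st.
  by have := uv s t st; rewrite ler_norml => /andP[+ _]; lra.
have cP := continuous_poisson_kernel x1.
have cu := continuousM_fun cP (continuous_circle a1 hu).
have cv := continuousM_fun cP (continuous_circle a1 hva).
have lin (w : R -> R) : continuous w -> continuous (fun t => w t + d * poisson_kernel x t).
  by move=> cw t; apply: cvgD; [exact: cw|
    exact: (@continuousM_fun R (cst d) _ (@cst_continuous _ _ d) cP t)].
have K0 t := poisson_kernel_ge0 t x1.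
have st t : sin t ^+ 2 + cos t ^+ 2 = 1 :> R by rewrite addrC cos2Dsin2.
have le3 : A <= pi * v x 0 + d * pi.
  rewrite -(harmonic_polynomial_poisson x1 hv) -(arc_integral_poisson x1).
  rewrite -arc_integral_lin//; apply: le_arc_integral => //; first exact: lin.
  move=> t _; have := uv _ _ (st t); rewrite ler_norml => /andP[_]; have := K0 t.
  by move: (poisson_kernel x t) (u _ _) (v _ _) => P U V; nra.
have le4 : pi * v x 0 <= A + d * pi.
  rewrite -(harmonic_polynomial_poisson x1 hv) -(arc_integral_poisson x1).
  rewrite -arc_integral_lin//; apply: le_arc_integral => //; first exact: lin.
  move=> t _; have := uv _ _ (st t); rewrite ler_norml => /andP[+ _]; have := K0 t.
  by move: (poisson_kernel x t) (u _ _) (v _ _) => P U V; nra.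
have dE : e = 2 * (d * pi) by rewrite mulrCA /d divfK// mulf_neq0// lt0r_neq0.
have le5 : pi * (u x 0 + (-1) * v x 0) <= d * pi by rewrite mulrC ler_pM2r.
have le6 : pi * (v x 0 + (-1) * u x 0) <= d * pi by rewrite mulrC ler_pM2r.
rewrite dE ler_norml; move: le3 le4 le5 le6; rewrite !mulrDr.
by move: A (u x 0) (v x 0) (d * pi) => B U V D *; apply/andP; split; lra.
Qed.

End poisson_formula.

(** * Powers of non-vanishing analytic functions *)

Section log_pairs.
Context {R : realType}.
Implicit Types (L phi : R -> R -> R) (x y a s rho : R).

(** [L + i phi] is a branch of the logarithm of an analytic function [w] on the
    disk of radius [a]: [A + i B] is [w' / w] and [C + i D] its derivative. *)
Definition log_pair a L phi : Prop :=
  exists A B C D : R -> R -> R, forall x y, x ^+ 2 + y ^+ 2 < a ^+ 2 ->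
  [/\ {for (x, y), continuous (fun w : R * R => L w.1 w.2)} /\
      {for (x, y), continuous (fun w : R * R => phi w.1 w.2)},
      is_derive x 1 (L ^~ y) (A x y) /\ is_derive x 1 (phi ^~ y) (B x y),
      is_derive y 1 (L x) (- B x y) /\ is_derive y 1 (phi x) (A x y),
      is_derive x 1 (A ^~ y) (C x y) /\ is_derive x 1 (B ^~ y) (D x y) &
      is_derive y 1 (A x) (- D x y) /\ is_derive y 1 (B x) (C x y)].

Lemma log_pair_lin a c L1 phi1 L2 phi2 :
  log_pair a L1 phi1 -> log_pair a L2 phi2 ->
  log_pair a (fun x y => L1 x y + c * L2 x y)
             (fun x y => phi1 x y + c * phi2 x y).
Proof.
move=> [A1 [B1 [C1 [D1 H1]]]] [A2 [B2 [C2 [D2 H2]]]].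
exists (fun x y => A1 x y + c * A2 x y), (fun x y => B1 x y + c * B2 x y),
  (fun x y => C1 x y + c * C2 x y), (fun x y => D1 x y + c * D2 x y) => x y xy.
have [[a1 a2] [a3 a4] [a5 a6] [a7 a8] [a9 a10]] := H1 x y xy.
have [[b1 b2] [b3 b4] [b5 b6] [b7 b8] [b9 b10]] := H2 x y xy.
have N (u v : R) : - (u + c * v) = - u + c * - v by ring.
split; split; rewrite ?N; try exact: is_derive_lin.
- apply: cvgD; first exact: a1.
  by apply: cvgM; [exact: cst_continuous|exact: b1].
- apply: cvgD; first exact: a2.
  by apply: cvgM; [exact: cst_continuous|exact: b2].
Qed.

(** The function is the real part of [w ^ s], which is analytic. *)
Lemma log_pair_harmonic a L phi s : log_pair a L phi ->
  axis_harmonic a (fun x y => expR (s * L x y) * cos (s * phi x y)).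
Proof.
move=> [A [B [C [D H]]]]; split.
  move=> x y /H[[cL cphi] _ _ _ _]; apply: cvgM.
    apply: (@continuous_comp _ _ _ (fun w : R * R => s * L w.1 w.2) expR).
      by apply: cvgM; [exact: cst_continuous|exact: cL].
    exact: continuous_expR.
  apply: (@continuous_comp _ _ _ (fun w : R * R => s * phi w.1 w.2) cos).
    by apply: cvgM; [exact: cst_continuous|exact: cphi].
  exact: continuous_cos.
pose u x y := expR (s * L x y) * cos (s * phi x y).
pose v x y := expR (s * L x y) * sin (s * phi x y).
pose ux x y := s * (A x y * u x y - B x y * v x y).
pose vx x y := s * (A x y * v x y + B x y * u x y).
pose uy x y := s * (- B x y * u x y - A x y * v x y).
pose vy x y := s * (- B x y * v x y + A x y * u x y).
exists ux, (fun x y => s * (C x y * u x y + A x y * ux x y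
                     - (D x y * v x y + B x y * vx x y))), uy,
  (fun x y => s * (- C x y * u x y - B x y * uy x y
                     - (- D x y * v x y + A x y * vy x y))) => x y xy.
have [_ [Lx phix] [Ly phiy] [Ax Bx] [Ay By]] := H x y xy.
have hux : is_derive x 1 (u ^~ y) (ux x y) by rewrite /u /ux /u /v; derive; ring.
have hvx : is_derive x 1 (v ^~ y) (vx x y) by rewrite /v /vx /u /v; derive; ring.
have huy : is_derive y 1 (u x) (uy x y) by rewrite /u /uy /u /v; derive; ring.
have hvy : is_derive y 1 (v x) (vy x y) by rewrite /v /vy /u /v; derive; ring.
split => //.
- by rewrite {1}/ux; derive; ring.
- by rewrite {1}/uy; derive; ring.
- by rewrite /ux /vx /uy /vy; ring.
Qed.

Section one_minus_rho_sqr.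
Variable rho : R.

(** The two parts of [1 - rho z^2], its squared modulus and the two parts of its
    principal logarithm; [|rho| < 1] keeps the zeros off the closed disk. *)
Definition quad_re x y := 1 - rho * (x * x - y * y).
Definition quad_im x y := - (2 * rho * x * y).
Definition quad_norm2 x y := quad_re x y * quad_re x y + quad_im x y * quad_im x y.
Definition quad_ln x y := 2^-1 * ln (quad_norm2 x y).
Definition quad_arg x y := atan (quad_im x y * (quad_re x y)^-1).

Lemma quad_re_gt0 a x y : a ^+ 2 * `|rho| <= 1 -> x ^+ 2 + y ^+ 2 < a ^+ 2 ->
  0 < quad_re x y.
Proof.
move=> arho xy; rewrite /quad_re subr_gt0.
have x2 := sqr_ge0 x; have y2 := sqr_ge0 y.
rewrite -!expr2; move: (x ^+ 2) (y ^+ 2) (a ^+ 2) x2 y2 xy arho => X Y A X0 Y0 XY.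
have [r0|r0|->] := ltgtP rho 0; last by rewrite mul0r.
- rewrite ltr0_norm// => arho; have := mulr_gt0 (_ : 0 < - rho) (_ : 0 < A - (X + Y)).
  by rewrite oppr_gt0 subr_gt0 => /(_ r0 XY); nra.
- rewrite gtr0_norm// => arho; have := mulr_gt0 r0 (_ : 0 < A - (X + Y)).
  by rewrite subr_gt0 => /(_ XY); nra.
Qed.

Lemma log_pair_quad a : a ^+ 2 * `|rho| <= 1 -> log_pair a quad_ln quad_arg.
Proof.
move=> arho.
pose A x y := - (2 * rho) * (x * quad_re x y + y * quad_im x y) * (quad_norm2 x y)^-1.
pose B x y := - (2 * rho) * (y * quad_re x y - x * quad_im x y) * (quad_norm2 x y)^-1.
exists A, B,
  (fun x y => - (2 * rho) * quad_re x y * (quad_norm2 x y)^-1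
              - (A x y * A x y - B x y * B x y)),
  (fun x y => 2 * rho * quad_im x y * (quad_norm2 x y)^-1
              - 2 * A x y * B x y) => x y xy.
have X0 := quad_re_gt0 arho xy.
have N0 : 0 < quad_norm2 x y by rewrite /quad_norm2; nra.
have X0' := lt0r_neq0 X0; have N0' := lt0r_neq0 N0.
have Rx : is_derive x 1 (quad_re ^~ y) (- (2 * rho * x)) by rewrite /quad_re; derive; ring.
have Ry : is_derive y 1 (quad_re x) (2 * rho * y) by rewrite /quad_re; derive; ring.
have Ix : is_derive x 1 (quad_im ^~ y) (- (2 * rho * y)) by rewrite /quad_im; derive; ring.
have Iy : is_derive y 1 (quad_im x) (- (2 * rho * x)) by rewrite /quad_im; derive; ring.
have Nx : is_derive x 1 (quad_norm2 ^~ y)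
    (- (4 * rho) * (x * quad_re x y + y * quad_im x y)) by rewrite /quad_norm2; derive; ring.
have Ny : is_derive y 1 (quad_norm2 x)
    (4 * rho * (y * quad_re x y - x * quad_im x y)) by rewrite /quad_norm2; derive; ring.
have Nix : is_derive x 1 (fun x => (quad_norm2 x y)^-1)
    (- (- (4 * rho) * (x * quad_re x y + y * quad_im x y)) / quad_norm2 x y ^+ 2).
  exact: is_derive_invf.
have Niy : is_derive y 1 (fun y => (quad_norm2 x y)^-1)
    (- (4 * rho * (y * quad_re x y - x * quad_im x y)) / quad_norm2 x y ^+ 2).
  exact: is_derive_invf.
have atanE : (1 + (quad_im x y * (quad_re x y)^-1) ^+ 2)^-1 =
    quad_re x y ^+ 2 / quad_norm2 x y.
  rewrite /quad_norm2; field; by rewrite X0' andbT; exact: N0'.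
have lnx := @is_derive_compf R (@ln R) (quad_norm2 ^~ y) x _ _ (is_derive1_ln N0) Nx.
have lny := @is_derive_compf R (@ln R) (quad_norm2 x) y _ _ (is_derive1_ln N0) Ny.
have Rix := @is_derive_invf R (quad_re ^~ y) x _ X0' Rx.
have Riy := @is_derive_invf R (quad_re x) y _ X0' Ry.
have c1 : {for (x, y), continuous (fun w : R * R => w.1)} by exact: cvg_fst.
have c2 : {for (x, y), continuous (fun w : R * R => w.2)} by exact: cvg_snd.
have cX : {for (x, y), continuous (fun w : R * R => quad_re w.1 w.2)}.
  apply: cvgB; first exact: cst_continuous.
  apply: cvgM; first exact: cst_continuous.
  by apply: cvgB; apply: cvgM.
have cY : {for (x, y), continuous (fun w : R * R => quad_im w.1 w.2)}.
  apply: cvgN; apply: cvgM => //; apply: cvgM => //; exact: cst_continuous.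
have cN : {for (x, y), continuous (fun w : R * R => quad_norm2 w.1 w.2)}.
  by apply: cvgD; apply: cvgM.
split; split.
- apply: cvgM; first exact: cst_continuous.
  apply: (@continuous_comp _ _ _ (fun w : R * R => quad_norm2 w.1 w.2) (@ln R)) => //.
  exact: continuous_ln.
- apply: (@continuous_comp _ _ _
    (fun w : R * R => quad_im w.1 w.2 * (quad_re w.1 w.2)^-1) (@atan R)).
    by apply: cvgM => //; apply: cvgV.
  exact: continuous_atan.
- by rewrite /quad_ln; derive; rewrite /A; field.
- by rewrite /quad_arg; derive; rewrite atanE /B; field; rewrite N0' X0'.
- by rewrite /quad_ln; derive; rewrite /B; field.
- by rewrite /quad_arg; derive; rewrite atanE /A; field; rewrite N0' X0'.
- by rewrite {1}/A; derive; rewrite /A /B /quad_norm2; field; exact: N0'.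
- by rewrite {1}/B; derive; rewrite /A /B /quad_norm2; field; exact: N0'.
- by rewrite {1}/A; derive; rewrite /A /B /quad_norm2; field; exact: N0'.
- by rewrite {1}/B; derive; rewrite /A /B /quad_norm2; field; exact: N0'.
Qed.

End one_minus_rho_sqr.
End log_pairs.

(** * Sharp integral estimates on the half circle *)

Section critical_integrals.
Context {R : realType}.
Local Notation mu := (@lebesgue_measure R).
Implicit Types (x y s t rho : R).

Lemma continuous_measurable_EFin (D : set R) (g : R -> R) : continuous g ->
  measurable_fun D (fun t => (g t)%:E).
Proof.
move=> cg; apply: (iffRL (@measurable_EFinP _ _ R D g)).
by apply: measurable_funTS; exact: continuous_measurable_fun.
Qed.

Lemma fatou_le (D : set R) (f : nat -> R -> R) (g : R -> R) (c : \bar R) :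
  measurable D -> (forall n, measurable_fun D (f n)) ->
  (forall n t, D t -> 0 <= f n t) ->
  (forall t, D t -> f ^~ t @ \oo --> g t) ->
  (forall n, (\int[mu]_(t in D) (f n t)%:E <= c)%E) ->
  (\int[mu]_(t in D) (g t)%:E <= c)%E.
Proof.
move=> mD mf f0 fg fc.
have gE t : t \in D -> (g t)%:E = limn_einf (fun n => (f n t)%:E).
  rewrite inE => Dt; apply/esym.
  have fgE : (f n t)%:E @[n --> \oo] --> (g t)%:E.
    by apply: cvg_EFin; [exact: nearW|exact: fg].
  by have [-> _] := cvg_limn_einf_sup fgE.
have -> : (\int[mu]_(t in D) (g t)%:E =
           \int[mu]_(t in D) limn_einf (fun n => (f n t)%:E))%E.
  exact: eq_integral.
have mfE n : measurable_fun D (fun t => (f n t)%:E) by apply: (iffRL (@measurable_EFinP _ _ R D (f n))); exact: mf.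
have f0E n t : D t -> (0 <= (f n t)%:E)%E by move=> Dt; rewrite lee_fin f0.
apply: le_trans (@fatou _ _ R mu D mD _ mfE f0E) _.
rewrite limn_einf_lim; apply: lime_le; first exact: is_cvg_einfs.
apply: nearW => n; apply: le_trans (fc n).
by apply: ereal_inf_lbound; exists n => /=.
Qed.

Lemma cos_scale_ge s t : 0 <= s <= 1 -> `|t| <= pi / 2 ->
  cos (s * (pi / 2)) <= cos (s * t).
Proof.
move=> /andP[s0 s1] tpi; have pi0 := pi_gt0 R.
rewrite -(cos_norm (s * t)) normrM (ger0_norm s0).
have t0 := normr_ge0 t.
rewrite leNgt ltr_cos ?in_itv/= -?leNgt.
- by rewrite ler_wpM2l.
- by apply/andP; split; nra.
- by apply/andP; split; nra.
Qed.

Lemma cos_scale_gt0 s : 0 < s < 1 -> 0 < cos (s * (pi / 2)) :> R.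
Proof.
move=> /andP[s0 s1]; have pi0 := pi_gt0 R.
by apply: cos_gt0_pihalf; apply/andP; split; nra.
Qed.

(** [atan q1 + atan q2] stays in the quarter plane when [q1 q2 <= 1], because
    its cosine is a positive multiple of [1 - q1 q2]. *)
Lemma atan_add_le q1 q2 : 0 <= q1 * q2 <= 1 -> `|atan q1 + atan q2 : R| <= pi / 2.
Proof.
have pi0 := pi_gt0 R.
wlog q10 : q1 q2 / 0 <= q1.
  move=> H q12; have [q10|q10] := leP 0 q1; first exact: H.
  rewrite -normrN opprD -!atanN; apply: H; first by rewrite oppr_ge0 ltW.
  by rewrite mulrNN.
move=> /andP[q12 q12'].
have [q20|q20] := leP 0 q2; last first.
  have -> : q1 = 0 by nra.
  rewrite atan0 add0r ltr0_norm; first by have := atan_gtNpi2 q2; lra.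
  by rewrite -(@atan0 R) lt_atan.
have a1 : 0 <= atan q1 by rewrite -(@atan0 R) le_atan.
have a2 : 0 <= atan q2 by rewrite -(@atan0 R) le_atan.
rewrite ger0_norm ?addr_ge0// leNgt; apply/negP => gt.
have h1 := atan_ltpi2 q1; have h2 := atan_ltpi2 q2.
have c1 : 0 < cos (atan q1) by apply: cos_gt0_pihalf; apply/andP; split; lra.
have c2 : 0 < cos (atan q2) by apply: cos_gt0_pihalf; apply/andP; split; lra.
have : cos (atan q1 + atan q2) < 0.
  rewrite (_ : _ + _ = (atan q1 + atan q2 - pi / 2) + pi / 2); last by ring.
  rewrite cosDpihalf oppr_lt0; apply: sin_gt0_pihalf.
  by apply/andP; split; lra.
rewrite cosD.
have sE q : 0 < cos (atan q) -> sin (atan q) = q * cos (atan q) :> R.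
  by move=> c0; rewrite -{2}(atanK q) /tan divfK// lt0r_neq0.
rewrite (sE q1)// (sE q2)//.
have -> : cos (atan q1) * cos (atan q2) - q1 * cos (atan q1) * (q2 * cos (atan q2)) =
  cos (atan q1) * cos (atan q2) * (1 - q1 * q2) by ring.
by rewrite ltNge mulr_ge0// ?mulr_ge0 ?subr_ge0// ltW.
Qed.

(** A radius beyond the unit circle within which [1 - rho z^2] has positive real
    part. *)
Lemma exists_radius rho : 0 < rho < 1 -> exists2 a : R, 1 < a & a ^+ 2 * rho <= 1.
Proof.
move=> /andP[r0 r1]; exists (2 / (1 + rho)).
  by rewrite ltr_pdivlMr; lra.
have r2 : 0 < (1 + rho) ^+ 2 by rewrite exprn_gt0//; lra.
by rewrite expr_div_n mulrAC ler_pdivrMr//; nra.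
Qed.

Lemma quad_norm2_circle rho t :
  quad_norm2 rho (sin t) (cos t) = (1 - rho) ^+ 2 + 4 * rho * cos t ^+ 2.
Proof.
rewrite (_ : quad_norm2 _ _ _ = (1 - rho * (sin t ^+ 2 - cos t ^+ 2)) ^+ 2
  + 4 * rho ^+ 2 * sin t ^+ 2 * cos t ^+ 2); last first.
  by rewrite /quad_norm2 /quad_re /quad_im; ring.
by rewrite sin2cos2; ring.
Qed.

Lemma log_pair_circle a L phi s : 1 < a -> log_pair a L phi ->
  continuous (fun t : R => expR (s * L (sin t) (cos t))).
Proof.
move=> a1 [A [B [C [D H]]]] t.
have h : (sin t) ^+ 2 + (cos t) ^+ 2 < a ^+ 2 by rewrite addrC cos2Dsin2; nra.
have [[cL _] _ _ _ _] := H _ _ h.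
have cLt := @continuous_comp2 R _ L sin cos t cL (@continuous_sin R t)
  (@continuous_cos R t).
apply: (@continuous_comp _ _ _ (fun t : R => s * L (sin t) (cos t)) expR).
  by apply: cvgM; [exact: cst_continuous|exact: cLt].
exact: continuous_expR.
Qed.

(** The mechanism behind both sharp estimates: if [|arg w| <= pi / 2] on the
    upper half circle then [cos (s pi / 2) |w|^s <= Re (w^s)] there, and the
    Poisson integral of the right-hand side is [pi] times its value at [x], which
    is [|w|^s] because the odd function [arg w] vanishes on the diameter. *)
Lemma log_pair_poisson_le a L phi s x : 1 < a -> log_pair a L phi ->
  0 < `|s| < 1 -> -1 < x < 1 ->
  (forall x y, L x (- y) = L x y) -> (forall x y, phi x (- y) = - phi x y) ->
  (forall t, - (pi / 2) <= t <= pi / 2 -> `|phi (sin t) (cos t)| <= pi / 2) ->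
  cos (`|s| * (pi / 2)) *
    arc_integral (fun t => poisson_kernel x t * expR (s * L (sin t) (cos t))) <=
  pi * expR (s * L x 0).
Proof.
move=> a1 Lphi /andP[s0 s1] x1 Leven phiodd phile.
have hu := log_pair_harmonic s Lphi.
have phi0 : phi x 0 = 0 by have := phiodd x 0; rewrite oppr0; lra.
have cP := continuous_poisson_kernel x1.
have cE := continuousM_fun cP (log_pair_circle (s := s) a1 Lphi).
have cu := continuousM_fun cP (continuous_circle a1 hu).
have := poisson_formula_even a1 hu _ x1.
rewrite phi0 mulr0 cos0 mulr1 => <-; last first.
  by move=> u v; rewrite Leven phiodd mulrN cosN.
rewrite -arc_integralZ//; apply: le_arc_integral => //.
  by move=> t; apply: cvgM; [exact: cst_continuous|exact: cE].
move=> t tpi; rewrite mulrCA; apply: ler_wpM2l; first exact: poisson_kernel_ge0.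
rewrite mulrC; apply: ler_wpM2l; first exact: expR_ge0.
rewrite -(cos_norm (s * _)) normrM.
have h : `| `|phi (sin t) (cos t)| | <= pi / 2 by rewrite normr_id; exact: phile.
by apply: cos_scale_ge h; rewrite !ltW.
Qed.

Lemma quad_argN rho x y : quad_arg rho x (- y) = - quad_arg rho x y.
Proof. by rewrite /quad_arg -atanN -mulNr /quad_re /quad_im; congr (atan (_ * _^-1)); ring. Qed.

Lemma quad_lnN rho x y : quad_ln rho x (- y) = quad_ln rho x y.
Proof.
by rewrite /quad_ln /quad_norm2 /quad_re /quad_im; congr (_ * ln _); ring.
Qed.

Let rhon (n : nat) : R := 1 - n.+2%:R^-1.

Let rhon01 n : 0 < rhon n < 1.
Proof.
rewrite /rhon subr_gt0 invf_lt1// ltr1n/=.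
by rewrite ltrBlDr ltrDl invr_gt0.
Qed.

Let rhon_cvg : rhon @ \oo --> (1 : R).
Proof.
rewrite -[X in _ --> X]subr0; apply: cvgB; first exact: cvg_cst.
rewrite (_ : (fun n => _) = (fun n => harmonic n.+1))//.
by have := @cvg_harmonic R; rewrite -cvg_shiftS.
Qed.

Definition open_arc : set R := `]- (pi / 2), pi / 2[%classic.

Lemma open_arc_integral (g : R -> R) : continuous g ->
  (\int[mu]_(t in open_arc) (g t)%:E = (arc_integral g)%:E)%E.
Proof.
move=> cg; rewrite /arc_integral /Rintegral fineK; last first.
  by apply: integrable_fin_num; [exact: measurable_arc|exact: arc_integrable].
by apply/esym/integral_itv_bndoo; exact: continuous_measurable_EFin.
Qed.

Lemma open_arc_cos_gt0 t : open_arc t -> 0 < cos t.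
Proof. by rewrite /open_arc/= in_itv/= => /cos_gt0_pihalf. Qed.

Lemma quad_arg_le rho x y : `|quad_arg rho x y| <= pi / 2.
Proof.
by rewrite ler_norml; apply/andP; split; apply/ltW;
  [exact: atan_gtNpi2|exact: atan_ltpi2].
Qed.

Lemma quad_ln_real rho x : 0 < 1 - rho * x ^+ 2 ->
  quad_ln rho x 0 = ln (1 - rho * x ^+ 2).
Proof.
move=> h; rewrite /quad_ln (_ : quad_norm2 _ _ _ = (1 - rho * x ^+ 2) ^+ 2).
  by rewrite lnXn// -[ln _ *+ 2]mulr_natl; field.
by rewrite /quad_norm2 /quad_re /quad_im; ring.
Qed.

Lemma quad_ln_circle_cvg t : 0 < cos t ->
  (fun n => quad_ln (rhon n) (sin t) (cos t)) @ \oo --> ln (2 * cos t).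
Proof.
move=> c0; have c2 : 0 < 2 * cos t by rewrite mulr_gt0.
rewrite (_ : ln (2 * cos t) = 2^-1 * ln ((2 * cos t) ^+ 2)); last first.
  by rewrite lnXn// -[ln _ *+ 2]mulr_natl; field.
apply: cvgM; first exact: cvg_cst.
have h : (fun n => quad_norm2 (rhon n) (sin t) (cos t)) @ \oo --> (2 * cos t) ^+ 2.
  rewrite (_ : (fun n => _) = (fun n => (1 - rhon n) * (1 - rhon n) +
      4 * cos t ^+ 2 * rhon n)); last first.
    by apply/funext => n; rewrite quad_norm2_circle; ring.
  rewrite (_ : (2 * cos t) ^+ 2 = (1 - 1) * (1 - 1) + 4 * cos t ^+ 2 * 1); last by ring.
  have h1 : (fun n => 1 - rhon n) @ \oo --> (1 - 1 : R).
    by apply: cvgB; [exact: cvg_cst|exact: rhon_cvg].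
  apply: cvgD; first exact: cvgM.
  by apply: cvgM; [exact: cvg_cst|exact: rhon_cvg].
apply: (@continuous_cvg _ _ _ _ _ (fun n => quad_norm2 (rhon n) (sin t) (cos t)) (@ln R)) => //.
by apply: continuous_ln; rewrite exprn_gt0.
Qed.

(** [log_pair_poisson_le] with [w = 1 - rho z^2] and exponent [- s]. On the half
    circle [|w|] tends to [|1 - z^2| = 2 cos t] as [rho] tends to 1, where Fatou's
    lemma applies; on the diameter [w >= 1 - x^2]. *)
Lemma poisson_powR_le s x : 0 < s < 1 -> -1 < x < 1 ->
  (\int[mu]_(t in open_arc)
     (poisson_kernel x t * (2 * cos t) `^ (- s))%:E <=
   (pi / cos (s * (pi / 2)) * (1 - x ^+ 2) `^ (- s))%:E)%E.
Proof.
move=> s01 x1; have pi0 := pi_gt0 R; have [s0 s1] := andP s01.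
have c0 := cos_scale_gt0 s01.
have cP := continuous_poisson_kernel x1.
have x2 : 0 < 1 - x ^+ 2 by have /andP[? ?] := x1; nra.
pose f n t := poisson_kernel x t * expR ((- s) * quad_ln (rhon n) (sin t) (cos t)).
have cf n : continuous (f n).
  have [a a1 ar] := exists_radius (rhon01 n).
  have r0 : 0 < rhon n by have /andP[] := rhon01 n.
  have lp := @log_pair_quad R (rhon n) a ltac:(by rewrite gtr0_norm).
  exact: continuousM_fun cP (log_pair_circle a1 lp).
apply: (@fatou_le open_arc f) => [||n t _|t tD|n].
- exact: measurable_itv.
- by move=> n; apply: measurable_funTS; exact: continuous_measurable_fun.
- by rewrite mulr_ge0// ?expR_ge0// poisson_kernel_ge0.
- have ct := open_arc_cos_gt0 tD.
  apply: cvgM; first exact: cvg_cst.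
  rewrite /powR gt_eqF ?mulr_gt0//.
  apply: (@continuous_cvg _ _ _ _ _ (fun n => - s * quad_ln (rhon n) (sin t) (cos t)) (@expR R)).
    exact: continuous_expR.
  by apply: cvgM; [exact: cvg_cst|exact: quad_ln_circle_cvg].
have /andP[r0 r1] := rhon01 n.
have [a a1 ar] := exists_radius (rhon01 n).
have lp := @log_pair_quad R (rhon n) a ltac:(by rewrite gtr0_norm).
have := log_pair_poisson_le (s := - s) a1 lp _ x1 (quad_lnN _) (quad_argN _)
  (fun t _ => quad_arg_le _ _ _).
rewrite normrN gtr0_norm// => /(_ s01) le.
rewrite open_arc_integral// lee_fin mulrAC ler_pdivlMr// mulrC.
apply: le_trans le _; apply: ler_wpM2l; first exact: ltW.
have rx : 1 - x ^+ 2 <= 1 - rhon n * x ^+ 2.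
  by rewrite lerD2l lerN2 ler_piMl ?sqr_ge0// ltW.
rewrite quad_ln_real ?(lt_le_trans x2)// /powR gt_eqF// ler_expR !mulNr lerN2.
apply: ler_wpM2l; first exact: ltW.
by rewrite ler_ln// posrE (lt_le_trans x2).
Qed.

Lemma quad_norm2_swap rho x y : quad_norm2 rho (- x) y = quad_norm2 rho x y.
Proof. by rewrite /quad_norm2 /quad_re /quad_im; ring. Qed.

(** On the circle [(1 - z^2) / (1 + z^2)] has modulus [|cot t|]; its real part is
    positive in the disk and its value at the origin, where the Poisson kernel is
    constant, is 1. Symmetry in [t] gives the factor 2. *)
Lemma cot_powR_le s (u v : R) : 0 < s < 1 -> 0 < u -> u <= v -> v < pi / 2 ->
  (\int[mu]_(t in `[u, v]) ((cos t / sin t) `^ s)%:E <=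
   (pi / (2 * cos (s * (pi / 2))))%:E)%E.
Proof.
move=> s01 u0 uv vpi; have pi0 := pi_gt0 R; have [s0 s1] := andP s01.
have c0 := cos_scale_gt0 s01.
pose L n x y := quad_ln (rhon n) x y + (-1) * quad_ln (- rhon n) x y.
pose phi n x y := quad_arg (rhon n) x y + (-1) * quad_arg (- rhon n) x y.
pose f n t := expR (s * L n (sin t) (cos t)).
have lp n : exists2 a, 1 < a & log_pair a (L n) (phi n).
  have [a a1 ar] := exists_radius (rhon01 n); exists a => //.
  have r0 : 0 < rhon n by have /andP[] := rhon01 n.
  by apply: log_pair_lin; apply: log_pair_quad; rewrite ?normrN gtr0_norm.
have cf n : continuous (f n).
  by have [a a1 lpa] := lp n; exact: log_pair_circle a1 lpa.
have phile n t : `|phi n (sin t) (cos t)| <= pi / 2.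
  rewrite /phi mulN1r /quad_arg -atanN -mulNr; apply: atan_add_le.
  have [a a1 ar] := exists_radius (rhon01 n).
  have /andP[r0 r1] := rhon01 n.
  have st : sin t ^+ 2 + cos t ^+ 2 < a ^+ 2 by rewrite addrC cos2Dsin2; nra.
  have X1 : 0 < quad_re (rhon n) (sin t) (cos t).
    by apply: quad_re_gt0 st; rewrite gtr0_norm.
  have X2 : 0 < quad_re (- rhon n) (sin t) (cos t).
    by apply: quad_re_gt0 st; rewrite normrN gtr0_norm.
  have -> : - quad_im (- rhon n) (sin t) (cos t) = quad_im (rhon n) (sin t) (cos t).
    by rewrite /quad_im; ring.
  rewrite mulf_div divr_ge0 ?(mulr_ge0 (ltW X1) (ltW X2))/= -?expr2 ?sqr_ge0//=.
  rewrite ler_pdivrMr ?mulr_gt0// mul1r -subr_ge0.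
  have -> : quad_re (rhon n) (sin t) (cos t) * quad_re (- rhon n) (sin t) (cos t) -
     quad_im (rhon n) (sin t) (cos t) ^+ 2 =
     1 - rhon n ^+ 2 * (cos t ^+ 2 + sin t ^+ 2) ^+ 2.
    by rewrite /quad_re /quad_im; ring.
  by rewrite cos2Dsin2 expr1n mulr1; nra.
have feven n t : f n (- t) = f n t.
  by rewrite /f /L sinN cosN /quad_ln !quad_norm2_swap.
have fc n : cos (s * (pi / 2)) * arc_integral (f n) <= pi.
  have [a a1 lpa] := lp n.
  have x1 : -1 < (0 : R) < 1 by lra.
  have Leven x y : L n x (- y) = L n x y by rewrite /L !quad_lnN.
  have phiodd x y : phi n x (- y) = - phi n x y by rewrite /phi !quad_argN; ring.
  have := log_pair_poisson_le (s := s) a1 lpa _ x1 Leven phiodd (fun t _ => phile n t).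
  rewrite gtr0_norm// => /(_ s01).
  have -> : L n 0 0 = 0.
    have q0 r : quad_ln r 0 0 = 0 :> R.
      by rewrite quad_ln_real expr0n/= mulr0 subr0 ?ln1.
    by rewrite /L !q0 mulr0 addr0.
  rewrite mulr0 expR0 mulr1 (_ : (fun t => _) = f n)//.
  apply/funext => t.
  by rewrite /poisson_kernel expr0n/= mulr0 mul0r !subr0 addr0 divr1 mul1r.
have mf D n : measurable_fun D (fun t => (f n t)%:E).
  exact: continuous_measurable_EFin.
apply: (@fatou_le `[u, v] f) => [||n t _|t|n].
- exact: measurable_itv.
- by move=> n; apply: measurable_funTS; exact: continuous_measurable_fun.
- exact: expR_ge0.
- rewrite /= in_itv/= => /andP[ut tv].
  have ct : 0 < cos t by apply: cos_gt0_pihalf; lra.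
  have st : 0 < sin t by apply: sin_gt0_pihalf; lra.
  rewrite /powR gt_eqF ?divr_gt0//.
  apply: (@continuous_cvg _ _ _ _ _ (fun n => s * L n (sin t) (cos t)) (@expR R)).
    exact: continuous_expR.
  apply: cvgM; first exact: cvg_cst.
  rewrite (_ : ln (cos t / sin t) = ln (2 * cos t) + (-1) * ln (2 * sin t)); last first.
    by rewrite ln_div ?posrE// !lnM ?posrE//; ring.
  apply: cvgD; first exact: quad_ln_circle_cvg.
  apply: cvgM; first exact: cvg_cst.
  have := @quad_ln_circle_cvg (pi / 2 - t).
  have -> : cos (pi / 2 - t) = sin t by rewrite addrC cosDpihalf sinN opprK.
  have -> : sin (pi / 2 - t) = cos t.
    by rewrite addrC sinD cos_pihalf sin_pihalf mulr0 add0r mulr1 cosN.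
  move=> /(_ st); rewrite (_ : (fun n => quad_ln (rhon n) (cos t) (sin t)) =
    (fun n => quad_ln (- rhon n) (sin t) (cos t)))//.
  apply/funext => n; rewrite /quad_ln; congr (_ * ln _).
  by rewrite /quad_norm2 /quad_re /quad_im; ring.
have sub : (\int[mu]_(t in `[u, v]) (f n t)%:E + \int[mu]_(t in `[(- v)%R, (- u)%R]) (f n t)%:E
    <= (arc_integral (f n))%:E)%E.
  have f0 t : (0 <= (f n t)%:E)%E by rewrite lee_fin expR_ge0.
  have m1 : measurable (`[u, v]%classic : set R) by exact: measurable_itv.
  have m2 : measurable (`[(- v)%R, (- u)%R]%classic : set R) by exact: measurable_itv.
  have dis : [disjoint (`[u, v]%classic : set R) & `[(- v)%R, (- u)%R]%classic].
    by apply/disj_setPS => t [] /=; rewrite !in_itv/= => /andP[? ?] /andP[? ?]; lra.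
  rewrite -(ge0_integral_setU mu m1 m2 (mf _ n) (fun t _ => f0 t) dis).
  rewrite -open_arc_integral//.
  apply: (ge0_subset_integral mu (measurableU _ _ m1 m2) (measurable_itv _) (mf _ n) (fun t _ => f0 t)).
  by move=> t; rewrite /open_arc/= !in_itv/= => -[|] /andP[? ?]; apply/andP; split; lra.
rewrite integration_by_substitution_oppr// in sub; last exact: continuous_subspaceT.
have E : (\int[mu]_(t in `[u, v]) ((f n \o -%R) t)%:E = \int[mu]_(t in `[u, v]) (f n t)%:E)%E.
  by apply: eq_integral => t _; rewrite /= feven.
rewrite E in sub.
have -> : pi / (2 * cos (s * (pi / 2))) = 2^-1 * (pi / cos (s * (pi / 2))) :> R.
  by rewrite invfM mulrCA.
rewrite EFinM lee_pdivlMl//; apply: (@le_trans _ _ (arc_integral (f n))%:E).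
  by rewrite mule_natl mule2n.
by rewrite lee_fin ler_pdivlMr// mulrC.
Qed.

End critical_integrals.

(** * The sharp integral estimate on the diameter *)

Section substitution_and_exhaustion.
Context {R : realType}.
Local Notation mu := (@lebesgue_measure R).

Lemma increasing_substitution (F F1 G : R -> R) (a b : R) : a <= b ->
  (forall x : R, a <= x <= b -> is_derive x 1 F (F1 x)) ->
  (forall x : R, a <= x <= b -> {for x, continuous F1}) ->
  (forall x : R, a <= x <= b -> 0 < F1 x) ->
  (forall y : R, F a <= y <= F b -> {for y, continuous G}) ->
  (\int[mu]_(y in `[F a, F b]) (G y)%:E =
   \int[mu]_(x in `[a, b]) (G (F x) * F1 x)%:E)%E.
Proof.
rewrite le_eqVlt => /predU1P[<- *|ab dF cF1 F1_gt0 cG].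
  by rewrite !set_itv1 !integral_set1.
have cF x : a <= x <= b -> {for x, continuous F}.
  by move=> xab; exact: is_derive_continuous (dF x xab).
have F1E (x : R) : a < x < b -> derive1 F x = F1 x.
  move=> /andP[ax xb]; rewrite derive1E.
  by have [|_ ->//] := dF x; rewrite (ltW ax) (ltW xb).
have aab : a <= a <= b by rewrite lexx ltW.
have bab : a <= b <= b by rewrite lexx ltW.
have oo x : x \in `]a, b[ -> a <= x <= b.
  by rewrite in_itv/= => /andP[ax xb]; rewrite (ltW ax) (ltW xb).
have Fab : derivable_oo_LRcontinuous F a b.
  split => [x /oo xab||]; first by have [] := dF x xab.
  - by apply: cvg_at_right_filter; exact: cF.
  - by apply: cvg_at_left_filter; exact: cF.
have cFab : {within `[a, b], continuous F}.
  exact: derivable_oo_LRcontinuous_within Fab.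
have incrF : {in `[a, b] &, {homo F : x y / x < y}}.
  move=> x y; rewrite !in_itv/= => /andP[ax xb] /andP[ay yb] xy.
  have dFxy z : z \in `]x, y[ -> is_derive z 1 F (F1 z).
    by rewrite in_itv/= => /andP[? ?]; apply: dF; apply/andP; split; lra.
  have cFxy : {within `[x, y], continuous F}.
    apply: continuous_subspaceW cFab => z; rewrite /= !in_itv/= => /andP[? ?].
    by apply/andP; split; lra.
  have [z] := MVT xy dFxy cFxy; rewrite in_itv/= => /andP[xz zy] FE.
  rewrite -subr_gt0 FE mulr_gt0 ?subr_gt0//; apply: F1_gt0.
  by apply/andP; split; lra.
have cF'a : derive1 F x @[x --> a^'+] --> F1 a.
  apply: (@cvg_trans _ (F1 x @[x --> a^'+])).
    apply: near_eq_cvg; near=> x; apply/esym/F1E/andP; split; near: x.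
      exact: nbhs_right_gt.
    exact: nbhs_right_lt.
  by apply: cvg_at_right_filter; exact: cF1.
have cF'b : derive1 F x @[x --> b^'-] --> F1 b.
  apply: (@cvg_trans _ (F1 x @[x --> b^'-])).
    apply: near_eq_cvg; near=> x; apply/esym/F1E/andP; split; near: x.
      exact: nbhs_left_gt.
    exact: nbhs_left_lt.
  by apply: cvg_at_left_filter; exact: cF1.
have cF'ab : {in `]a, b[, continuous (derive1 F)}.
  move=> x xab; rewrite /continuous_at F1E; last by move: xab; rewrite in_itv.
  apply: (@cvg_trans _ (F1 y @[y --> x])); last exact: cF1 (oo _ xab).
  apply: near_eq_cvg; near=> y; apply/esym/F1E.
  suff : y \in `]a, b[ by rewrite in_itv.
  by near: y; exact: near_in_itvoo.
have cGab : {within `[F a, F b], continuous G}.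
  by apply: continuous_in_subspaceT => y; rewrite inE/= in_itv/=; exact: cG.
rewrite (integration_by_substitution_increasing (ltW ab) incrF cF'ab
  (cvgP _ cF'a) (cvgP _ cF'b) Fab cGab).
have cGF : {in `]a, b[, continuous (G \o F)}.
  move=> x xab; have xab' := oo x xab; apply: continuous_comp; first exact: cF.
  apply: cG; move: xab; rewrite in_itv/= => /andP[ax xb].
  have inx : x \in `[a, b] by rewrite in_itv.
  by rewrite (ltW (incrF _ _ _ inx ax)) ?(ltW (incrF _ _ inx _ xb))// in_itv.
rewrite (@integral_itv_bndoo R a b _ true false); last first.
  apply: (iffRL (@measurable_EFinP _ _ R _ _)).
  apply: open_continuous_measurable_fun; first exact: interval_open.
  move=> x; rewrite inE/= => xab.
  by apply: continuousM; [exact: cGF|exact: cF'ab].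
rewrite (@integral_itv_bndoo R a b _ true false); last first.
  apply: (iffRL (@measurable_EFinP _ _ R _ _)).
  apply: open_continuous_measurable_fun; first exact: interval_open.
  move=> x; rewrite inE/= => xab.
  by apply: cvgM; [exact: cGF|exact: cF1 (oo _ xab)].
apply: eq_integral => x; rewrite inE/= in_itv/= => xab.
by rewrite fctE /= F1E.
Unshelve. all: by end_near. Qed.

Lemma exhaustion_le (D : set R) (S : nat -> set R) (g : R -> R) (c : \bar R) :
  measurable D -> measurable_fun D g -> (forall x, D x -> 0 <= g x) ->
  (forall n, measurable (S n)) -> (forall n, S n `<=` D) ->
  (forall x, D x -> \forall n \near \oo, S n x) ->
  (forall n, (\int[mu]_(x in S n) (g x)%:E <= c)%E) ->
  (\int[mu]_(x in D) (g x)%:E <= c)%E.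
Proof.
move=> mD mg g0 mS SD cover gc.
apply: (@fatou_le _ D (fun n => g \_ (S n))) => // [n|n x Dx|x Dx|n].
- apply: measurable_funTS; apply/(measurable_restrictT _ (mS n)).
  exact: measurable_funS (SD n) mg.
- by rewrite patchE; case: ifPn => // _; exact: g0.
- apply: cvg_near_cst.
  have [N _ hN] := cover x Dx; exists N => // n /= /hN Sx.
  by rewrite patchE mem_set.
- rewrite (_ : (\int[mu]_(x in D) ((g \_ (S n)) x)%:E = \int[mu]_(x in S n) (g x)%:E)%E)//.
  rewrite -[in RHS](setIidr (SD n)) integral_mkcondr.
  by apply: eq_integral => x _; rewrite !patchE; case: ifPn.
Qed.

End substitution_and_exhaustion.

Section diameter_integral.
Context {R : realType}.
Local Notation mu := (@lebesgue_measure R).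
Implicit Types (s t x : R).

Lemma continuous_powR_gt0 (f : R -> R) (r x : R) : 0 < f x ->
  {for x, continuous f} -> {for x, continuous (fun y => f y `^ r)}.
Proof.
move=> fx cf; apply: (@continuous_comp _ _ _ f (fun y => y `^ r)) => //.
have h : is_derive (f x) 1 (fun y : R => y `^ r) _ := is_derive1_powR r fx.
exact: is_derive_continuous h.
Qed.

Lemma poisson_kernel_sym t x : 0 < x < 1 -> 0 < cos t ->
  poisson_kernel x t + poisson_kernel (- x) t =
  (1 - x ^+ 2) / cos t * (2 * cos t * (1 + x ^+ 2) /
    ((1 - x ^+ 2) ^+ 2 + 4 * cos t ^+ 2 * x ^+ 2)).
Proof.
move=> x01 c0; have /andP[x0 x1] := x01.
have d1 := @poisson_denom_gt0 R x t ltac:(lra).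
have d2 := @poisson_denom_gt0 R (- x) t ltac:(lra).
have dE : (1 - x ^+ 2) ^+ 2 + 4 * cos t ^+ 2 * x ^+ 2 =
  (1 - 2 * x * sin t + x ^+ 2) * (1 - 2 * - x * sin t + (- x) ^+ 2).
  by rewrite cos2sin2; ring.
have c0' := lt0r_neq0 c0.
rewrite dE /poisson_kernel; move: d1 d2.
rewrite (_ : 1 - 2 * - x * sin t + (- x) ^+ 2 = 1 + 2 * x * sin t + x ^+ 2); last by ring.
move=> /lt0r_neq0 d1 /lt0r_neq0 d2.
by field; rewrite c0' d1 d2.
Qed.

Lemma continuous_poisson_powR (r : R) t x : -1 < x < 1 ->
  {for x, continuous (fun x => poisson_kernel x t * (1 - x ^+ 2) `^ r)}.
Proof.
move=> x1; apply: cvgM; last first.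
  apply: (@continuous_powR_gt0 (fun x => 1 - x ^+ 2)); first by have /andP[? ?] := x1; nra.
  apply: cvgB; first exact: cst_continuous.
  by rewrite expr2; apply: cvgM; exact: cvg_id.
have d0 := lt0r_neq0 (poisson_denom_gt0 t x1).
apply: cvgM.
  apply: cvgB; first exact: cst_continuous.
  by rewrite expr2; apply: cvgM; exact: cvg_id.
apply: cvgV => //; apply: cvgD.
  apply: cvgB; first exact: cst_continuous.
  by apply: cvgM; [apply: cvgM; [exact: cst_continuous|exact: cvg_id]|exact: cst_continuous].
by rewrite expr2; apply: cvgM; exact: cvg_id.
Qed.

(** Fold [x] with [- x] and substitute [tan v = 2 x cos t / (1 - x^2)], which maps
    the half diameter onto [[0, pi / 2]]. The integrand becomes
    [(1 - x^2)^s dv / cos t], and [(1 - x^2)^s] is at most [((1 - x^2) / x)^s],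
    which is [(2 cos t)^s (cot v)^s]; then [cot_powR_le] applies. *)
Lemma diameter_powR_le s t : 0 < s < 1 -> open_arc t ->
  (\int[mu]_(x in `](-1)%R, 1%R[)
     (poisson_kernel x t * (1 - x ^+ 2) `^ (s - 1))%:E <=
   (pi / cos (s * (pi / 2)) * (2 * cos t) `^ (s - 1))%:E)%E.
Proof.
move=> s01 /open_arc_cos_gt0 c0; have [s0 s1] := andP s01.
have pi0 := pi_gt0 R; have cs0 := cos_scale_gt0 s01.
pose g x := poisson_kernel x t * (1 - x ^+ 2) `^ (s - 1).
have cg x : -1 < x < 1 -> {for x, continuous g} by exact: continuous_poisson_powR.
have g0 x : -1 < x < 1 -> 0 <= g x.
  by move=> x1; rewrite mulr_ge0 ?powR_ge0// poisson_kernel_ge0.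
pose D : set R := `](-1)%R, 1%R[%classic `\ 0.
have mD : measurable D by apply: measurableD; [exact: measurable_itv|exact: measurable_set1].
have mg1 : measurable_fun (`](-1)%R, 1%R[%classic : set R) g.
  apply: open_continuous_measurable_fun; first exact: interval_open.
  by move=> x; rewrite inE/= in_itv/=; exact: cg.
have -> : (\int[mu]_(x in `](-1)%R, 1%R[) (g x)%:E = \int[mu]_(x in D) (g x)%:E)%E.
  apply/esym/integral_setD1 => //; apply: (iffRL (@measurable_EFinP _ _ R D g)).
  by apply: measurable_funS mg1; [exact: measurable_itv|exact: subDsetl].
(* The pieces [[d n, 1 - d n]] avoid the end points, where the integrand may be
   unbounded, and the origin, where the substitution gives [v = 0] and [cot v] is
   infinite. *)
pose d (n : nat) : R := n.+2%:R^-1.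
have d01 n : 0 < d n <= 2^-1.
  by rewrite /d invr_gt0 ltr0n/= lef_pV2 ?posrE ?ltr0n// ler_nat.
pose K n : set R := `[d n, 1 - d n]%classic.
pose K' n : set R := `[- (1 - d n), - d n]%classic.
apply: (@exhaustion_le R D (fun n => K n `|` K' n)) => //.
- by apply: measurable_funS mg1; [exact: measurable_itv|exact: subDsetl].
- by move=> x [] /=; rewrite in_itv/= => /g0.
- by move=> n; apply: measurableU; exact: measurable_itv.
- move=> n x [|] /=; rewrite /K /K' /D/= !in_itv/= => /andP[? ?]; have /andP[? ?] := d01 n.
    by split; [apply/andP; split; lra|move=> ?; lra].
  by split; [apply/andP; split; lra|move=> ?; lra].
- move=> x [] /=; rewrite in_itv/= => /andP[x1 x2] /eqP xn0.
  have x0 : 0 < `|x| by rewrite normr_gt0.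
  have x1' : 0 < 1 - `|x| by rewrite subr_gt0 ltr_norml x1.
  have dcvg : d @ \oo --> (0 : R).
    rewrite (_ : d = (fun n => harmonic n.+1))//.
    by have := @cvg_harmonic R; rewrite -cvg_shiftS.
  near=> n.
  have dn1 : d n < `|x| by near: n; exact: (cvgr_lt _ dcvg).
  have dn2 : d n < 1 - `|x| by near: n; exact: (cvgr_lt _ dcvg).
  rewrite /K /K' /=; rewrite !in_itv/=; move: dn1 dn2.
  have [xp|xp] := leP 0 x.
    by rewrite ger0_norm// => *; left; apply/andP; split; lra.
  by rewrite ltr0_norm// => *; right; apply/andP; split; lra.
move=> n; have /andP[d0 d1] := d01 n.
have inK x : d n <= x <= 1 - d n -> 0 < x < 1 by move=> /andP[? ?]; apply/andP; split; lra.
have inK1 x : d n <= x <= 1 - d n -> -1 < x < 1 by move=> /andP[? ?]; apply/andP; split; lra.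
have inK2 x : d n <= x <= 1 - d n -> -1 < - x < 1 by move=> /andP[? ?]; apply/andP; split; lra.
have mK : measurable (K n) by exact: measurable_itv.
have mK' : measurable (K' n) by exact: measurable_itv.
have KE x : K n x -> d n <= x <= 1 - d n by rewrite /K/= in_itv.
have KK : [disjoint K n & K' n].
  by apply/disj_setPS => x []; rewrite /K /K'/= !in_itv/= => /andP[? ?] /andP[? ?]; lra.
have KKS : K n `|` K' n `<=` `](-1)%R, 1%R[%classic.
  by move=> x [|]; rewrite /K /K'/= !in_itv/= => /andP[? ?]; apply/andP; split; lra.
have mgE (S : set R) : S `<=` `](-1)%R, 1%R[%classic -> measurable_fun S (EFin \o g).
  move=> SD; apply: (iffRL (@measurable_EFinP _ _ R S g)).
  by apply: measurable_funS mg1; first exact: measurable_itv.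
rewrite (ge0_integral_setU mu mK mK' (mgE _ KKS) _ KK); last first.
  by move=> x /KKS; rewrite /= in_itv/= lee_fin => /g0.
rewrite /K' (@integration_by_substitution_oppr R g); last 2 first.
- lra.
- apply: continuous_in_subspaceT => x; rewrite inE/= in_itv/= => /andP[? ?].
  by apply: cg; apply/andP; split; lra.
have mgN : measurable_fun (K n) (EFin \o (g \o -%R)).
  apply: (iffRL (@measurable_EFinP _ _ R (K n) (g \o -%R))).
  apply: subspace_continuous_measurable_fun => //.
  apply: continuous_in_subspaceT => x; rewrite inE => /KE xK.
  by apply: continuous_comp; [exact: opp_continuous|exact: cg (inK2 _ xK)].
rewrite -/(K n) -ge0_integralD//; last 3 first.
- by move=> x /KE /inK1 /g0; rewrite lee_fin.
- by apply: mgE => x Kx; apply: KKS; left.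
- by move=> x /KE /inK2 /g0; rewrite lee_fin.
pose F x := atan (2 * cos t * x / (1 - x ^+ 2)).
pose F1 x := 2 * cos t * (1 + x ^+ 2) /
    ((1 - x ^+ 2) ^+ 2 + 4 * cos t ^+ 2 * x ^+ 2).
pose G (v : R) := (cos v / sin v) `^ s.
have xx x : d n <= x <= 1 - d n -> 0 < 1 - x ^+ 2.
  by move=> /inK/andP[? ?]; nra.
have den x : d n <= x <= 1 - d n -> 0 < (1 - x ^+ 2) ^+ 2 + 4 * cos t ^+ 2 * x ^+ 2.
  by move=> h; rewrite ltr_pwDl// ?exprn_gt0 ?xx// mulr_ge0 ?sqr_ge0// mulr_ge0 ?sqr_ge0.
have dF x : d n <= x <= 1 - d n -> is_derive x 1 F (F1 x).
  move=> xK; have x0 := lt0r_neq0 (xx x xK); have e0 := lt0r_neq0 (den x xK).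
  rewrite /F (_ : (fun x => _) = (fun x => atan (2 * cos t * x * (1 - x * x)^-1))); last first.
    by apply/funext => y; rewrite expr2.
  rewrite expr2 in x0.
  derive; first exact: x0.
  by rewrite /F1; field; rewrite ?x0 ?e0.
have cF1 x : d n <= x <= 1 - d n -> {for x, continuous F1}.
  move=> xK; have e0 := lt0r_neq0 (den x xK).
  have csq : {for x, continuous (fun x : R => x ^+ 2)}.
    exact: exprn_continuous.
  have csq1 : {for x, continuous (fun x : R => 1 - x ^+ 2)}.
    by apply: cvgB; [exact: cst_continuous|exact: csq].
  apply: cvgM; first apply: cvgM; first exact: cst_continuous.
    by apply: cvgD; [exact: cst_continuous|exact: csq].
  apply: cvgV => //; apply: cvgD.
    by rewrite expr2; apply: cvgM; exact: csq1.
  by apply: cvgM; [exact: cst_continuous|exact: csq].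
have F1_gt0 x : d n <= x <= 1 - d n -> 0 < F1 x.
  move=> xK; rewrite divr_gt0 ?den// mulr_gt0 ?mulr_gt0//.
  by rewrite ltr_pwDl// sqr_ge0.
have d1d : d n <= 1 - d n by lra.
have arg0 x : 0 < x < 1 -> 0 < 2 * cos t * x / (1 - x ^+ 2).
  move=> /andP[x0 x1]; rewrite divr_gt0 ?mulr_gt0//; nra.
have F0 x : 0 < x < 1 -> 0 < F x by move=> /arg0; rewrite -{2}(@atan0 R); exact: lt_atan.
have Fpi x : F x < pi / 2 by exact: atan_ltpi2.
have dK : d n <= d n <= 1 - d n by rewrite lexx.
have dK' : d n <= 1 - d n <= 1 - d n by rewrite lexx andbT.
have cG y : F (d n) <= y <= F (1 - d n) -> {for y, continuous G}.
  move=> /andP[y1 y2]; have F0n := F0 _ (inK _ dK); have Fpn := Fpi (1 - d n).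
  have sy : 0 < sin y by apply: sin_gt0_pihalf; apply/andP; split; lra.
  have cy : 0 < cos y by apply: cos_gt0_pihalf; apply/andP; split; lra.
  apply: (@continuous_powR_gt0 (fun v => cos v / sin v)); first exact: divr_gt0.
  apply: cvgM; first exact: continuous_cos.
  by apply: cvgV; [exact: lt0r_neq0|exact: continuous_sin].
have c2 : 0 < 2 * cos t by rewrite mulr_gt0.
have Fle x y : d n <= x <= 1 - d n -> d n <= y <= 1 - d n -> x <= y -> F x <= F y.
  move=> xK yK xy; have /andP[x0 x1] := inK _ xK; have /andP[y0 y1] := inK _ yK.
  apply: le_atan; apply: ler_pM.
  - by apply/ltW; rewrite mulr_gt0.
  - by rewrite invr_ge0 ltW ?xx.
  - by apply: ler_wpM2l => //; exact: ltW.
  - by rewrite lef_pV2 ?posrE ?xx//; nra.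
have sub := increasing_substitution d1d dF cF1 F1_gt0 cG.
have bound := cot_powR_le s01 (F0 _ (inK _ dK)) (Fle _ _ dK dK' d1d) (Fpi _).
pose C := (2 * cos t) `^ s / cos t.
have C0 : 0 <= C by rewrite divr_ge0 ?powR_ge0// ltW.
have cF x : d n <= x <= 1 - d n -> {for x, continuous F}.
  by move=> xK; exact: is_derive_continuous (dF x xK).
have Fmono x : d n <= x <= 1 - d n -> F (d n) <= F x <= F (1 - d n).
  by move=> xK; have /andP[x1 x2] := xK; apply/andP; split; exact: Fle.
have mGF : measurable_fun (K n) (fun x => (G (F x) * F1 x)%:E).
  apply: (iffRL (@measurable_EFinP _ _ R (K n) (fun x => G (F x) * F1 x))).
  apply: subspace_continuous_measurable_fun => //.
  apply: continuous_in_subspaceT => x; rewrite inE => /KE xK.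
  apply: cvgM; last exact: cF1.
  apply: (@continuous_comp _ _ _ F G); first exact: cF.
  exact/cG/Fmono.
have GF0 x : K n x -> (0 <= (G (F x) * F1 x)%:E)%E.
  by move=> /KE xK; rewrite lee_fin mulr_ge0 ?powR_ge0// ltW// F1_gt0.
apply: (@le_trans _ _ (\int[mu]_(x in K n) (C%:E * (G (F x) * F1 x)%:E))%E).
  apply: ge0_le_integral => //.
  - move=> x /KE xK; apply: adde_ge0; rewrite lee_fin; apply: g0.
      exact: inK1.
    exact: inK2.
  - by apply: emeasurable_funD => //; apply: mgE => x Kx; apply: KKS; left.
  - exact: measurable_funeM.
  - move=> x /KE xK; rewrite -EFinM /= -EFinD lee_fin.
    have x1 := xx x xK; have /andP[x0 x2] := inK x xK.
    rewrite /g /= sqrrN -mulrDl (poisson_kernel_sym (inK x xK) c0) -/(F1 x).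
    have GE : (2 * cos t) `^ s * G (F x) = ((1 - x ^+ 2) / x) `^ s.
      have -> : G (F x) = ((1 - x ^+ 2) / (2 * cos t * x)) `^ s.
        by congr (_ `^ _); rewrite -[LHS]invrK invf_div -/(tan _) atanK invf_div.
      rewrite -powRM; last 2 first.
      - exact: ltW.
      - by rewrite divr_ge0 ?ltW// mulr_gt0.
      congr (_ `^ _); field; by rewrite (lt0r_neq0 x0) (lt0r_neq0 c0).
    have le : (1 - x ^+ 2) `^ s <= ((1 - x ^+ 2) / x) `^ s.
      have x1' := ltW x1; have x0' := ltW x0.
      apply: (ge0_ler_powR (ltW s0)); rewrite ?nnegrE ?divr_ge0//.
      by rewrite ler_pdivlMr// ler_piMr// ltW.
    have -> : (1 - x ^+ 2) / cos t * F1 x * (1 - x ^+ 2) `^ (s - 1) =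
        (F1 x / cos t) * (1 - x ^+ 2) `^ s.
      by rewrite -(@mulr_powRB1 _ (1 - x ^+ 2) s) ?ltW//; ring.
    have -> : C * (G (F x) * F1 x) = (F1 x / cos t) * ((1 - x ^+ 2) / x) `^ s.
      by rewrite -GE /C; ring.
    by apply: ler_wpM2l le; rewrite divr_ge0 ?ltW// F1_gt0.
rewrite ge0_integralZl_EFin//.
rewrite -sub; apply: (@le_trans _ _ (C%:E * (pi / (2 * cos (s * (pi / 2))))%:E)%E).
  by apply: lee_wpmul2l; rewrite ?lee_fin.
rewrite -EFinM lee_fin /C -(mulr_powRB1 (ltW c2) s0).
rewrite le_eqVlt; apply/orP; left; apply/eqP; field.
by rewrite (lt0r_neq0 c0) (lt0r_neq0 cs0).
Unshelve. all: by end_near.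
Qed.
End diameter_integral.

(** * Polar coordinates *)

Section plane_measurability.
Context {R : realType}.

(** Open subsets of the plane are countable unions of rational squares. *)
Lemma open_measurable_plane (A : set (R * R)) : open A -> measurable A.
Proof.
move=> oA.
pose box (a b e : rat) : set (R * R) :=
  `]ratr a - ratr e, ratr a + ratr e[%classic `*` `]ratr b - ratr e, ratr b + ratr e[%classic.
pose S a b e := if `[< box a b e `<=` A >] then box a b e else set0.
have -> : A = \bigcup_a \bigcup_b \bigcup_e S a b e.
  apply/seteqP; split => [[x y] Axy|w [a _ [b _ [e _]]]]; last first.
    by rewrite /S; case: asboolP => [+ bw|//]; exact.
  have /nbhs_ballP[d /= d0 dA] := open_nbhs_nbhs (conj oA Axy).
  have d2 : 0 < d / 2 by rewrite divr_gt0.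
  have [e] := rat_in_itvoo d2; rewrite in_itv/= => /andP[e0 ed].
  have [a] := @rat_in_itvoo R (x - ratr e) x ltac:(lra); rewrite in_itv/= => /andP[ax xa].
  have [b] := @rat_in_itvoo R (y - ratr e) y ltac:(lra); rewrite in_itv/= => /andP[bY yb].
  exists a => //; exists b => //; exists e => //; rewrite /S asboolT//.
    by split => /=; rewrite in_itv/=; apply/andP; split; lra.
  move=> [x' y'] [] /=; rewrite !in_itv/= => /andP[? ?] /andP[? ?].
  by apply: dA; split; rewrite /ball/= ltr_norml; apply/andP; split; lra.
apply: bigcupT_measurable_rat => a; apply: bigcupT_measurable_rat => b.
apply: bigcupT_measurable_rat => e; rewrite /S; case: ifP => // _.
by apply: measurableX; exact: measurable_itv.
Qed.

Lemma continuous_measurable_plane (U : set (R * R)) (g : R * R -> R) : open U ->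
  (forall w, U w -> {for w, continuous g}) -> measurable_fun U g.
Proof.
move=> oU cg; have mU := open_measurable_plane oU.
apply: (measurability _ (RGenOpens.measurableE R)) => _ [_ [a [b ->] <-]].
apply: open_measurable_plane; rewrite openE => w [Uw gw]; rewrite /interior.
apply: filterI; first exact: open_nbhs_nbhs (conj oU Uw).
by apply: (cg w Uw); apply: open_nbhs_nbhs; split => //; exact: interval_open.
Qed.

Lemma closed_measurable_plane (A : set (R * R)) : closed A -> measurable A.
Proof.
by move=> /closed_openC /open_measurable_plane /measurableC; rewrite setCK.
Qed.

Lemma measurable_indic_plane (A : set (R * R)) (g : R * R -> R) : measurable A ->
  measurable_fun A g -> measurable_fun setT (fun w => g w * \1_A w).
Proof.
move=> mA mg; rewrite (_ : (fun w => _) = g \_ A).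
  by apply/(measurable_restrictT _ mA).
apply/funext => w; rewrite patchE indicE.
by case: (w \in A); rewrite ?mulr1 ?mulr0.
Qed.

Lemma open_unit_disk : open [set w : R * R | w.1 ^+ 2 + w.2 ^+ 2 < 1].
Proof.
apply: (@open_comp _ _ (fun w : R * R => w.1 ^+ 2 + w.2 ^+ 2) [set x | x < 1]).
  move=> w _; apply: cvgD; rewrite expr2; apply: cvgM; first [exact: cvg_fst|exact: cvg_snd].
exact: open_lt.
Qed.

End plane_measurability.

Section polar_coordinates.
Context {R : realType}.
Local Notation mu := (@lebesgue_measure R).
Variable F : R -> R -> R.
Hypothesis F0 : forall x y : R, 0 <= F x y.
Hypothesis cF : forall x y : R, x ^+ 2 + y ^+ 2 < 1 ->
  {for (x, y), continuous (fun w : R * R => F w.1 w.2)}.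
Variable r0 : R.
Hypothesis r01 : 0 < r0 < 1.

Let disk0 : set (R * R) := [set w | w.1 ^+ 2 + w.2 ^+ 2 <= r0 ^+ 2].

(** The image of [disk0] under [(x, y) |-> (y, t)], where [x = |y| tan t]. *)
Let sector : set (R * R) := [set w | open_arc w.2 /\ w.1 ^+ 2 <= r0 ^+ 2 * cos w.2 ^+ 2].

Let f0 (w : R * R) : R := F w.1 w.2 * \1_disk0 w.
Let h0 (w : R * R) : R :=
  F (`|w.1| * tan w.2) w.1 * (`|w.1| * cos w.2 ^- 2) * \1_sector w.

Let k0 (w : R * R) : R := (F (w.1 * sin w.2) (w.1 * cos w.2) +
  F (w.1 * sin w.2) (- (w.1 * cos w.2))) * w.1 * \1_(`[0, r0]%classic) w.1.

Let r0_sqr : r0 ^+ 2 < 1.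
Proof. by have /andP[? ?] := r01; nra. Qed.

Let c1 (w : R * R) : {for w, continuous (fun w : R * R => w.1)}.
Proof. exact: cvg_fst. Qed.

Let c2 (w : R * R) : {for w, continuous (fun w : R * R => w.2)}.
Proof. exact: cvg_snd. Qed.

Let csin (w : R * R) : {for w, continuous (fun w : R * R => sin w.2)}.
Proof. by apply: (@continuous_comp _ _ _ snd (@sin R)); [exact: c2|exact: continuous_sin]. Qed.

Let ccos (w : R * R) : {for w, continuous (fun w : R * R => cos w.2)}.
Proof. by apply: (@continuous_comp _ _ _ snd (@cos R)); [exact: c2|exact: continuous_cos]. Qed.

Let measurable_f0 : measurable_fun setT f0.
Proof.
apply: measurable_indic_plane.
  apply: closed_measurable_plane.
  apply: (@preimage_closed _ _ (fun w : R * R => w.1 ^+ 2 + w.2 ^+ 2) [set x | x <= r0 ^+ 2]).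
    by move=> w _; apply: cvgD; rewrite expr2; apply: cvgM; first [exact: cvg_fst|exact: cvg_snd].
  exact: closed_le.
apply: (@measurable_funS _ _ _ _ [set w : R * R | w.1 ^+ 2 + w.2 ^+ 2 < 1]).
- exact: open_measurable_plane (@open_unit_disk R).
- by move=> w; rewrite /disk0/= => /le_lt_trans; exact.
- apply: continuous_measurable_plane; first exact: open_unit_disk.
  by move=> [x y] /=; exact: cF.
Qed.

Let tan_sqr t : 0 < cos t -> forall y : R, (`|y| * tan t) ^+ 2 + y ^+ 2 = y ^+ 2 * cos t ^- 2.
Proof.
move=> ct y; rewrite cos2_tan2 ?lt0r_neq0// exprMn real_normK ?num_real//; ring.
Qed.

Let measurable_h0 : measurable_fun setT h0.
Proof.
pose V : set (R * R) := (snd @^-1` open_arc) `&`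
  [set w | w.1 ^+ 2 - cos w.2 ^+ 2 < 0].
have csub (c : R) (w : R * R) :
    {for w, continuous (fun w : R * R => w.1 ^+ 2 - c * cos w.2 ^+ 2)}.
  apply: cvgB; first by rewrite expr2; apply: cvgM; exact: c1.
  apply: cvgM; first exact: cst_continuous.
  by rewrite expr2; apply: cvgM; exact: ccos.
have oarc : open (snd @^-1` open_arc : set (R * R)).
  by apply: open_comp; [move=> w _; exact: c2|exact: interval_open].
have oV : open V.
  apply: openI => //.
  apply: (@open_comp _ _ (fun w : R * R => w.1 ^+ 2 - cos w.2 ^+ 2) [set x | x < 0]).
    move=> w _; have := csub 1 w.
    by rewrite (_ : (fun w => _) = (fun w : R * R => w.1 ^+ 2 - cos w.2 ^+ 2))//;
      apply/funext => v; rewrite mul1r.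
  exact: open_lt.
have VE w : V w -> 0 < cos w.2 /\ w.1 ^+ 2 < cos w.2 ^+ 2.
  by move=> [/open_arc_cos_gt0 ? /=]; rewrite subr_lt0.
have sectorV : sector `<=` V.
  move=> w [/= ow le]; have c0 := open_arc_cos_gt0 ow; split => //=.
  by rewrite subr_lt0 (le_lt_trans le)// gtr_pMl// exprn_gt0.
have msector : measurable sector.
  apply: measurableI; first exact: open_measurable_plane.
  apply: closed_measurable_plane.
  have := @preimage_closed _ _ (fun w : R * R => w.1 ^+ 2 - r0 ^+ 2 * cos w.2 ^+ 2)
    [set x | x <= 0] (fun w _ => csub _ w) (@closed_le _ (0 : R)).
  rewrite (_ : _ @^-1` _ = [set w | w.1 ^+ 2 <= r0 ^+ 2 * cos w.2 ^+ 2])//.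
  by apply/seteqP; split => w /=; rewrite subr_le0.
apply: measurable_indic_plane => //.
apply: (measurable_funS (open_measurable_plane oV) sectorV).
apply: continuous_measurable_plane => // w /VE[ct yc].
have cabs : {for w, continuous (fun w : R * R => `|w.1|)}.
  by apply: (@continuous_comp _ _ _ fst (fun x : R => `|x|)); [exact: c1|exact: norm_continuous].
have ctan : {for w, continuous (fun w : R * R => tan w.2)}.
  apply: (@continuous_comp _ _ _ snd (@tan R)); first exact: c2.
  by apply: continuous_tan; exact: lt0r_neq0.
apply: cvgM.
  apply: (@continuous_comp2 _ _ F (fun w : R * R => `|w.1| * tan w.2) fst w) => //.
    by apply: cF; rewrite tan_sqr// ltr_pdivrMr ?exprn_gt0// mul1r.
  by apply: cvgM.
apply: cvgM => //; apply: cvgV; first by rewrite lt0r_neq0// exprn_gt0.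
by rewrite expr2; apply: cvgM; exact: ccos.
Qed.

Let measurable_k0 : measurable_fun setT k0.
Proof.
pose A : set (R * R) := fst @^-1` `[0, r0]%classic.
rewrite (_ : k0 = (fun w => (F (w.1 * sin w.2) (w.1 * cos w.2) +
  F (w.1 * sin w.2) (- (w.1 * cos w.2))) * w.1 * \1_A w))//.
apply: measurable_indic_plane.
  apply: closed_measurable_plane; apply: preimage_closed.
    by move=> w _; exact: c1.
  exact: itv_closed.
pose U : set (R * R) := fst @^-1` `](-1)%R, 1[%classic.
have oU : open U by apply: open_comp; [move=> w _; exact: c1|exact: interval_open].
apply: (@measurable_funS _ _ _ _ U).
- exact: open_measurable_plane.
- move=> w; rewrite /A /U/= !in_itv/= => /andP[? ?].
  by have /andP[? ?] := r01; apply/andP; split; lra.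
apply: continuous_measurable_plane => // w; rewrite /U/= in_itv/= => w1.
have w11 : w.1 ^+ 2 < 1 by have /andP[? ?] := w1; nra.
have cs : {for w, continuous (fun w : R * R => w.1 * sin w.2)}.
  by apply: cvgM; [exact: c1|exact: csin].
have cc : {for w, continuous (fun w : R * R => w.1 * cos w.2)}.
  by apply: cvgM; [exact: c1|exact: ccos].
have sq : (w.1 * sin w.2) ^+ 2 + (w.1 * cos w.2) ^+ 2 < 1.
  by rewrite !exprMn -mulrDr addrC cos2Dsin2 mulr1.
apply: cvgM; last exact: c1.
apply: cvgD.
  by apply: (@continuous_comp2 _ _ F _ _ w) => //; exact: cF.
apply: (@continuous_comp2 _ _ F _ _ w) => //; last exact: cvgN.
by apply: cF; rewrite sqrrN.
Qed.

(* For fixed [y], substitute [x = |y| tan t]. *)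
Let slice_y (y : R) : y != 0 ->
  (\int[mu]_t (h0 (y, t))%:E <= \int[mu]_x (f0 (x, y))%:E)%E.
Proof.
move=> yn0; have y0 : 0 < `|y| by rewrite normr_gt0.
have f0_ge0 (w : R * R) : 0 <= f0 w by rewrite mulr_ge0// indicE.
have [yr|yr] := ltP r0 `|y|.
  rewrite [X in (X <= _)%E](_ : _ = 0%E).
    by apply: integral_ge0 => x _; rewrite lee_fin.
  apply: integral0_eq => t _; rewrite /h0 indicE memNset ?mulr0// => -[_ /=].
  apply/negP; rewrite -ltNge -(real_normK (num_real y)).
  have /andP[r00 _] := r01.
  apply: (@le_lt_trans _ _ (r0 ^+ 2)); last by nra.
  by rewrite ler_piMr ?sqr_ge0// -(cos2Dsin2 t) lerDl sqr_ge0.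
pose b := Num.sqrt (r0 ^+ 2 - y ^+ 2).
pose c := atan (b / `|y|).
have r0_ge0 : 0 <= r0 by have /andP[/ltW] := r01.
have yr2 : 0 <= r0 ^+ 2 - y ^+ 2.
  by rewrite subr_ge0 -(real_normK (num_real y)) lerXn2r// nnegrE.
have b2 : b ^+ 2 = r0 ^+ 2 - y ^+ 2 by rewrite sqr_sqrtr.
have b0 : 0 <= b by exact: sqrtr_ge0.
have c0 : 0 <= c by rewrite -(@atan0 R); apply: le_atan; rewrite divr_ge0// ltW.
have cpi : c < pi / 2 by exact: atan_ltpi2.
have tanc : `|y| * tan c = b by rewrite atanK mulrC divfK// lt0r_neq0.
have ct t : - c <= t <= c -> 0 < cos t.
  by move=> /andP[? ?]; apply: cos_gt0_pihalf; apply/andP; split; lra.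
have E : (\int[mu]_(x in `[(- b)%R, b]) (F x y)%:E =
  \int[mu]_(t in `[(- c)%R, c]) (F (`|y| * tan t) y * (`|y| * cos t ^- 2))%:E)%E.
  have := @increasing_substitution R (fun t => `|y| * tan t) (fun t => `|y| * cos t ^- 2)
    (F ^~ y) (- c) c.
  rewrite tanN mulrN tanc; apply.
  - lra.
  - move=> t /ct /lt0r_neq0 /is_derive_tan dt.
    have := is_derive_mulf (is_derive_cstf `|y| t) dt.
    by rewrite mul0r add0r.
  - move=> t /ct tc; apply: cvgM; first exact: cst_continuous.
    apply: cvgV; first by rewrite lt0r_neq0// exprn_gt0.
    by rewrite expr2; apply: cvgM; exact: continuous_cos.
  - by move=> t /ct tc; rewrite mulr_gt0// invr_gt0 exprn_gt0.
  - move=> x /andP[xb1 xb2].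
    have xy : x ^+ 2 + y ^+ 2 < 1.
      by apply: le_lt_trans r0_sqr; nra.
    exact: (@continuous_comp2 _ _ F id (cst y) x (cF xy) (fun=> id) (@cst_continuous _ _ y x)).
have mC : measurable (`[(- c)%R, c]%classic : set R) by exact: measurable_itv.
have mB : measurable (`[(- b)%R, b]%classic : set R) by exact: measurable_itv.
have mh : measurable_fun setT (fun t : R => (h0 (y, t))%:E).
  apply: (iffRL (@measurable_EFinP _ _ R setT (fun t : R => h0 (y, t)))).
  exact: (measurableT_comp measurable_h0 (pair1_measurable y)).
have mf : measurable_fun setT (fun x : R => (f0 (x, y))%:E).
  apply: (iffRL (@measurable_EFinP _ _ R setT (fun x : R => f0 (x, y)))).
  exact: (measurableT_comp measurable_f0 (pair2_measurable y)).
have h0_ge0 (w : R * R) : 0 <= h0 w.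
  rewrite /h0 indicE; apply: mulr_ge0 => //; apply: mulr_ge0 => //.
  by apply: mulr_ge0 => //; rewrite invr_ge0 sqr_ge0.
apply: (@le_trans _ _ (\int[mu]_(t in `[(- c)%R, c]) (h0 (y, t))%:E)%E).
  rewrite [leRHS]integral_mkcond; apply: ge0_le_integral => //.
  - by move=> t _; rewrite lee_fin.
  - exact/(measurable_restrictT _ mC)/measurable_funTS.
  - move=> t _; rewrite patchE; case: ifPn => // /negP tc.
    rewrite /h0 indicE memNset ?mulr0//; move=> [/= tarc le]; apply: tc.
    rewrite inE/= in_itv/=.
    have tc0 := open_arc_cos_gt0 tarc.
    move: tarc; rewrite /open_arc/= => tarc.
    have tan2 : tan t ^+ 2 <= (b / `|y|) ^+ 2.
      rewrite [(b / _) ^+ 2]expr_div_n b2 real_normK ?num_real//.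
      rewrite ler_pdivlMr ?lt0r_sqr//; last by rewrite exprn_even_gt0.
      have : y ^+ 2 * cos t ^- 2 <= r0 ^+ 2 by rewrite ler_pdivrMr// exprn_gt0.
      rewrite cos2_tan2 ?lt0r_neq0//; lra.
    have : `|tan t| <= b / `|y|.
      by rewrite -(@ler_pXn2r _ 2)// ?nnegrE ?divr_ge0// real_normK ?num_real.
    rewrite ler_norml => /andP[t1 t2].
    rewrite -(tanK tarc) /c -atanN; apply/andP; split; exact: le_atan.
apply: (@le_trans _ _ (\int[mu]_(x in `[(- b)%R, b]) (f0 (x, y))%:E)%E); last first.
  by apply: ge0_subset_integral => // x _; rewrite lee_fin.
rewrite le_eqVlt; apply/orP; left; apply/eqP.
transitivity (\int[mu]_(x in `[(- b)%R, b]) (F x y)%:E)%E; last first.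
  apply: eq_integral => x; rewrite inE/= in_itv/= => /andP[x1 x2].
  by rewrite /f0 indicE mem_set ?mulr1// /disk0/=; nra.
rewrite E; apply: eq_integral => t; rewrite inE/= in_itv/= => tc.
rewrite /h0 indicE mem_set ?mulr1//=; split => /=.
  by move: tc => /andP[? ?]; rewrite /open_arc/= in_itv/=; apply/andP; split; lra.
have tc0 := ct t tc.
have tan_le (u v : R) : - (pi / 2) < u -> v < pi / 2 -> u <= v -> tan u <= tan v.
  by move=> u1 v1 uv; rewrite leNgt ltr_tan ?in_itv/= -?leNgt//; apply/andP; split; lra.
have tt : `|tan t| <= b / `|y|.
  rewrite ler_norml -(@atanK R (b / `|y|)) -tanN -/c; move/andP: tc => [tc1 tc2].
  by apply/andP; split; apply: tan_le => //; lra.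
have y2 : y ^+ 2 = `|y| ^+ 2 by rewrite real_normK ?num_real.
have : (`|y| * tan t) ^+ 2 <= b ^+ 2.
  have -> : b = `|y| * (b / `|y|) by rewrite mulrC divfK// lt0r_neq0.
  rewrite -[leLHS](real_normK (num_real _)) normrM normr_id.
  apply: lerXn2r; rewrite ?nnegrE ?mulr_ge0 ?divr_ge0//.
  by apply: ler_wpM2l.
have := tan_sqr tc0 y; rewrite b2 => eq le.
have : y ^+ 2 * cos t ^- 2 <= r0 ^+ 2 by rewrite -eq; lra.
by rewrite ler_pdivrMr// exprn_gt0.
Qed.

(* For fixed [t], substitute [y = r cos t]; the sign of [r] selects the half of
    the disk. *)
Let slice_t (t : R) : open_arc t ->
  (\int[mu]_r (k0 (r, t))%:E <= \int[mu]_y (h0 (y, t))%:E)%E.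
Proof.
move=> tarc; have c0 := open_arc_cos_gt0 tarc; have c0' := lt0r_neq0 c0.
have /andP[r0_gt0 r0_lt1] := r01.
pose G (y : R) := F (`|y| * tan t) y * (`|y| * cos t ^- 2).
have h0_ge0 (w : R * R) : 0 <= h0 w.
  rewrite /h0 indicE; apply: mulr_ge0 => //; apply: mulr_ge0 => //.
  by apply: mulr_ge0 => //; rewrite invr_ge0 sqr_ge0.
have mh : measurable_fun setT (fun y : R => (h0 (y, t))%:E).
  apply: (iffRL (@measurable_EFinP _ _ R setT (fun y : R => h0 (y, t)))).
  exact: (measurableT_comp measurable_h0 (pair2_measurable t)).
pose d := r0 * cos t.
have cG (y : R) : - d <= y <= d -> {for y, continuous G}.
  move=> /andP[y1 y2].
  have sq : (`|y| * tan t) ^+ 2 + y ^+ 2 < 1.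
    rewrite tan_sqr// ltr_pdivrMr ?exprn_gt0// mul1r.
    have dc : d < cos t by rewrite /d gtr_pMl.
    by nra.
  have cabs : {for y, continuous (fun y : R => `|y|)} by exact: norm_continuous.
  have c3 : {for y, continuous (fun y : R => `|y| * tan t)}.
    by apply: cvgM => //; exact: cst_continuous.
  apply: cvgM.
    exact: (@continuous_comp2 _ _ F _ id y (cF sq) c3 (fun=> id)).
  by apply: cvgM => //; exact: cst_continuous.
have dcos (r : R) : - r0 <= r <= r0 -> is_derive r 1 (fun r => cos t * r) (cos t).
  move=> _; have := is_derive_mulf (is_derive_cstf (cos t) r) (is_derive_idf r).
  by rewrite mul0r add0r mulr1.
have r0N : - r0 <= r0 by lra.
have cG' (y : R) : cos t * - r0 <= y <= cos t * r0 -> {for y, continuous G}.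
  by rewrite mulrN [cos t * r0]mulrC; exact: cG.
have E := increasing_substitution r0N dcos (fun r _ => @cst_continuous _ _ (cos t) r)
  (fun _ _ => c0) cG'.
rewrite mulrN [cos t * r0]mulrC -/d in E.
pose P (r : R) := G (cos t * r) * cos t.
have cP (r : R) : - r0 <= r <= r0 -> {for r, continuous P}.
  move=> /andP[r1 r2]; apply: cvgM; last exact: cst_continuous.
  apply: (@continuous_comp _ _ _ (fun r : R => cos t * r) G).
    by apply: cvgM; [exact: cst_continuous|exact: cvg_id].
  by apply: cG; rewrite /d; apply/andP; split; nra.
have PE (r : R) : P r = F (`|r| * sin t) (r * cos t) * `|r|.
  rewrite /P /G normrM (gtr0_norm c0) /tan.
  rewrite (_ : cos t * `|r| * (sin t / cos t) = `|r| * sin t); last by field.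
  rewrite [cos t * r]mulrC -!mulrA; congr (_ * _); field; exact: c0'.
have P0 (r : R) : 0 <= P r by rewrite PE mulr_ge0.
pose A : set R := `[0, r0]%classic.
pose B : set R := `[(- r0)%R, 0[%classic.
have mA : measurable A by exact: measurable_itv.
have mB : measurable B by exact: measurable_itv.
have AB : [disjoint A & B].
  by apply/disj_setPS => r []; rewrite /A /B/= !in_itv/= => /andP[? ?] /andP[? ?]; lra.
have ABS : A `|` B `<=` `[(- r0)%R, r0]%classic.
  by move=> r [|]; rewrite /A /B/= !in_itv/= => /andP[? ?]; apply/andP; split; lra.
have mP (S : set R) : measurable S -> S `<=` `[(- r0)%R, r0]%classic ->
    measurable_fun S (fun r => (P r)%:E).
  move=> mS SD; apply: (iffRL (@measurable_EFinP _ _ R S P)).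
  apply: subspace_continuous_measurable_fun => //.
  by apply: continuous_in_subspaceT => r; rewrite inE => /SD; rewrite /= in_itv/=; exact: cP.
apply: (@le_trans _ _ (\int[mu]_(y in `[(- d)%R, d]) (h0 (y, t))%:E)%E); last first.
  by apply: ge0_subset_integral => // y _; rewrite lee_fin.
have -> : (\int[mu]_(y in `[(- d)%R, d]) (h0 (y, t))%:E =
    \int[mu]_(r in `[(- r0)%R, r0]) (P r)%:E)%E.
  rewrite -E; apply: eq_integral => y; rewrite inE/= in_itv/= => /andP[y1 y2].
  rewrite /h0 indicE mem_set ?mulr1//; split => //=.
  by rewrite -exprMn -/d; nra.
apply: (@le_trans _ _ (\int[mu]_(r in A `|` B) (P r)%:E)%E); last first.
  apply: ge0_subset_integral => //; [exact: measurableU|exact: mP|].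
  by move=> r _; rewrite lee_fin.
rewrite (ge0_integral_setU mu mA mB (mP _ (measurableU _ _ mA mB) ABS) _ AB); last first.
  by move=> r _; rewrite lee_fin.
have EB : (\int[mu]_(r in B) (P r)%:E = \int[mu]_(r in A) (P (- r)%R)%:E)%E.
  have cPN : {within `[(- r0)%R, (- 0)%R], continuous P}.
    apply: continuous_in_subspaceT => r; rewrite inE/= in_itv/= oppr0 => /andP[? ?].
    by apply: cP; apply/andP; split; lra.
  rewrite -[RHS](integration_by_substitution_oppr (ltW r0_gt0) cPN) oppr0.
  apply: integral_itv_bndo_bndc; apply: mP; first exact: measurable_itv.
  by move=> r Br; apply: ABS; right.
rewrite EB -ge0_integralD//; last 4 first.
- by move=> r _; rewrite lee_fin.
- by apply: mP => // r Ar; apply: ABS; left.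
- by move=> r _; rewrite lee_fin.
- apply: (iffRL (@measurable_EFinP _ _ R A (fun r => P (- r)))).
  apply: subspace_continuous_measurable_fun => //.
  apply: continuous_in_subspaceT => r; rewrite inE /A/= in_itv/= => /andP[? ?].
  apply: (@continuous_comp _ _ _ -%R P); first exact: opp_continuous.
  by apply: cP; apply/andP; split; lra.
rewrite le_eqVlt; apply/orP; left; apply/eqP; rewrite [RHS]integral_mkcond.
apply: eq_integral => r _; rewrite patchE /k0 indicE /= -/A.
case: ifPn => rA; rewrite ?mulr0 ?mulr1//.
move: rA; rewrite inE /A/= in_itv/= => /andP[r1 r2].
by rewrite !PE normrN ger0_norm// mulNr -EFinD mulrDl.
Qed.

Let ka (w : R * R) := k0 w * \1_open_arc w.2.

Let ka_ge0 (w : R * R) : 0 <= ka w.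
Proof.
rewrite /ka mulr_ge0 ?indicE//.
rewrite /k0 indicE; have [|] := boolP (w.1 \in `[0, r0]%classic); rewrite ?mulr0// mulr1.
by rewrite inE/= in_itv/= => /andP[w0 _]; rewrite mulr_ge0// addr_ge0.
Qed.

Let measurable_ka : measurable_fun setT (fun w => (ka w)%:E).
Proof.
apply: (iffRL (@measurable_EFinP _ _ R setT ka)).
apply: measurable_funM; first exact: measurable_k0.
by apply: measurableT_comp; [apply: measurable_indic; exact: measurable_itv|exact: measurable_snd].
Qed.

Let arc_slice (r : R) : r \in `[0, r0]%classic ->
  (\int[mu]_(t in open_arc)
     ((F (r * sin t) (r * cos t) + F (r * sin t) (- (r * cos t))) * r)%:E =
   \int[mu]_t (ka (r, t))%:E)%E.
Proof.
move=> rA; rewrite integral_mkcond; apply: eq_integral => t _.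
rewrite patchE /ka /k0 /= !indicE rA mulr1.
by case: ifPn; rewrite ?mulr1 ?mulr0.
Qed.

Lemma measurable_polar : measurable_fun `[0, r0]%classic (fun r : R =>
  \int[mu]_(t in open_arc)
     ((F (r * sin t) (r * cos t) + F (r * sin t) (- (r * cos t))) * r)%:E)%E.
Proof.
have mK : measurable_fun setT (fun r => \int[mu]_t (ka (r, t))%:E)%E.
  exact: (@measurable_fun_fubini_tonelli_F _ _ _ _ R mu _ measurable_ka
    (fun w => ka_ge0 w)).
apply: (eq_measurable_fun (fun r => \int[mu]_t (ka (r, t))%:E)%E).
  by move=> r rA; rewrite arc_slice.
exact: measurable_funTS.
Qed.

(** The polar map factors as [(r, t) |-> (r cos t, t)] followed by
    [(y, t) |-> (|y| tan t, y)]; each factor moves one coordinate only, so that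
    two substitutions in one variable and Tonelli's theorem suffice. *)
Lemma polar_le :
  (\int[mu]_(r in `[0%R, r0]) \int[mu]_(t in open_arc)
     ((F (r * sin t) (r * cos t) + F (r * sin t) (- (r * cos t))) * r)%:E <=
   \int[(mu \x mu)%E]_(w in [set w : R * R | (w.1 ^+ 2 + w.2 ^+ 2 < 1)%R]) (F w.1 w.2)%:E)%E.
Proof.
have f0_ge0 (w : R * R) : 0 <= f0 w by rewrite mulr_ge0// indicE.
have h0_ge0 (w : R * R) : 0 <= h0 w.
  rewrite /h0 indicE; apply: mulr_ge0 => //; apply: mulr_ge0 => //.
  by apply: mulr_ge0 => //; rewrite invr_ge0 sqr_ge0.
have mE (g : R * R -> R) : measurable_fun setT g -> measurable_fun setT (fun w => (g w)%:E).
  by move=> mg; exact: (iffRL (@measurable_EFinP _ _ R setT g)).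
pose K (w : R * R) := (ka w)%:E.
pose H (w : R * R) := (h0 w)%:E.
pose FF (w : R * R) := (f0 w)%:E.
have K0 w : (0 <= K w)%E by rewrite lee_fin.
have H0 w : (0 <= H w)%E by rewrite lee_fin.
have FF0 w : (0 <= FF w)%E by rewrite lee_fin.
have mK : measurable_fun setT K by exact: measurable_ka.
have mH : measurable_fun setT H by exact: mE.
have mFF : measurable_fun setT FF by exact: mE.
apply: (@le_trans _ _ (\int[mu]_r \int[mu]_t K (r, t))%E).
  rewrite le_eqVlt; apply/orP; left; apply/eqP; rewrite integral_mkcond.
  apply: eq_integral => r _; rewrite patchE; case: ifPn => rA; first exact: arc_slice.
  rewrite integral0_eq// => t _.
  by rewrite /K /ka /k0 /= indicE (negbTE rA) mulr0 mul0r.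
have FK : (\int[mu]_r \int[mu]_t K (r, t) = \int[mu]_t \int[mu]_r K (r, t))%E.
  exact: (@fubini_tonelli _ _ _ _ R mu mu K mK K0).
have FH : (\int[mu]_y \int[mu]_t H (y, t) = \int[mu]_t \int[mu]_y H (y, t))%E.
  exact: (@fubini_tonelli _ _ _ _ R mu mu H mH H0).
have FFE : (\int[(mu \x mu)%E]_w FF w = \int[mu]_y \int[mu]_x FF (x, y))%E.
  exact: (@fubini_tonelli2 _ _ _ _ R mu mu FF mFF FF0).
rewrite FK.
have mKG : measurable_fun setT (fun t => \int[mu]_r K (r, t))%E.
  exact: (@measurable_fun_fubini_tonelli_G _ _ _ _ R mu K mK K0).
have mHG : measurable_fun setT (fun t => \int[mu]_y H (y, t))%E.
  exact: (@measurable_fun_fubini_tonelli_G _ _ _ _ R mu H mH H0).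
have mHF : measurable_fun setT (fun y => \int[mu]_t H (y, t))%E.
  exact: (@measurable_fun_fubini_tonelli_F _ _ _ _ R mu H mH H0).
have mFG : measurable_fun setT (fun y => \int[mu]_x FF (x, y))%E.
  exact: (@measurable_fun_fubini_tonelli_G _ _ _ _ R mu FF mFF FF0).
have KH t : (\int[mu]_r K (r, t) <= \int[mu]_y H (y, t))%E.
  have [tarc|tarc] := boolP (t \in open_arc).
    apply: le_trans (slice_t (set_mem tarc)).
    rewrite le_eqVlt; apply/orP; left; apply/eqP; apply: eq_integral => r _.
    by rewrite /K /ka indicE tarc mulr1.
  rewrite [leLHS]integral0_eq; first by apply: integral_ge0 => y _; exact: H0.
  by move=> r _; rewrite /K /ka indicE (negbTE tarc) mulr0.
apply: (@le_trans _ _ (\int[mu]_t \int[mu]_y H (y, t))%E).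
  apply: (ge0_le_integral mu measurableT _ mKG mHG (fun t _ => KH t)).
  by move=> t _; apply: integral_ge0 => r _; exact: K0.
rewrite -FH.
apply: (@le_trans _ _ (\int[mu]_y \int[mu]_x FF (x, y))%E).
  have mT0 : measurable ([set: R] `\ (0 : R)).
    by apply: measurableD; [exact: measurableT|exact: measurable_set1].
  rewrite -(@integral_setD1 R _ 0 _ mT0 (measurable_funTS mHF)).
  rewrite -(@integral_setD1 R _ 0 _ mT0 (measurable_funTS mFG)).
  apply: (ge0_le_integral mu mT0 _ (measurable_funTS mHF) (measurable_funTS mFG)).
    by move=> y _; apply: integral_ge0 => t _; exact: H0.
  by move=> y [_ /eqP]; exact: slice_y.
rewrite -FFE.
rewrite [leRHS]integral_mkcond.
apply: (ge0_le_integral (mu \x mu)%E measurableT _ mFF).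
- by move=> w _; exact: FF0.
- apply/(measurable_restrictT _ (open_measurable_plane (@open_unit_disk R))).
  apply: (iffRL (@measurable_EFinP _ _ R _ (fun w : R * R => F w.1 w.2))).
  apply: continuous_measurable_plane; first exact: open_unit_disk.
  by move=> [x y] /=; exact: cF.
- move=> w _; rewrite patchE /FF /f0 indicE; case: ifPn => wD.
    by rewrite lee_fin; case: (_ \in _); rewrite ?mulr1 ?mulr0.
  rewrite memNset ?mulr0// => wd; move/negP: wD; apply; rewrite inE.
  exact: le_lt_trans wd r0_sqr.
Qed.

End polar_coordinates.

(** * Hoelder's inequality with a weight *)

Section weighted_hoelder.
Context {R : realType}.
Local Notation mu := (@lebesgue_measure R).
Local Open Scope ereal_scope.

Lemma integral_patch_powR (D : set R) (f : R -> R) (r : R) : (r != 0)%R ->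
  (forall t, D t -> (0 <= f t)%R) ->
  \int[mu]_t (`| ((f \_ D) t)%:E | `^ r) = \int[mu]_(t in D) ((f t) `^ r)%:E.
Proof.
move=> r0 f0; rewrite [RHS]integral_mkcond; apply: eq_integral => t _.
rewrite !patchE; case: ifPn => tD.
  by rewrite gee0_abs ?lee_fin ?f0 ?poweR_EFin//; exact: set_mem.
by rewrite abse0 poweR0r.
Qed.

(** Hoelder's inequality for the measure [P dt] and the factorization of [Phi]
    as [w^(s (1 - s)) Phi] times [w^(- s (1 - s))], where [s = 1 / p]: the
    exponents are those for which the second factor leaves [w^(- s)]. *)
Lemma hoelder_weight (D : set R) (P w Phi : R -> R) (p : R) : (1 < p)%R ->
  measurable D ->
  measurable_fun D P -> measurable_fun D w -> measurable_fun D Phi ->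
  (forall t, D t -> (0 <= P t)%R) -> (forall t, D t -> (0 < w t)%R) ->
  (forall t, D t -> (0 <= Phi t)%R) ->
  (\int[mu]_(t in D) (P t * Phi t)%:E) `^ p <=
  (\int[mu]_(t in D) (P t * w t `^ (- p^-1))%:E) `^ (p - 1) *
   \int[mu]_(t in D) (P t * (w t `^ (1 - p^-1) * Phi t `^ p))%:E.
Proof.
move=> p1 mD mP mw mPhi P0 w0 Phi0.
have p0 : (0 < p)%R by lra.
have pn0 := lt0r_neq0 p0.
pose s : R := p^-1%R.
have sp : (s * p = 1)%R by rewrite mulVf.
have s0 : (0 < s)%R by rewrite invr_gt0.
have s1 : (s < 1)%R by rewrite invf_lt1.
pose q : R := (1 - s)^-1%R.
have s1' : (0 < 1 - s)%R by rewrite subr_gt0.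
have q0 : (0 < q)%R by rewrite invr_gt0.
have sq : ((1 - s) * q = 1)%R by rewrite mulfV// lt0r_neq0.
have qp : (q * (p - 1) = p)%R.
  have -> : (p - 1 = p * (1 - s))%R by rewrite mulrBr mulr1 [(p * s)%R]mulrC sp.
  by rewrite mulrCA [(q * _)%R]mulrC sq mulr1.
pose f t : R := (P t `^ s * w t `^ (s * (1 - s)) * Phi t)%R.
pose g t : R := (P t `^ (1 - s) * w t `^ (- (s * (1 - s))))%R.
have mpow (h : R -> R) r : measurable_fun D h -> measurable_fun D (fun t => h t `^ r)%R.
  by move=> mh; apply: (@measurableT_comp _ _ _ _ _ _ (@powR R ^~ r)) => //; exact: measurable_powR.
have mf : measurable_fun D f.
  by apply: measurable_funM => //; apply: measurable_funM; exact: mpow.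
have mg : measurable_fun D g by apply: measurable_funM; exact: mpow.
have f0 t : D t -> (0 <= f t)%R by move=> Dt; rewrite mulr_ge0 ?mulr_ge0 ?powR_ge0// Phi0.
have g0 t : D t -> (0 <= g t)%R by move=> Dt; rewrite mulr_ge0 ?powR_ge0.
have mfD : measurable_fun setT (f \_ D) by apply/(measurable_restrictT _ mD).
have mgD : measurable_fun setT (g \_ D) by apply/(measurable_restrictT _ mD).
have pq : (p^-1 + q^-1 = 1)%R by rewrite /q invrK addrC subrK.
have := @hoelder _ _ R mu (f \_ D) (g \_ D) p q mfD mgD p0 q0 pq.
have -> : 'N[mu]_1[EFin \o ((f \_ D) \* (g \_ D))%R] = \int[mu]_(t in D) (P t * Phi t)%:E.
  rewrite Lnorm1 [RHS]integral_mkcond; apply: eq_integral => t _.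
  rewrite /= !patchE; case: ifPn => tD; last by rewrite /= mulr0 normr0.
  have Dt := set_mem tD.
  congr (_%:E); rewrite ger0_norm; last by apply: mulr_ge0; [exact: f0|exact: g0].
  rewrite /f /g powRN.
  have wp : (0 < w t `^ (s * (1 - s)))%R by rewrite powR_gt0 ?w0.
  have -> : (P t `^ s * w t `^ (s * (1 - s)) * Phi t *
      (P t `^ (1 - s) * (w t `^ (s * (1 - s)))^-1) =
      (P t `^ s * P t `^ (1 - s)) * Phi t)%R.
    by field; rewrite lt0r_neq0.
  have e : (s + (1 - s) = 1)%R by ring.
  have -> : (P t `^ s * P t `^ (1 - s) = P t `^ 1)%R.
    by rewrite -powRD ?e// oner_eq0.
  by rewrite powRr1// P0.
move=> le.
have A0 : 0 <= \int[mu]_(t in D) (P t * Phi t)%:E.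
  by apply: integral_ge0 => t Dt; rewrite lee_fin mulr_ge0 ?P0 ?Phi0.
have in0 (x : \bar R) : 0 <= x -> x \in `[0, +oo] by move=> x0; rewrite in_itv/= x0 leey.
have le2 := gt0_ler_poweR (ltW p0) (in0 _ A0) (in0 _ (mule_ge0 (Lnorm_ge0 _ _ _) (Lnorm_ge0 _ _ _))) le.
apply: le_trans le2 _.
rewrite poweRM ?Lnorm_ge0// powR_Lnorm//.
have -> : 'N[mu]_q%:E[EFin \o g \_ D] `^ p =
   (\int[mu]_(t in D) (P t * w t `^ (- s))%:E) `^ (p - 1).
  rewrite -[in LHS]qp poweRrM powR_Lnorm ?lt0r_neq0// integral_patch_powR ?lt0r_neq0//.
  congr (_ `^ _); apply: eq_integral => t /set_mem Dt; congr (_%:E).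
  rewrite powRM ?powR_ge0// -!powRrM sq powRr1 ?P0// mulNr -mulrA sq mulr1.
  by [].
rewrite integral_patch_powR// muleC.
rewrite le_eqVlt; apply/orP; left; apply/eqP; congr (_ * _).
apply: eq_integral => t /set_mem Dt; congr (_%:E).
rewrite /f powRM ?mulr_ge0 ?powR_ge0 ?Phi0// powRM ?powR_ge0//.
rewrite -!powRrM sp powRr1 ?P0// -mulrA; congr (_ * (_ * _))%R.
by rewrite mulrAC sp mul1r.
Qed.

End weighted_hoelder.

(** * The inequality of Riesz and Fejer *)

Section riesz_fejer.
Context {R : realType}.
Local Notation mu := (@lebesgue_measure R).
Variables (p a : R) (U V : R -> R -> R).
Hypotheses (p1 : 1 < p) (a1 : 1 < a).
Hypotheses (hU : axis_harmonic a U) (hV : axis_harmonic a V).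

Definition modulus (x y : R) : R := Num.sqrt (U x y ^+ 2 + V x y ^+ 2).

(** The half circle carries both conjugate points, so that the functions to which
    the Poisson formula is applied are even in [y]. *)
Definition arc_mean (t : R) : R :=
  2^-1 * (modulus (sin t) (cos t) + modulus (sin t) (- cos t)).

Let s : R := p^-1.
Let c0 : R := cos (s * (pi / 2)).

Let s01 : 0 < s < 1.
Proof.
have p0 : 0 < p := lt_trans ltr01 p1.
by rewrite /s invr_gt0 p0 invf_lt1.
Qed.

Let c0_gt0 : 0 < c0. Proof. exact: cos_scale_gt0 s01. Qed.

Lemma continuous_modulus (x y : R) : x ^+ 2 + y ^+ 2 < a ^+ 2 ->
  {for (x, y), continuous (fun w : R * R => modulus w.1 w.2)}.
Proof.
move=> xy; apply: (@continuous_comp _ _ _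
  (fun w : R * R => U w.1 w.2 ^+ 2 + V w.1 w.2 ^+ 2) (@Num.sqrt R)).
  by apply: cvgD; rewrite expr2; apply: cvgM;
    first [exact: (hU.1 _ _ xy)|exact: (hV.1 _ _ xy)].
exact: sqrt_continuous.
Qed.

Lemma modulus_ge0 (x y : R) : 0 <= modulus x y. Proof. exact: sqrtr_ge0. Qed.

Lemma arc_mean_ge0 t : 0 <= arc_mean t.
Proof. by rewrite /arc_mean mulr_ge0 ?invr_ge0// addr_ge0// modulus_ge0. Qed.

Let circle (t : R) : sin t ^+ 2 + cos t ^+ 2 < a ^+ 2.
Proof. by have h := a1; rewrite addrC cos2Dsin2; nra. Qed.

Lemma continuous_arc_mean : continuous arc_mean.
Proof.
move=> t; apply: cvgM; first exact: cst_continuous.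
have cs := @continuous_sin R t; have cc := @continuous_cos R t.
apply: cvgD.
  exact: (continuous_comp2 (continuous_modulus (circle t)) cs cc).
have xy : sin t ^+ 2 + (- cos t) ^+ 2 < a ^+ 2 by rewrite sqrrN circle.
have ccN : {for t, continuous (fun t : R => - cos t)} by exact: cvgN.
exact: (@continuous_comp2 _ _ modulus sin (fun t => - cos t) t (continuous_modulus xy) cs ccN).
Qed.

(** [c U + d V], with [c - i d] the conjugate phase of [U + i V] at [(x, 0)], is
    harmonic, equals the modulus at [(x, 0)] and is at most the modulus
    everywhere. *)
Lemma modulus_poisson_le (x : R) : -1 < x < 1 ->
  pi * modulus x 0 <= arc_integral (fun t => poisson_kernel x t * arc_mean t).
Proof.
move=> x1; have cP := continuous_poisson_kernel x1.
have [m0|m0] := eqVneq (modulus x 0) 0.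
  rewrite m0 mulr0.
  have -> : 0 = 0 * arc_integral (poisson_kernel x) by rewrite mul0r.
  rewrite -arc_integralZ//; apply: le_arc_integral.
  - by apply: continuousM_fun => // t; exact: cst_continuous.
  - by apply: continuousM_fun => //; exact: continuous_arc_mean.
  - by move=> t _; rewrite mul0r mulr_ge0 ?poisson_kernel_ge0 ?arc_mean_ge0.
have m_gt0 : 0 < modulus x 0 by rewrite lt_neqAle eq_sym m0 modulus_ge0.
have m2 (u v : R) : modulus u v ^+ 2 = U u v ^+ 2 + V u v ^+ 2.
  by rewrite sqr_sqrtr// addr_ge0 ?sqr_ge0.
pose c := U x 0 / modulus x 0; pose d := V x 0 / modulus x 0.
have cd : c ^+ 2 + d ^+ 2 = 1.
  by rewrite /c /d !expr_div_n -mulrDl -m2 mulfV// expf_neq0.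
pose W u v := (0 * U u v + c * U u v) + d * V u v.
have hW : axis_harmonic a W.
  apply: axis_harmonic_lin hV; have := axis_harmonic_lin (c - 1) hU hU.
  by rewrite (_ : (fun x y => U x y + (c - 1) * U x y) =
    (fun x y => 0 * U x y + c * U x y))//; apply/funext => u; apply/funext => v; ring.
have WE u v : W u v = c * U u v + d * V u v by rewrite /W mul0r add0r.
have W0 : W x 0 = modulus x 0.
  rewrite WE /c /d mulrAC [_ / _ * V x 0]mulrAC -mulrDl -!expr2 -m2 expr2 mulfK//.
have Wle u v : W u v <= modulus u v.
  rewrite WE; apply: le_trans (ler_norm _) _.
  rewrite -(@ler_pXn2r _ 2)// ?nnegrE ?modulus_ge0// real_normK ?num_real// m2.
  rewrite -[leRHS]mul1r -cd; have := sqr_ge0 (c * V u v - d * U u v); nra.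
pose E u v := W u v + 1 * W u (- v).
have hE : axis_harmonic a E by apply: axis_harmonic_lin => //; exact: axis_harmonic_conj.
have Eeven u v : E u (- v) = E u v by rewrite /E opprK; ring.
have := poisson_formula_even a1 hE Eeven x1.
rewrite {2}/E oppr0 W0 => PE.
have cE := continuousM_fun cP (continuous_circle a1 hE).
have -> : pi * modulus x 0 =
    2^-1 * arc_integral (fun t => poisson_kernel x t * E (sin t) (cos t)).
  by rewrite PE; field.
rewrite -arc_integralZ//; apply: le_arc_integral.
- by apply: (@continuousM_fun _ (cst 2^-1)) => // t; exact: cst_continuous.
- by apply: continuousM_fun => //; exact: continuous_arc_mean.
- move=> t _; rewrite mulrCA; apply: ler_wpM2l; first exact: poisson_kernel_ge0.
  by rewrite /arc_mean; apply: ler_wpM2l => //; rewrite /E mul1r lerD.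
Qed.

Let weight (t : R) : R := (2 * cos t) `^ (1 - s) * arc_mean t `^ p.

Let K : R := pi^-1 * c0 `^ (1 - p).

(** Hoelder's inequality with the weight [2 cos t]; [poisson_powR_le] bounds the
    factor that does not contain the modulus. *)
Lemma modulus_powR_le (x : R) : -1 < x < 1 ->
  ((modulus x 0 `^ p)%:E <= K%:E * ((1 - x ^+ 2) `^ (s - 1))%:E *
    \int[mu]_(t in open_arc) (poisson_kernel x t * weight t)%:E)%E.
Proof.
move=> x1; have pi0 := pi_gt0 R; have cP := continuous_poisson_kernel x1.
have cPm := continuousM_fun cP continuous_arc_mean.
have x2 : 0 < 1 - x ^+ 2 by have /andP[? ?] := x1; nra.
have p0 : 0 < p := lt_trans ltr01 p1.
have mcont (g : R -> R) : continuous g -> measurable_fun open_arc g.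
  by move=> cg; apply: measurable_funTS; exact: continuous_measurable_fun.
have mopen : measurable (@open_arc R) by exact: measurable_itv.
have c2 : continuous (fun t : R => 2 * cos t).
  by move=> t; apply: cvgM; [exact: cst_continuous|exact: continuous_cos].
have w0 (t : R) : open_arc t -> 0 < 2 * cos t by move=> /open_arc_cos_gt0 ?; rewrite mulr_gt0.
have := hoelder_weight p1 mopen (mcont _ cP) (mcont _ c2)
  (mcont _ continuous_arc_mean) (fun t _ => poisson_kernel_ge0 t x1) w0
  (fun t _ => arc_mean_ge0 t).
rewrite (open_arc_integral cPm) poweR_EFin -/s => hoel.
set B := (\int[mu]_(t in _) _)%E; rewrite -/B in hoel.
have B0 : (0 <= B)%E.
  apply: integral_ge0 => t _; rewrite lee_fin mulr_ge0 ?poisson_kernel_ge0//.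
  by rewrite mulr_ge0 ?powR_ge0.
have {}hoel : ((arc_integral (fun t => poisson_kernel x t * arc_mean t) `^ p)%:E <=
    ((pi / c0 * (1 - x ^+ 2) `^ (- s)) `^ (p - 1))%:E * B)%E.
  apply: le_trans hoel _; apply: lee_wpmul2r => //.
  rewrite -poweR_EFin; have := poisson_powR_le s01 x1.
  have in0 (y : \bar R) : (0 <= y -> y \in `[0, +oo])%E by move=> y0; rewrite in_itv/= y0 leey.
  move=> le; apply: (gt0_ler_poweR _ (in0 _ _) (in0 _ _) le).
    by rewrite subr_ge0 ltW.
    by apply: integral_ge0 => t _; rewrite lee_fin mulr_ge0 ?powR_ge0 ?poisson_kernel_ge0.
  by rewrite lee_fin mulr_ge0 ?powR_ge0// divr_ge0 ?ltW.
have pim : (((pi * modulus x 0) `^ p)%:E <=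
    ((pi / c0 * (1 - x ^+ 2) `^ (- s)) `^ (p - 1))%:E * B)%E.
  apply: le_trans hoel; rewrite lee_fin; apply: (ge0_ler_powR (ltW p0)).
  - by rewrite nnegrE mulr_ge0 ?modulus_ge0 ?ltW.
  - rewrite nnegrE; apply: le_trans (modulus_poisson_le x1).
    by rewrite mulr_ge0 ?modulus_ge0 ?ltW.
  - exact: modulus_poisson_le.
have pip : 0 < pi `^ p :> R by rewrite powR_gt0.
have -> : modulus x 0 `^ p = (pi `^ p)^-1 * (pi * modulus x 0) `^ p.
  by rewrite powRM ?modulus_ge0 ?ltW// mulKf// lt0r_neq0.
rewrite -EFinM.
have -> : K * (1 - x ^+ 2) `^ (s - 1) =
    (pi `^ p)^-1 * (pi / c0 * (1 - x ^+ 2) `^ (- s)) `^ (p - 1).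
  rewrite powRM ?powR_ge0 ?divr_ge0 ?ltW// -powRrM.
  have -> : - s * (p - 1) = s - 1.
    by rewrite mulrBr mulr1 mulNr /s mulVf ?lt0r_neq0//; ring.
  rewrite mulrA; congr (_ * _).
  rewrite powRM ?invr_ge0 ?ltW// mulrA.
  have -> : pi `^ (p - 1) = pi `^ p / pi :> R.
    by rewrite powRB ?powRr1 ?ltW// lt0r_neq0// implybT.
  rewrite mulKf ?lt0r_neq0// /K; congr (_ * _).
  rewrite -[c0^-1]powR_inv1 ?ltW// -powRrM; congr (_ `^ _); ring.
rewrite EFinM [X in (_ <= X * _)%E]EFinM -muleA; apply: lee_wpmul2l; last exact: pim.
by rewrite lee_fin invr_ge0 ltW.
Qed.

(** Integrate [modulus_powR_le] over the diameter and exchange the integrals: the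
    inner one is then bounded by [diameter_powR_le], and the powers of [2 cos t]
    cancel. *)
Lemma riesz_fejer :
  (\int[mu]_(x in `](-1)%R, 1%R[) (modulus x 0 `^ p)%:E <=
   (c0^-1 `^ p)%:E * \int[mu]_(t in open_arc) (arc_mean t `^ p)%:E)%E.
Proof.
have pi0 := pi_gt0 R.
pose I : set R := `](-1)%R, 1%R[%classic.
have mI : measurable I by exact: measurable_itv.
have IE x : I x -> -1 < x < 1 by rewrite /I/= in_itv.
have mopen : measurable (@open_arc R) by exact: measurable_itv.
pose S : set (R * R) := I `*` open_arc.
have oS : open S.
  apply: (@openI _ (fst @^-1` I) (snd @^-1` open_arc)); apply: open_comp;
    by [move=> w _; first [exact: cvg_fst|exact: cvg_snd]|exact: interval_open].
pose A (w : R * R) := poisson_kernel w.1 w.2 * (1 - w.1 ^+ 2) `^ (s - 1).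
have mA : measurable_fun S A.
  apply: continuous_measurable_plane => // w [/= /IE w1 w2].
  have cf : {for w, continuous (fun w : R * R => w.1)} by exact: cvg_fst.
  have csin : {for w, continuous (fun w : R * R => sin w.2)}.
    by apply: (@continuous_comp _ _ _ snd (@sin R)); [exact: cvg_snd|exact: continuous_sin].
  have csq : {for w, continuous (fun w : R * R => 1 - w.1 ^+ 2)}.
    apply: cvgB; first exact: cst_continuous.
    by rewrite expr2; apply: cvgM.
  apply: cvgM; last first.
    apply: (@continuous_comp _ _ _ (fun w : R * R => 1 - w.1 ^+ 2) (fun y : R => y `^ (s - 1))) => //.
    apply: (@continuous_powR_gt0 _ id) => //.
    by have /andP[? ?] := w1; nra.
  apply: cvgM => //; apply: cvgV; first exact/lt0r_neq0/poisson_denom_gt0.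
  apply: cvgD; last by rewrite expr2; apply: cvgM.
  apply: cvgB; first exact: cst_continuous.
  by apply: cvgM => //; apply: cvgM => //; exact: cst_continuous.
pose B (t : R) := weight t * \1_open_arc t.
have B0 t : 0 <= B t by rewrite mulr_ge0 ?indicE// mulr_ge0 ?powR_ge0.
have mpow (g : R -> R) r : continuous g -> measurable_fun setT (fun t => g t `^ r).
  move=> cg; apply: (@measurableT_comp _ _ _ _ _ _ (@powR R ^~ r)).
    exact: measurable_powR.
  exact: continuous_measurable_fun.
have c2 : continuous (fun t : R => 2 * cos t).
  by move=> t; apply: cvgM; [exact: cst_continuous|exact: continuous_cos].
have mB : measurable_fun setT B.
  apply: measurable_funM; last exact: measurable_indic.
  by apply: measurable_funM; apply: mpow; [exact: c2|exact: continuous_arc_mean].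
pose Q (w : R * R) : \bar R := ((A \_ S) w * B w.2)%:E.
have AS0 w : 0 <= (A \_ S) w.
  rewrite patchE; case: ifPn => // /set_mem [/IE w1 _].
  by rewrite mulr_ge0 ?powR_ge0// poisson_kernel_ge0.
have Q0 w : (0 <= Q w)%E by rewrite lee_fin mulr_ge0.
have mS : measurable S by exact: measurableX.
have mQ : measurable_fun setT Q.
  apply: (iffRL (@measurable_EFinP _ _ R setT (fun w : R * R => (A \_ S) w * B w.2))).
  apply: measurable_funM; first exact/(measurable_restrictT _ mS).
  by apply: measurableT_comp => //; exact: measurable_snd.
have FQ : (\int[mu]_x \int[mu]_t Q (x, t) = \int[mu]_t \int[mu]_x Q (x, t))%E.
  exact: (@fubini_tonelli _ _ _ _ R mu mu Q mQ Q0).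
have mQF : measurable_fun setT (fun x => \int[mu]_t Q (x, t))%E.
  exact: (@measurable_fun_fubini_tonelli_F _ _ _ _ R mu Q mQ Q0).
have mQG : measurable_fun setT (fun t => \int[mu]_x Q (x, t))%E.
  exact: (@measurable_fun_fubini_tonelli_G _ _ _ _ R mu Q mQ Q0).
have Q1E x t : I x -> open_arc t -> Q (x, t) = (A (x, t) * weight t)%:E.
  move=> Ix ta; rewrite /Q /B indicE (mem_set ta) mulr1 patchE.
  by rewrite (mem_set (conj Ix ta : S (x, t))).
clear AS0 B0 mB mA mS.
have QE0 x t : ~ (I x /\ open_arc t) -> Q (x, t) = 0%E.
  move=> xt; have NS : ((x, t) \in S) = false by apply/negP => /set_mem.
  by rewrite /Q patchE NS mul0r.
have Qge0 x : (0 <= \int[mu]_t Q (x, t))%E by apply: integral_ge0 => t _; exact: Q0.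
clearbody Q.
have K0 : 0 <= K.
  by apply: mulr_ge0; [rewrite invr_ge0 ltW|exact: powR_ge0].
have step1 x : I x -> ((modulus x 0 `^ p)%:E <= K%:E * \int[mu]_t Q (x, t))%E.
  move=> Ix; apply: le_trans (modulus_powR_le (IE x Ix)) _.
  rewrite -muleA; apply: lee_wpmul2l; first by rewrite lee_fin.
  rewrite -ge0_integralZl_EFin//; last 3 first.
  - by move=> t _; rewrite lee_fin mulr_ge0 ?poisson_kernel_ge0 ?IE// mulr_ge0 ?powR_ge0.
  - apply: (iffRL (@measurable_EFinP _ _ R open_arc (fun t => poisson_kernel x t * weight t))).
    apply: measurable_funM; last first.
      by apply: measurable_funM; apply: measurable_funTS; apply: mpow;
        [exact: c2|exact: continuous_arc_mean].
    apply: measurable_funTS; apply: continuous_measurable_fun.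
    exact: continuous_poisson_kernel (IE x Ix).
  - exact: powR_ge0.
  rewrite integral_mkcond le_eqVlt; apply/orP; left; apply/eqP.
  apply: eq_integral => t _; rewrite patchE; case: ifPn => ta.
    by rewrite Q1E//; [rewrite -EFinM /A /=; congr (_%:E); ring|exact: set_mem].
  by rewrite QE0// => -[_ /mem_set ta']; rewrite ta' in ta.
have step2 t : (\int[mu]_x Q (x, t) <=
    (((pi / c0) * arc_mean t `^ p)%:E * (\1_open_arc t)%:E))%E.
  rewrite indicE; have [ta|ta] := boolP (t \in open_arc); last first.
    rewrite mule0 integral0_eq// => x _.
    by apply: QE0 => -[_ /mem_set ta']; rewrite ta' in ta.
  rewrite mule1; have Ta := set_mem ta; have ct := open_arc_cos_gt0 Ta.
  have ct2 : 0 < 2 * cos t by rewrite mulr_gt0.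
  have -> : (\int[mu]_x Q (x, t) = \int[mu]_(x in I) ((weight t)%:E *
      (poisson_kernel x t * (1 - x ^+ 2) `^ (s - 1))%:E))%E.
    rewrite [RHS]integral_mkcond; apply: eq_integral => x _.
    rewrite patchE; case: ifPn => xI; last first.
      by apply: QE0 => -[/mem_set xI' _]; rewrite xI' in xI.
    by rewrite Q1E//; [rewrite -EFinM /A /=; congr (_%:E); ring|exact: set_mem].
  have W0 : 0 <= weight t by rewrite mulr_ge0 ?powR_ge0.
  rewrite ge0_integralZl_EFin//; last 2 first.
  - by move=> x /IE x1; rewrite lee_fin mulr_ge0 ?powR_ge0// poisson_kernel_ge0.
  - apply: (iffRL (@measurable_EFinP _ _ R I
      (fun x => poisson_kernel x t * (1 - x ^+ 2) `^ (s - 1)))).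
    apply: open_continuous_measurable_fun; first exact: interval_open.
    by move=> x /set_mem /IE; exact: continuous_poisson_powR.
  apply: (@le_trans _ _ ((weight t)%:E * (pi / c0 * (2 * cos t) `^ (s - 1))%:E)%E).
    by apply: lee_wpmul2l; [rewrite lee_fin|exact: diameter_powR_le].
  rewrite -EFinM lee_fin le_eqVlt; apply/orP; left; apply/eqP.
  have e : (2 * cos t) `^ (1 - s) * (2 * cos t) `^ (s - 1) = 1.
    by rewrite -powRD ?addrA ?subrK ?subrr ?powRr0// lt0r_neq0 ?implybT.
  transitivity ((2 * cos t) `^ (1 - s) * (2 * cos t) `^ (s - 1) * (pi / c0 * arc_mean t `^ p)).
    by rewrite /weight; ring.
  by rewrite e mul1r.
have mm : measurable_fun I (fun x => (modulus x 0 `^ p)%:E).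
  apply: (iffRL (@measurable_EFinP _ _ R I (fun x => modulus x 0 `^ p))).
  apply: (@measurableT_comp _ _ _ _ _ _ (@powR R ^~ p)); first exact: measurable_powR.
  apply: open_continuous_measurable_fun; first exact: interval_open.
  move=> x /set_mem /IE x1; have h := a1.
  have xy : x ^+ 2 + 0 ^+ 2 < a ^+ 2 by rewrite expr0n/= addr0; have /andP[? ?] := x1; nra.
  exact: (@continuous_comp2 _ _ modulus id (cst 0) x (continuous_modulus xy)
    (fun=> id) (@cst_continuous _ _ (0 : R) x)).
apply: (@le_trans _ _ (\int[mu]_(x in I) (K%:E * \int[mu]_t Q (x, t)))%E).
  apply: (ge0_le_integral mu mI _ mm _ step1).
    by move=> x _; rewrite lee_fin powR_ge0.
  by apply: measurable_funeM; exact: measurable_funTS.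
rewrite ge0_integralZl_EFin//; last first.
  exact: measurable_funTS.
have le3 : (\int[mu]_(x in I) \int[mu]_t Q (x, t) <=
    (pi / c0)%:E * \int[mu]_(t in open_arc) (arc_mean t `^ p)%:E)%E.
  apply: (@le_trans _ _ (\int[mu]_x \int[mu]_t Q (x, t))%E).
    exact: (ge0_subset_integral mu mI measurableT mQF (fun x _ => Qge0 x)).
  have mmp : measurable_fun setT (fun t => (arc_mean t `^ p)%:E).
    apply: (iffRL (@measurable_EFinP _ _ R setT (fun t => arc_mean t `^ p))).
    by apply: mpow; exact: continuous_arc_mean.
  have C0 : 0 <= pi / c0 by rewrite divr_ge0 ?ltW.
  have -> : ((pi / c0)%:E * \int[mu]_(t in open_arc) (arc_mean t `^ p)%:E =
      \int[mu]_t (((pi / c0) * arc_mean t `^ p)%:E * (\1_open_arc t)%:E))%E.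
    rewrite -(ge0_integralZl_EFin mu mopen _ (measurable_funTS mmp) C0); last first.
      by move=> t _; rewrite lee_fin powR_ge0.
    rewrite integral_mkcond; apply: eq_integral => t _.
    by rewrite patchE indicE; case: ifPn => _; rewrite ?mule1 ?mule0// EFinM.
  rewrite FQ; apply: (ge0_le_integral mu measurableT _ mQG _ (fun t _ => step2 t)).
    by move=> t _; apply: integral_ge0 => x _; exact: Q0.
  apply: emeasurable_funM.
    apply: (iffRL (@measurable_EFinP _ _ R setT (fun t => pi / c0 * arc_mean t `^ p))).
    by apply: measurable_funM; [exact: measurable_cst|apply: mpow; exact: continuous_arc_mean].
  apply: (iffRL (@measurable_EFinP _ _ R setT (\1_open_arc : R -> R))).
  exact: measurable_indic.
apply: le_trans (lee_wpmul2l _ le3) _; first by rewrite lee_fin.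
rewrite muleA -EFinM le_eqVlt; apply/orP; left; apply/eqP; congr (_%:E * _)%E.
rewrite /K mulrA [pi^-1 * _ * pi]mulrAC mulVf ?lt0r_neq0// mul1r.
have c0n := lt0r_neq0 c0_gt0.
rewrite powRB ?c0n ?implybT// powRr1 ?ltW// mulrAC mulfV// mul1r.
by rewrite -[c0^-1]powR_inv1 ?ltW// -powRrM mulN1r powRN.
Qed.

End riesz_fejer.

(** * Dilates of harmonic functions on the disk *)

Section harmonic_dilates.
Context {R : realType}.
Implicit Types (u : R * R -> R) (x y r : R).

Lemma derivable_horizontal u x y : derivable u (x, y) (1, 0) ->
  is_derive x 1 (fun t : R => u (t, y)) (partial_x u (x, y)).
Proof.
move=> du; have E : (fun h : R => h^-1 *: (u (h *: ((1, 0) : R * R) + (x, y)) - u (x, y))) =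
    (fun h : R => h^-1 *: (u (h *: (1 : R) + x, y) - u (x, y))).
  apply/funext => h; congr (_ *: (u _ - _)); congr (_, _).
  by rewrite /= [h *: 0]mulr0 add0r.
split.
  by move: du; rewrite /derivable /= E.
by rewrite /partial_x /derive /= E.
Qed.

Lemma derivable_vertical u x y : derivable u (x, y) (0, 1) ->
  is_derive y 1 (fun t : R => u (x, t)) (partial_y u (x, y)).
Proof.
move=> du; have E : (fun h : R => h^-1 *: (u (h *: ((0, 1) : R * R) + (x, y)) - u (x, y))) =
    (fun h : R => h^-1 *: (u (x, h *: (1 : R) + y) - u (x, y))).
  apply/funext => h; congr (_ *: (u _ - _)); congr (_, _).
  by rewrite /= [h *: 0]mulr0 add0r.
split.
  by move: du; rewrite /derivable /= E.
by rewrite /partial_y /derive /= E.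
Qed.

Lemma mean_value_le (g dg : R -> R) (a b M : R) :
  (forall t : R, `|t - a| <= `|b - a| -> is_derive t 1 g (dg t) /\ `|dg t| <= M) ->
  `|g b - g a| <= M * `|b - a|.
Proof.
move=> H; have cg (c d : R) : (forall t : R, c <= t <= d -> `|t - a| <= `|b - a|) ->
    {within `[c, d], continuous g}.
  move=> cd; apply: derivable_within_continuous => t; rewrite in_itv/= => /cd /H[h _].
  by have [] := h.
have [ab|ba] := leP a b.
  have tab (t : R) : a <= t <= b -> `|t - a| <= `|b - a|.
    by move=> /andP[? ?]; rewrite !ger0_norm ?subr_ge0//; lra.
  have drv (t : R) : t \in `]a, b[%R -> is_derive t 1 g (dg t).
    by rewrite in_itv/= => /andP[? ?]; apply: (H _ _).1; apply: tab; rewrite !ltW.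
  have [t tI E] := MVT_segment ab drv (cg _ _ tab).
  rewrite E normrM; apply: ler_wpM2r => //; apply: (H _ _).2; apply: tab.
  by move: tI; rewrite in_itv.
have tab (t : R) : b <= t <= a -> `|t - a| <= `|b - a|.
  by move=> /andP[? ?]; rewrite !ler0_norm ?subr_le0//; lra.
have drv (t : R) : t \in `]b, a[%R -> is_derive t 1 g (dg t).
  by rewrite in_itv/= => /andP[? ?]; apply: (H _ _).1; apply: tab; rewrite !ltW.
have [t tI E] := MVT_segment (ltW ba) drv (cg _ _ tab).
rewrite distrC [`|b - a|]distrC E normrM; apply: ler_wpM2r => //; apply: (H _ _).2.
by apply: tab; move: tI; rewrite in_itv.
Qed.

(** Joint continuity follows from the mean value theorem along a horizontal
    segment, where [partial_x u] is bounded, and continuity along a vertical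
    one. *)
Lemma C1_on_continuous (D : set (R * R)) u : open D -> C1_on D u ->
  forall w, D w -> {for w, continuous u}.
Proof.
move=> oD C1 [x y] Dxy.
have [dx dy cx _] := C1 _ Dxy.
pose M := `|partial_x u (x, y)| + 1.
have M0 : 0 < M by rewrite ltr_wpDl.
have /nbhs_ballP[d /= d0 hd] : nbhs (x, y) (D `&` [set w | `|partial_x u w| <= M]).
  apply: filterI; first exact: open_nbhs_nbhs.
  have /cvgrPdist_lt /(_ _ ltr01) := cx; apply: filterS => w /= lt.
  have -> : partial_x u w = partial_x u (x, y) - (partial_x u (x, y) - partial_x u w) by ring.
  by rewrite (le_trans (ler_normB _ _))// lerD2l ltW.
have cy : {for y, continuous (fun t => u (x, t))}.
  exact: is_derive_continuous (derivable_vertical dy).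
apply/cvgrPdist_lt => e e0.
have e20 : 0 < e / 2 by rewrite divr_gt0.
have /cvgrPdist_lt /(_ _ e20) /nbhs_ballP[d' /= d'0 hd'] := cy.
pose m := Num.min (Num.min d d') (e / 2 / M).
have m0 : 0 < m by rewrite !lt_min d0 d'0 !divr_gt0.
suff : nbhs (x, y) [set w | `|u (x, y) - u w| < e] by [].
apply/nbhs_ballP; exists m => //= -[x' y'] [/=]; rewrite /ball/= => xx yy.
have yd : `|y - y'| < d by apply: lt_le_trans yy _; rewrite !ge_min lexx.
have yd' : `|y - y'| < d' by apply: lt_le_trans yy _; rewrite !ge_min lexx orbT.
have xd : `|x - x'| < d by apply: lt_le_trans xx _; rewrite !ge_min lexx.
have xe : M * `|x - x'| <= e / 2.
  rewrite mulrC -ler_pdivlMr//; apply: ltW; apply: lt_le_trans xx _.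
  by rewrite ge_min lexx orbT.
have h1 : `|u (x, y') - u (x', y')| <= M * `|x - x'|.
  rewrite distrC [`|x - x'|]distrC.
  apply: (@mean_value_le (fun t => u (t, y')) (fun t => partial_x u (t, y'))) => t tx.
  have [Dt Mt] : D (t, y') /\ `|partial_x u (t, y')| <= M.
    apply: hd; split => //=; rewrite /ball/=.
    by rewrite distrC (le_lt_trans tx)// distrC.
  by split => //; apply: derivable_horizontal; have [] := C1 _ Dt.
have h2 : `|u (x, y) - u (x, y')| < e / 2 by exact: hd'.
rewrite (_ : u (x, y) - u (x', y') =
  (u (x, y) - u (x, y')) + (u (x, y') - u (x', y'))); last by ring.
rewrite (le_lt_trans (ler_normD _ _))// [e]splitr; apply: ltr_leD => //.
exact: le_trans h1 xe.
Qed.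

Lemma unit_disk_coord :
  @of_coord R @^-1` @unit_disk R = [set w : R * R | w.1 ^+ 2 + w.2 ^+ 2 < 1].
Proof.
apply/seteqP; split => -[x y]; rewrite /of_coord /unit_disk /= => h.
  rewrite -[ltRHS](expr1n _ 2) -[ltLHS]sqr_sqrtr ?addr_ge0 ?sqr_ge0//.
  by rewrite ltrXn2r ?sqrtr_ge0.
by rewrite -[ltRHS]sqrtr1 ltr_sqrt.
Qed.

(** The dilate is harmonic on the disk of radius [1 / r], which contains the
    closed unit disk. *)
Lemma real_harmonic_dilate u r : 0 < r < 1 ->
  real_harmonic_on (@of_coord R @^-1` @unit_disk R) u ->
  axis_harmonic r^-1 (fun x y => u (r * x, r * y)).
Proof.
move=> /andP[r0 r1]; rewrite unit_disk_coord => -[[C1u C1x C1y] lap].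
pose D := [set w : R * R | w.1 ^+ 2 + w.2 ^+ 2 < 1].
have inD x y : x ^+ 2 + y ^+ 2 < r^-1 ^+ 2 -> D (r * x, r * y).
  by rewrite /D/= !exprMn -mulrDr -ltr_pdivlMl ?exprn_gt0// mulr1 exprVn.
split.
  move=> x y /inD xy.
  have cu := C1_on_continuous (@open_unit_disk R) C1u xy.
  have c1 : {for (x, y), continuous (fun w : R * R => r * w.1)}.
    by apply: cvgM; [exact: cst_continuous|exact: cvg_fst].
  have c2 : {for (x, y), continuous (fun w : R * R => r * w.2)}.
    by apply: cvgM; [exact: cst_continuous|exact: cvg_snd].
  have cu' : {for (r * x, r * y), continuous (fun w : R * R => u (w.1, w.2))}.
    by rewrite (_ : (fun w : R * R => u (w.1, w.2)) = u)//; apply/funext => -[].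
  exact: (@continuous_comp2 R _ (fun s t => u (s, t)) _ _ (x, y) cu' c1 c2).
exists (fun x y => r * partial_x u (r * x, r * y)),
  (fun x y => r * (r * partial_x (partial_x u) (r * x, r * y))),
  (fun x y => r * partial_y u (r * x, r * y)),
  (fun x y => r * (r * partial_y (partial_y u) (r * x, r * y))) => x y /inD xy.
have dr (t : R) : is_derive t 1 (fun t => r * t) r.
  by have := is_derive_mulf (is_derive_cstf r t) (is_derive_idf t); rewrite mul0r add0r mulr1.
have [u1 u2 _ _] := C1u _ xy.
have [u3 _ _ _] := C1x _ xy.
have [_ u4 _ _] := C1y _ xy.
have scale (g : R -> R) t dg : is_derive (r * t) 1 g dg ->
    is_derive t 1 (fun t => g (r * t)) (r * dg).
  by move=> hg; rewrite mulrC; exact: (is_derive_compf hg (dr t)).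
have scale2 (g : R -> R) t dg : is_derive (r * t) 1 g dg ->
    is_derive t 1 (fun t => r * g (r * t)) (r * (r * dg)).
  move=> /scale hg; have := is_derive_mulf (is_derive_cstf r t) hg.
  by rewrite mul0r add0r.
split.
- exact: (scale _ _ _ (derivable_horizontal u1)).
- exact: (scale2 _ _ _ (derivable_horizontal u3)).
- exact: (scale _ _ _ (derivable_vertical u2)).
- exact: (scale2 _ _ _ (derivable_vertical u4)).
- by have := lap _ xy; rewrite /laplacian -!mulrDr => ->; rewrite !mulr0.
Qed.

End harmonic_dilates.

(** * Integration over the radius *)

(** A zero of [g] is allowed, so that [|f|^p] is continuous at the zeros of [f]. *)
Lemma continuous_powR_ge0 (R : realType) (T : topologicalType) (p : R) (g : T -> R) (t : T) :
  0 < p -> (forall x, 0 <= g x) -> {for t, continuous g} ->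
  {for t, continuous (fun x => g x `^ p)}.
Proof.
move=> p0 g0 cg; have [gt0|gt0] := eqVneq (g t) 0; last first.
  apply: (@continuous_comp _ _ _ g (fun y => y `^ p)) => //.
  apply: (@continuous_powR_gt0 _ id) => //.
  by rewrite lt_neqAle eq_sym gt0 g0.
apply/cvgrPdist_lt => e e0; rewrite gt0 powR0 ?lt0r_neq0//.
have d0 : 0 < e `^ p^-1 by rewrite powR_gt0.
have /cvgrPdist_lt /(_ _ d0) := cg; apply: filterS => x.
rewrite gt0 !sub0r !normrN !ger0_norm ?powR_ge0// => lt.
have -> : e = (e `^ p^-1) `^ p by rewrite -powRrM mulVf ?lt0r_neq0// powRr1// ltW.
by apply: gt0_ltr_powR => //; rewrite nnegrE ?g0// ltW.
Qed.

Lemma integral_disk_weight (R : realType) (alpha a b : R) : -1 < alpha ->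
  0 <= a < b -> b < 1 ->
  (\int[@lebesgue_measure R]_(r in `[a, b])
     ((alpha + 1) * (2 * r) * (1 - r ^+ 2) `^ alpha)%:E =
   ((1 - a ^+ 2) `^ (alpha + 1) - (1 - b ^+ 2) `^ (alpha + 1))%:E)%E.
Proof.
move=> alpha1 /andP[a0 ab] b1.
pose F (r : R) := - (1 - r ^+ 2) `^ (alpha + 1).
have pos (r : R) : a <= r <= b -> 0 < 1 - r ^+ 2 by move=> /andP[? ?]; nra.
have dF (r : R) : a <= r <= b ->
    is_derive r 1 F ((alpha + 1) * (2 * r) * (1 - r ^+ 2) `^ alpha).
  move=> /pos r1; rewrite /F.
  have dq : is_derive r 1 (fun r => 1 - r ^+ 2) (- (2 * r)).
    by derive; rewrite /=; ring.
  apply: is_derive_eqf.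
    apply: is_derive_oppf.
    exact: (@is_derive_compf _ (fun y => y `^ (alpha + 1)) (fun r => 1 - r ^+ 2) r _ _
      (is_derive1_powR _ r1) dq).
  by rewrite addrK; ring.
have cF (r : R) : a <= r <= b -> {for r, continuous F}.
  by move=> /dF; exact: is_derive_continuous.
rewrite (@continuous_FTC2 _ _ F _ _ ab).
- by rewrite /F -EFinB; congr (_%:E); ring.
- apply: continuous_in_subspaceT => r; rewrite inE/= in_itv/= => /pos r1.
  apply: cvgM; first by apply: cvgM; [exact: cst_continuous|apply: cvgM; [exact: cst_continuous|exact: cvg_id]].
  apply: (@continuous_comp _ _ _ (fun r : R => 1 - r ^+ 2) (fun y : R => y `^ alpha)).
    by apply: cvgB; [exact: cst_continuous|rewrite expr2; apply: cvgM; exact: cvg_id].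
  exact: (@continuous_powR_gt0 _ id).
- have ab' := ltW ab; split => [r||].
  + rewrite in_itv/= => /andP[r1 r2].
    by have [] := dF r ltac:(by rewrite !ltW).
  + by apply: cvg_at_right_filter; apply: cF; rewrite lexx.
  + by apply: cvg_at_left_filter; apply: cF; rewrite lexx andbT.
- move=> r; rewrite in_itv/= => /andP[r1 r2]; rewrite derive1E.
  by have [_ ->] := dF r ltac:(by rewrite !ltW).
Qed.

Section radial_integration.
Context {R : realType}.
Local Notation mu := (@lebesgue_measure R).
Variables (alpha C : R) (G : R -> R -> R).
Hypotheses (alpha1 : -1 < alpha) (C0 : 0 <= C).
Hypothesis G0 : forall x y : R, 0 <= G x y.
Hypothesis cG : forall x y : R, x ^+ 2 + y ^+ 2 < 1 ->
  {for (x, y), continuous (fun w : R * R => G w.1 w.2)}.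
Hypothesis circle_le : forall r : R, 0 < r < 1 ->
  (\int[mu]_(x in `[(- r)%R, r]) (G x 0)%:E <=
   C%:E * \int[mu]_(t in open_arc)
     (2^-1 * (G (r * sin t) (r * cos t) + G (r * sin t) (- (r * cos t))) * r)%:E)%E.

Let a0 : 0 < alpha + 1. Proof. by rewrite -ltrBlDr sub0r. Qed.

Let F (x y : R) : R := (alpha + 1) * (1 - (x ^+ 2 + y ^+ 2)) `^ alpha * G x y.

Let F_ge0 x y : 0 <= F x y.
Proof. by rewrite mulr_ge0// mulr_ge0 ?powR_ge0// ltW. Qed.

Let cF x y : x ^+ 2 + y ^+ 2 < 1 ->
  {for (x, y), continuous (fun w : R * R => F w.1 w.2)}.
Proof.
move=> xy; apply: cvgM; last exact: cG.
apply: cvgM; first exact: cst_continuous.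
apply: (@continuous_comp _ _ _ (fun w : R * R => 1 - (w.1 ^+ 2 + w.2 ^+ 2))
  (fun y : R => y `^ alpha)).
  apply: cvgB; first exact: cst_continuous.
  by apply: cvgD; rewrite expr2; apply: cvgM; first [exact: cvg_fst|exact: cvg_snd].
by apply: (@continuous_powR_gt0 _ id) => //=; rewrite subr_gt0.
Qed.

Let W (r : R) : R := (alpha + 1) * (2 * r) * (1 - r ^+ 2) `^ alpha.

Let cG_diameter (x : R) : -1 < x < 1 -> {for x, continuous (G ^~ 0)}.
Proof.
move=> /andP[? ?]; have xy : x ^+ 2 + 0 ^+ 2 < 1 by rewrite expr0n/= addr0; nra.
exact: (@continuous_comp2 _ _ G id (cst 0) x (cG xy) (fun=> id)
  (@cst_continuous _ _ (0 : R) x)).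
Qed.

Let cG_circle (r t e : R) : 0 < r < 1 -> e ^+ 2 = 1 ->
  {for t, continuous (fun t => G (r * sin t) (e * (r * cos t)))}.
Proof.
move=> /andP[? ?] e1; have xy : (r * sin t) ^+ 2 + (e * (r * cos t)) ^+ 2 < 1.
  by rewrite !exprMn e1 mul1r -mulrDr addrC cos2Dsin2; nra.
have c1 : {for t, continuous (fun t : R => r * sin t)}.
  by apply: cvgM; [exact: cst_continuous|exact: continuous_sin].
have c2 : {for t, continuous (fun t : R => e * (r * cos t))}.
  by apply: cvgM; [exact: cst_continuous|apply: cvgM; [exact: cst_continuous|exact: continuous_cos]].
exact: (@continuous_comp2 _ _ G _ _ t (cG xy) c1 c2).
Qed.

Let J := (\int[(mu \x mu)%E]_(w in [set w : R * R | (w.1 ^+ 2 + w.2 ^+ 2 < 1)%R])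
  (F w.1 w.2)%:E)%E.

Let mdiam : measurable (`](-1)%R, 1%R[%classic : set R).
Proof. exact: measurable_itv. Qed.

Let measurable_diameter (c : R) : measurable_fun (`](-1)%R, 1%R[%classic : set R)
  (fun x => G x 0 * Num.max 0 ((1 - x ^+ 2) `^ (alpha + 1) - c)).
Proof.
have mG : measurable_fun (`](-1)%R, 1%R[%classic : set R) (G ^~ 0).
  apply: open_continuous_measurable_fun; first exact: interval_open.
  by move=> x /set_mem; rewrite /= in_itv/=; exact: cG_diameter.
have mq : measurable_fun (`](-1)%R, 1%R[%classic : set R) (fun x : R => 1 - x ^+ 2).
  apply: measurable_funTS; apply: continuous_measurable_fun => x.
  by apply: cvgB; [exact: cst_continuous|rewrite expr2; apply: cvgM; exact: cvg_id].
have mp := measurableT_comp (@measurable_powR R (alpha + 1)) mq.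
apply: measurable_funM => //.
apply: (@measurable_maxr _ _ R _ (cst 0)); first exact: measurable_cst.
by apply: measurable_funB; [exact: mp|exact: measurable_cst].
Qed.

Section truncation.
Variable r0 : R.
Hypothesis r01 : 0 < r0 < 1.

(** The pairs [(r, x)] with [|x| <= r <= r0]; squares replace [|x| <= r]. *)
Let cone : set (R * R) := [set w | 0 <= w.1 <= r0 /\ w.2 ^+ 2 <= w.1 ^+ 2].

Let K (w : R * R) : R := W w.1 * G w.2 0 * \1_cone w.

Let K_ge0 w : 0 <= K w.
Proof.
rewrite /K indicE; have [|_] := boolP (w \in cone); last by rewrite mulr0.
rewrite inE => -[/andP[w0 _] _]; rewrite mulr1 mulr_ge0// mulr_ge0 ?powR_ge0//.
by rewrite mulr_ge0 ?(ltW a0)// mulr_ge0.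
Qed.

Let measurable_K : measurable_fun setT K.
Proof.
have c1 (w : R * R) : {for w, continuous (fun w : R * R => w.1)} by exact: cvg_fst.
have c2 (w : R * R) : {for w, continuous (fun w : R * R => w.2)} by exact: cvg_snd.
apply: measurable_indic_plane.
  apply: closed_measurable_plane; apply: closedI.
    rewrite (_ : (fun w => _) = fst @^-1` `[0, r0]%classic); last first.
      by apply/seteqP; split => w /=; rewrite in_itv/=.
    by apply: preimage_closed; [move=> w _; exact: c1|exact: itv_closed].
  have := @preimage_closed _ _ (fun w : R * R => w.2 ^+ 2 - w.1 ^+ 2) [set x | x <= 0].
  rewrite (_ : _ @^-1` _ = (fun w => is_true (w.2 ^+ 2 <= w.1 ^+ 2))); last first.
    by apply/seteqP; split => w /=; rewrite subr_le0.
  apply; last exact: closed_le.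
  by move=> w _; apply: cvgB; rewrite expr2; apply: cvgM; first [exact: c1|exact: c2].
pose U : set (R * R) := (fst @^-1` `](-1)%R, 1[%classic) `&` (snd @^-1` `](-1)%R, 1[%classic).
have oU : open U.
  apply: openI; apply: open_comp; first [by move=> w _; exact: c1|by move=> w _; exact: c2|
    exact: interval_open].
apply: (@measurable_funS _ _ _ _ U).
- exact: open_measurable_plane.
- move=> w [/andP[? ?] ?]; have /andP[? ?] := r01.
  by split; rewrite /= in_itv/=; apply/andP; split; nra.
apply: continuous_measurable_plane => // w []; rewrite /= !in_itv/= => /andP[? ?] w2.
apply: cvgM.
  apply: cvgM; first by apply: cvgM; [exact: cst_continuous|apply: cvgM; [exact: cst_continuous|exact: c1]].
  apply: (@continuous_comp _ _ _ (fun w : R * R => 1 - w.1 ^+ 2) (fun y : R => y `^ alpha)).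
    by apply: cvgB; [exact: cst_continuous|rewrite expr2; apply: cvgM; exact: c1].
  by apply: (@continuous_powR_gt0 _ id) => //=; nra.
apply: (@continuous_comp _ _ _ snd (G ^~ 0)); first exact: c2.
exact: cG_diameter.
Qed.

Let slice_r (r : R) : r \in `[0, r0]%classic ->
  (\int[mu]_x (K (r, x))%:E <= C%:E * \int[mu]_(t in open_arc)
     ((F (r * sin t) (r * cos t) + F (r * sin t) (- (r * cos t))) * r)%:E)%E.
Proof.
rewrite inE/= in_itv/= => /andP[r_ge0 rr0]; have /andP[_ r0_lt1] := r01.
have C0' : (0 <= C%:E)%E by rewrite lee_fin.
have [->|rn0] := eqVneq r 0.
  rewrite [leLHS]integral0_eq; last by move=> x _; rewrite /K /W /= !(mulr0, mul0r).
  by rewrite mule_ge0// integral_ge0// => t _; rewrite mulr0.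
have r_gt0 : 0 < r by rewrite lt_neqAle eq_sym rn0.
have r1 : 0 < r < 1 by rewrite r_gt0 (le_lt_trans rr0).
have W0 : 0 <= W r.
  by rewrite /W mulr_ge0 ?powR_ge0// mulr_ge0 ?(ltW a0)// mulr_ge0.
have mD : measurable (`[(- r)%R, r]%classic : set R) by exact: measurable_itv.
have mG0 : measurable_fun (`[(- r)%R, r]%classic : set R) (G ^~ 0).
  apply: subspace_continuous_measurable_fun => //.
  apply: continuous_in_subspaceT => x; rewrite inE/= in_itv/= => /andP[? ?].
  by apply: cG_diameter; move/andP: r1 => [? ?]; apply/andP; split; lra.
have mG := iffRL (@measurable_EFinP _ _ R _ _) mG0.
have -> : (\int[mu]_x (K (r, x))%:E =
    (W r)%:E * \int[mu]_(x in `[(- r)%R, r]) (G x 0)%:E)%E.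
  rewrite -(ge0_integralZl_EFin mu mD _ mG W0); last by move=> x _; rewrite lee_fin.
  rewrite [RHS]integral_mkcond; apply: eq_integral => x _.
  rewrite patchE /K indicE /=.
  have -> : ((r, x) \in cone) = (x \in `[(- r)%R, r]%classic).
    apply/idP/idP; rewrite !inE /cone/= in_itv/=.
      by move=> [_ xr]; apply/andP; split; nra.
    by move=> /andP[? ?]; split; [rewrite r_ge0|nra].
  by case: ifPn => _; rewrite ?mulr1 ?mulr0.
apply: (@le_trans _ _ ((W r)%:E * (C%:E * \int[mu]_(t in open_arc)
     (2^-1 * (G (r * sin t) (r * cos t) + G (r * sin t) (- (r * cos t))) * r)%:E))%E).
  by apply: lee_wpmul2l; [rewrite lee_fin|exact: circle_le].
rewrite muleCA; apply: lee_wpmul2l => //.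
have cg (t : R) : {for t, continuous (fun t => 2^-1 *
    (G (r * sin t) (r * cos t) + G (r * sin t) (- (r * cos t))) * r)}.
  apply: cvgM; last exact: cst_continuous.
  apply: cvgM; first exact: cst_continuous.
  apply: cvgD.
    have := @cG_circle r t 1 r1 (expr1n _ _).
    by rewrite (_ : (fun t => G _ (1 * _)) = (fun t => G (r * sin t) (r * cos t)))//;
      apply/funext => x; rewrite mul1r.
  have := @cG_circle r t (-1) r1 ltac:(by rewrite sqrrN expr1n).
  by rewrite (_ : (fun t => G _ (-1 * _)) = (fun t => G (r * sin t) (- (r * cos t))))//;
    apply/funext => x; rewrite mulN1r.
have mg : measurable_fun (@open_arc R) (fun t => (2^-1 *
    (G (r * sin t) (r * cos t) + G (r * sin t) (- (r * cos t))) * r)%:E).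
  exact: continuous_measurable_EFin.
have arg (t : R) : (alpha + 1) * (1 - ((r * sin t) ^+ 2 + (r * cos t) ^+ 2)) `^ alpha =
    (alpha + 1) * (1 - r ^+ 2) `^ alpha.
  by rewrite !exprMn -mulrDr [X in r ^+ 2 * X]addrC cos2Dsin2 mulr1.
have argN (t : R) : (alpha + 1) * (1 - ((r * sin t) ^+ 2 + (- (r * cos t)) ^+ 2)) `^ alpha =
    (alpha + 1) * (1 - r ^+ 2) `^ alpha.
  by rewrite sqrrN arg.
have FE (t : R) : (F (r * sin t) (r * cos t) + F (r * sin t) (- (r * cos t))) * r =
    (alpha + 1) * (1 - r ^+ 2) `^ alpha * 2 * (2^-1 *
    (G (r * sin t) (r * cos t) + G (r * sin t) (- (r * cos t))) * r).
  by rewrite /F arg argN; field.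
have moa : measurable (@open_arc R) by exact: measurable_itv.
have g0 (t : R) : @open_arc R t -> (0 <= (2^-1 *
    (G (r * sin t) (r * cos t) + G (r * sin t) (- (r * cos t))) * r)%:E)%E.
  by move=> _; rewrite lee_fin mulr_ge0// mulr_ge0 ?invr_ge0// addr_ge0.
have k0 : 0 <= (alpha + 1) * (1 - r ^+ 2) `^ alpha * 2.
  by rewrite mulr_ge0// mulr_ge0 ?powR_ge0// ltW.
apply: (@le_trans _ _ (((alpha + 1) * (1 - r ^+ 2) `^ alpha * 2)%:E *
    \int[mu]_(t in open_arc) (2^-1 *
    (G (r * sin t) (r * cos t) + G (r * sin t) (- (r * cos t))) * r)%:E)%E).
  apply: lee_wpmul2r; first by apply: integral_ge0.
  (* [W r] is the weight of [F] times [2 r]; here its factor [r <= 1] is dropped,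
     the other factor [r] in the integrand being the Jacobian. *)
  rewrite lee_fin /W (_ : _ * (2 * r) * _ = (alpha + 1) * (1 - r ^+ 2) `^ alpha * 2 * r); last by ring.
  by rewrite ler_piMr// ltW//; have /andP[] := r1.
rewrite -(ge0_integralZl_EFin mu moa g0 mg k0) le_eqVlt; apply/orP; left; apply/eqP.
by apply: eq_integral => t _; rewrite FE.
Qed.

Let slice_x (x : R) : -1 < x < 1 ->
  ((G x 0 * Num.max 0 ((1 - x ^+ 2) `^ (alpha + 1) - (1 - r0 ^+ 2) `^ (alpha + 1)))%:E <=
   \int[mu]_r (K (r, x))%:E)%E.
Proof.
move=> x1; have /andP[r0_gt0 r0_lt1] := r01.
have a0' := a0.
have [xr|xr] := ltP `|x| r0; last first.
  have -> : Num.max 0 ((1 - x ^+ 2) `^ (alpha + 1) - (1 - r0 ^+ 2) `^ (alpha + 1)) = 0.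
    apply/max_idPl; rewrite subr_le0; apply: ge0_ler_powR.
    - exact: ltW.
    - by rewrite nnegrE; have /andP[? ?] := x1; nra.
    - by rewrite nnegrE; nra.
    - by rewrite lerD2l lerN2 -(real_normK (num_real x)); nra.
  by rewrite mulr0 integral_ge0// => r _; rewrite lee_fin.
have pos : 0 <= `|x| < r0 by rewrite normr_ge0.
have mI : measurable (`[`|x|, r0]%classic : set R) by exact: measurable_itv.
have W0 (r : R) : `[`|x|, r0]%classic r -> (0 <= (W r)%:E)%E.
  rewrite /= in_itv/= => /andP[r1 _]; rewrite lee_fin /W mulr_ge0 ?powR_ge0//.
  by rewrite mulr_ge0 ?(ltW a0)// mulr_ge0// (le_trans (normr_ge0 x)).
have mW0 : measurable_fun (`[`|x|, r0]%classic : set R) W.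
  apply: subspace_continuous_measurable_fun => //.
  apply: continuous_in_subspaceT => r; rewrite inE/= in_itv/= => /andP[r1 r2].
  have r3 : 0 <= r by exact: le_trans (normr_ge0 x) r1.
  apply: cvgM; first by apply: cvgM; [exact: cst_continuous|apply: cvgM; [exact: cst_continuous|exact: cvg_id]].
  apply: (@continuous_comp _ _ _ (fun r : R => 1 - r ^+ 2) (fun y : R => y `^ alpha)).
    by apply: cvgB; [exact: cst_continuous|rewrite expr2; apply: cvgM; exact: cvg_id].
  by apply: (@continuous_powR_gt0 _ id) => //=; nra.
have mW := iffRL (@measurable_EFinP _ _ R _ _) mW0.
have -> : (\int[mu]_r (K (r, x))%:E = (G x 0)%:E * \int[mu]_(r in `[`|x|%R, r0]) (W r)%:E)%E.
  rewrite -(ge0_integralZl_EFin mu mI W0 mW (G0 x 0)) [RHS]integral_mkcond.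
  apply: eq_integral => r _; rewrite patchE /K indicE /=.
  have -> : ((r, x) \in cone) = (r \in `[`|x|, r0]%classic).
    apply/idP/idP; rewrite !inE /cone/= in_itv/=.
      move=> [/andP[r1 ->] xr2]; rewrite andbT -(ger0_norm r1).
      by rewrite -(@ler_pXn2r _ 2) ?nnegrE// !real_normK ?num_real.
    move=> /andP[r1 ->]; have r2 : 0 <= r by exact: le_trans (normr_ge0 x) r1.
    by rewrite r2 -(real_normK (num_real x)); split=> //; nra.
  by case: ifPn => _; rewrite ?mulr1 ?mulr0// -EFinM mulrC.
rewrite integral_disk_weight// real_normK ?num_real// -EFinM lee_fin.
apply: ler_wpM2l => //; rewrite ge_max lexx andbT subr_ge0; apply: ge0_ler_powR.
- exact: ltW.
- by rewrite nnegrE; nra.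
- by rewrite nnegrE; have /andP[? ?] := x1; nra.
- by rewrite lerD2l lerN2 -(real_normK (num_real x)); nra.
Qed.

(** Both sides integrate [K]: over [x] first this is the circle inequality and
    polar coordinates, over [r] first it is [integral_disk_weight], whose value is
    replaced by 0 when [|x| >= r0]. *)
Lemma truncated_area_le : (\int[mu]_(x in `](-1)%R, 1%R[)
    (G x 0 * Num.max 0 ((1 - x ^+ 2) `^ (alpha + 1) - (1 - r0 ^+ 2) `^ (alpha + 1)))%:E <=
  C%:E * J)%E.
Proof.
pose KE (w : R * R) := (K w)%:E.
have KE0 w : (0 <= KE w)%E by rewrite lee_fin.
have mKE : measurable_fun setT KE by exact: (iffRL (@measurable_EFinP _ _ R setT K)).
have FK : (\int[mu]_r \int[mu]_x KE (r, x) = \int[mu]_x \int[mu]_r KE (r, x))%E.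
  exact: (@fubini_tonelli _ _ _ _ R mu mu KE mKE KE0).
have mKG : measurable_fun setT (fun x => \int[mu]_r KE (r, x))%E.
  exact: (@measurable_fun_fubini_tonelli_G _ _ _ _ R mu KE mKE KE0).
have mKF : measurable_fun setT (fun r => \int[mu]_x KE (r, x))%E.
  exact: (@measurable_fun_fubini_tonelli_F _ _ _ _ R mu KE mKE KE0).
have KG0 x : (0 <= \int[mu]_r KE (r, x))%E by apply: integral_ge0 => r _; exact: KE0.
apply: (@le_trans _ _ (\int[mu]_(x in `](-1)%R, 1%R[) \int[mu]_r KE (r, x))%E).
  have f0 (x : R) : `](-1)%R, 1%R[%classic x -> (0 <= (G x 0 *
      Num.max 0 ((1 - x ^+ 2) `^ (alpha + 1) - (1 - r0 ^+ 2) `^ (alpha + 1)))%:E)%E.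
    by move=> _; rewrite lee_fin; apply: mulr_ge0; [exact: G0|rewrite le_max lexx].
  apply: (ge0_le_integral mu mdiam f0
    (iffRL (@measurable_EFinP _ _ R _ _) (measurable_diameter _)) (measurable_funTS mKG)).
  by move=> x; rewrite /= in_itv/=; exact: slice_x.
apply: (@le_trans _ _ (\int[mu]_x \int[mu]_r KE (r, x))%E).
  apply: (@ge0_subset_integral _ _ R mu _ _ mdiam measurableT) => [|x _|]; [exact: mKG|exact: KG0|exact: subsetT].
rewrite -FK.
pose Phi (r : R) := (\int[mu]_(t in open_arc)
  ((F (r * sin t) (r * cos t) + F (r * sin t) (- (r * cos t))) * r)%:E)%E.
have mA : measurable (`[0, r0]%classic : set R) by exact: measurable_itv.
have mPhi : measurable_fun (`[0, r0]%classic : set R) Phi by exact: measurable_polar.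
have Phi0 (r : R) : `[0, r0]%classic r -> (0 <= Phi r)%E.
  rewrite /= in_itv/= => /andP[r_ge0 _]; apply: integral_ge0 => t _.
  by rewrite lee_fin mulr_ge0// addr_ge0.
apply: (@le_trans _ _ (\int[mu]_(r in `[0%R, r0]) (C%:E * Phi r))%E).
  rewrite [leLHS](_ : _ = \int[mu]_(r in `[0%R, r0]) \int[mu]_x KE (r, x))%E; last first.
    rewrite [RHS]integral_mkcond; apply: eq_integral => r _; rewrite patchE.
    case: ifPn => // /negP rA; apply: integral0_eq => x _.
    rewrite /KE /K indicE memNset ?mulr0//= => -[w1 _]; apply: rA.
    by rewrite inE/= in_itv.
  apply: (ge0_le_integral mu mA _ (measurable_funTS mKF)).
  - by move=> r _; apply: integral_ge0 => x _; exact: KE0.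
  - by apply: emeasurable_funM => //; exact: measurable_cst.
  - by move=> r rA; apply: slice_r; rewrite inE.
rewrite (ge0_integralZl_EFin mu mA Phi0 mPhi C0).
by apply: lee_wpmul2l; [rewrite lee_fin|exact: polar_le].
Qed.

End truncation.

(** The circle inequality, integrated over [r <= r0] against
    [(alpha + 1) 2 r (1 - r^2)^alpha]; Fatou's lemma then lets [r0] tend to 1,
    where the subtracted term [(1 - r0^2)^(alpha + 1)] vanishes. *)
Lemma weighted_area_le :
  (\int[mu]_(x in `](-1)%R, 1%R[) ((1 - x ^+ 2) `^ (alpha + 1) * G x 0)%:E <=
   C%:E * \int[(mu \x mu)%E]_(w in [set w : R * R | (w.1 ^+ 2 + w.2 ^+ 2 < 1)%R])
     ((alpha + 1) * (1 - (w.1 ^+ 2 + w.2 ^+ 2)) `^ alpha * G w.1 w.2)%:E)%E.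
Proof.
pose rn (n : nat) : R := 1 - n.+2%:R^-1.
have rn01 n : 0 < rn n < 1.
  rewrite /rn subr_gt0 ltrBlDr ltrDl invr_gt0 ltr0n andbT.
  by rewrite invf_lt1 ?ltr0n// ltr1n.
pose f n (x : R) := G x 0 * Num.max 0 ((1 - x ^+ 2) `^ (alpha + 1) - (1 - rn n ^+ 2) `^ (alpha + 1)).
apply: (@fatou_le _ `](-1)%R, 1%R[%classic f) => [||n x _|x x1|n].
- exact: measurable_itv.
- by move=> n; exact: measurable_diameter.
- by rewrite /f mulr_ge0// le_max lexx.
- have rn1 : rn @ \oo --> (1 : R).
    rewrite -[X in _ --> X]subr0; apply: cvgB; first exact: cvg_cst.
    by have := @cvg_harmonic R; rewrite -(cvg_shiftS (@harmonic R)).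
  pose k (r : R) := G x 0 * Num.max 0 ((1 - x ^+ 2) `^ (alpha + 1) - `|1 - r ^+ 2| `^ (alpha + 1)).
  have x2 : 0 <= (1 - x ^+ 2) `^ (alpha + 1) by exact: powR_ge0.
  have -> : (1 - x ^+ 2) `^ (alpha + 1) * G x 0 = k 1.
    rewrite /k expr1n subrr normr0 powR0 ?lt0r_neq0// subr0 mulrC; congr (_ * _).
    by apply/esym/max_idPr.
  have -> : f ^~ x = k \o rn.
    apply/funext => n; rewrite /f /k /= ger0_norm//.
    by have /andP[? ?] := rn01 n; nra.
  apply: continuous_cvg; last exact: rn1.
  apply: cvgM; first exact: cst_continuous.
  have cd : {for 1, continuous (fun r : R => (1 - x ^+ 2) `^ (alpha + 1) - `|1 - r ^+ 2| `^ (alpha + 1))}.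
    apply: cvgB; first exact: cst_continuous.
    apply: (@continuous_powR_ge0 _ _ _ (fun r : R => `|1 - r ^+ 2|)) => //.
    apply: (@continuous_comp _ _ _ (fun r : R => 1 - r ^+ 2) (fun y : R => `|y|)).
      by apply: cvgB; [exact: cst_continuous|rewrite expr2; apply: cvgM; exact: cvg_id].
    exact: norm_continuous.
  exact: (@continuous_max _ _ (cst 0) _ (1 : R) (@cst_continuous _ _ (0 : R) _) cd).
- exact: truncated_area_le.

Qed.

End radial_integration.

(** * The weighted area inequality *)

Lemma mean_powR_le (R : realType) (p A B : R) : 1 <= p -> 0 <= A -> 0 <= B ->
  (2^-1 * (A + B)) `^ p <= 2^-1 * (A `^ p + B `^ p).
Proof.
move=> p1 A0 B0; have c2 : 1 - 2^-1 = 2^-1 :> R by field.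
suff : (2^-1 * A + (1 - 2^-1) * B) `^ p <= 2^-1 * A `^ p + (1 - 2^-1) * B `^ p.
  by rewrite !c2 -!mulrDr.
by apply: (convex_powR p1 (Itv01 _ _)) => //=;
  rewrite ?inE/= ?in_itv/= ?A0 ?B0// ?invr_ge0// invf_le1 ?ler1n.
Qed.

Section area_inequality.
Context {R : realType}.
Local Notation mu := (@lebesgue_measure R).
Variables (p alpha : R) (f : R[i] -> R[i]).
Hypotheses (p1 : 1 < p) (alpha1 : -1 < alpha).
Hypothesis hf : harmonic_on (@unit_disk R) f.

Let u (w : R * R) : R := complex.Re (f (of_coord w)).
Let v (w : R * R) : R := complex.Im (f (of_coord w)).

Let N (w : R * R) : R := normc (f (of_coord w)).

Let C : R := (cos (p^-1 * (pi / 2)))^-1 `^ p.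

Let p0 : 0 < p. Proof. exact: lt_trans ltr01 p1. Qed.

Let NE w : N w = Num.sqrt (u w ^+ 2 + v w ^+ 2).
Proof. by rewrite /N /u /v; case: (f _). Qed.

Let N_ge0 w : 0 <= N w. Proof. by rewrite NE sqrtr_ge0. Qed.

Let cN (w : R * R) : w.1 ^+ 2 + w.2 ^+ 2 < 1 -> {for w, continuous N}.
Proof.
move=> w1; have [[[C1u _ _] _] [[C1v _ _] _]] := hf.
rewrite unit_disk_coord in C1u C1v.
have cu := C1_on_continuous (@open_unit_disk R) C1u w1.
have cv := C1_on_continuous (@open_unit_disk R) C1v w1.
rewrite (_ : N = (fun w => Num.sqrt (u w ^+ 2 + v w ^+ 2))); last exact/funext.
apply: (@continuous_comp _ _ _ (fun w => u w ^+ 2 + v w ^+ 2) (@Num.sqrt R)).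
  by apply: cvgD; rewrite expr2; apply: cvgM; first [exact: cu|exact: cv].
exact: sqrt_continuous.
Qed.

(** The circle inequality at radius [r]; convexity of [y |-> y^p] replaces the
    mean of [|f|] over conjugate points by the mean of [|f|^p]. *)
Let circle_le (r : R) : 0 < r < 1 ->
  (\int[mu]_(x in `[(- r)%R, r]) (N (x, 0) `^ p)%:E <=
   C%:E * \int[mu]_(t in open_arc)
     (2^-1 * (N (r * sin t, r * cos t)%R `^ p + N (r * sin t, - (r * cos t))%R `^ p) * r)%:E)%E.
Proof.
move=> r01; have /andP[r_gt0 r_lt1] := r01.
have [hRe hIm] := hf.
have hU := real_harmonic_dilate r01 hRe.
have hV := real_harmonic_dilate r01 hIm.
have r1 : 1 < r^-1 by rewrite invf_gt1.
have ME x y : modulus (fun x y => complex.Re (f (of_coord (r * x, r * y))))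
    (fun x y => complex.Im (f (of_coord (r * x, r * y)))) x y = N (r * x, r * y).
  by rewrite NE.
have := riesz_fejer p1 r1 hU hV.
set m := arc_mean _ _ => RF.
have mE t : m t = 2^-1 * (N (r * sin t, r * cos t) + N (r * sin t, - (r * cos t))).
  by rewrite /m /arc_mean !ME mulrN.
have cm : continuous m by exact: continuous_arc_mean r1 hU hV.
have m_ge0 t : 0 <= m t by exact: arc_mean_ge0.
have cNx (x : R) : -1 < x < 1 -> {for x, continuous (fun x => N (x, 0) `^ p)}.
  move=> x1; apply: continuous_powR_ge0 => //.
  have xy : x ^+ 2 + 0 ^+ 2 < 1 by rewrite expr0n/= addr0; have /andP[? ?] := x1; nra.
  have cNxy : {for (x, 0), continuous (fun w : R * R => N (w.1, w.2))}.
    by rewrite (_ : (fun w : R * R => N (w.1, w.2)) = N);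
      [exact: cN|apply/funext => -[]].
  exact: (@continuous_comp2 _ _ (fun x y => N (x, y)) id (cst 0) x cNxy (fun=> id)
    (@cst_continuous _ _ (0 : R) x)).
have dil (x : R) : -1 <= x <= 1 -> is_derive x 1 (fun x => r * x) r.
  by move=> _; have := is_derive_mulf (is_derive_cstf r x) (is_derive_idf x); rewrite mul0r add0r mulr1.
have N11 : -1 <= 1 :> R by lra.
have cG (y : R) : r * -1 <= y <= r * 1 -> {for y, continuous (fun x => N (x, 0) `^ p)}.
  by rewrite mulrN !mulr1 => /andP[? ?]; apply: cNx; apply/andP; split; lra.
have := increasing_substitution N11 dil (fun x _ => @cst_continuous _ _ r x) (fun _ _ => r_gt0) cG.
rewrite mulrN !mulr1 => ->.
have mx0 : measurable_fun (`](-1)%R, 1%R[%classic : set R) (fun x => N (r * x, 0) `^ p).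
  apply: open_continuous_measurable_fun; first exact: interval_open.
  move=> x /set_mem; rewrite /= in_itv/= => /andP[? ?].
  apply: (@continuous_comp _ _ _ (fun x => r * x) (fun x => N (x, 0) `^ p)).
    by apply: cvgM; [exact: cst_continuous|exact: cvg_id].
  by apply: cNx; apply/andP; split; nra.
have mx := iffRL (@measurable_EFinP _ _ R _ _) mx0.
have r_ge0 := ltW r_gt0.
rewrite (_ : (\int[mu]_(x in `[(-1)%R, 1%R]) (N ((r * x)%R, 0%R) `^ p * r)%:E =
  r%:E * \int[mu]_(x in `](-1)%R, 1%R[) (N ((r * x)%R, 0%R) `^ p)%:E)%E); last first.
  rewrite -(ge0_integralZl_EFin mu (measurable_itv _) _ mx r_ge0); last first.
    by move=> x _; rewrite lee_fin powR_ge0.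
  rewrite (@integral_itv_bndoo R (-1) 1 _ true false).
    by apply: eq_integral => x _; rewrite -EFinM mulrC.
  apply: (iffRL (@measurable_EFinP _ _ R _ (fun x => N (r * x, 0) `^ p * r))).
  by apply: measurable_funM => //; exact: measurable_cst.
have mm : measurable_fun (@open_arc R) (fun t => (m t `^ p)%:E).
  apply: (iffRL (@measurable_EFinP _ _ R _ (fun t => m t `^ p))).
  apply: (@measurableT_comp _ _ _ _ _ _ (@powR R ^~ p)); first exact: measurable_powR.
  by apply: measurable_funTS; exact: continuous_measurable_fun.
apply: (@le_trans _ _ (r%:E * (C%:E * \int[mu]_(t in open_arc) (m t `^ p)%:E))%E).
  apply: lee_wpmul2l; first by rewrite lee_fin.
  apply: le_trans RF; rewrite le_eqVlt; apply/orP; left; apply/eqP.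
  by apply: eq_integral => x _; rewrite ME mulr0.
rewrite muleCA; apply: lee_wpmul2l; first by rewrite lee_fin powR_ge0.
rewrite -(ge0_integralZl_EFin mu (measurable_itv _) _ mm r_ge0); last first.
  by move=> t _; rewrite lee_fin powR_ge0.
have cNc (t e : R) : e ^+ 2 = 1 -> {for t, continuous (fun t => N (r * sin t, e * (r * cos t)))}.
  move=> e1; have xy : (r * sin t) ^+ 2 + (e * (r * cos t)) ^+ 2 < 1.
    rewrite !exprMn e1 mul1r -mulrDr addrC cos2Dsin2; nra.
  have cNxy : {for (r * sin t, e * (r * cos t)), continuous (fun w : R * R => N (w.1, w.2))}.
    by rewrite (_ : (fun w : R * R => N (w.1, w.2)) = N);
      [exact: cN|apply/funext => -[]].
  have c1 : {for t, continuous (fun t : R => r * sin t)}.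
    by apply: cvgM; [exact: cst_continuous|exact: continuous_sin].
  have c2 : {for t, continuous (fun t : R => e * (r * cos t))}.
    by apply: cvgM; [exact: cst_continuous|apply: cvgM; [exact: cst_continuous|exact: continuous_cos]].
  exact: (@continuous_comp2 _ _ (fun x y => N (x, y)) _ _ t cNxy c1 c2).
apply: ge0_le_integral.
- exact: measurable_itv.
- by move=> t _; rewrite -EFinM lee_fin mulr_ge0// powR_ge0.
- by apply: emeasurable_funM => //; exact: measurable_cst.
- apply: continuous_measurable_EFin => t.
  have h1 : {for t, continuous (fun t => N (r * sin t, r * cos t) `^ p)}.
    apply: continuous_powR_ge0 => //; have := @cNc t 1 (expr1n _ _).
    by rewrite (_ : (fun t => N (r * sin t, 1 * (r * cos t))) = (fun t => N (r * sin t, r * cos t)))//;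
      apply/funext => x; rewrite mul1r.
  have h2 : {for t, continuous (fun t => N (r * sin t, - (r * cos t)) `^ p)}.
    apply: continuous_powR_ge0 => //; have := @cNc t (-1) ltac:(by rewrite sqrrN expr1n).
    by rewrite (_ : (fun t => N (r * sin t, -1 * (r * cos t))) = (fun t => N (r * sin t, - (r * cos t))))//;
      apply/funext => x; rewrite mulN1r.
  apply: cvgM; last exact: cst_continuous.
  apply: cvgM; first exact: cst_continuous.
  by apply: cvgD; [exact: h1|exact: h2].
- move=> t _; rewrite -EFinM lee_fin mulrC; apply: ler_wpM2r => //.
  rewrite mE.
  set A := N _; set B := N (_, - _).
  exact: mean_powR_le (ltW p1) (N_ge0 _) (N_ge0 _).
Qed.

Let C_ge0 : 0 <= C. Proof. exact: powR_ge0. Qed.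

Lemma harmonic_area_le :
  (\int[mu]_(x in `](-1)%R, 1%R[) ((1 - x ^+ 2) `^ (alpha + 1) * N (x, 0) `^ p)%:E <=
   C%:E * \int[(mu \x mu)%E]_(w in [set w : R * R | (w.1 ^+ 2 + w.2 ^+ 2 < 1)%R])
     ((alpha + 1) * (1 - (w.1 ^+ 2 + w.2 ^+ 2)) `^ alpha * N (w.1, w.2) `^ p)%:E)%E.
Proof.
have G0 x y : 0 <= N (x, y) `^ p by exact: powR_ge0.
have cG x y : x ^+ 2 + y ^+ 2 < 1 ->
    {for (x, y), continuous (fun w : R * R => N (w.1, w.2) `^ p)}.
  move=> xy; apply: (@continuous_powR_ge0 _ _ _ (fun w : R * R => N (w.1, w.2))) => //.
  by rewrite (_ : (fun w : R * R => N (w.1, w.2)) = N);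
    [exact: cN|apply/funext => -[]].
exact: (@weighted_area_le R alpha C (fun x y => N (x, y) `^ p) alpha1 C_ge0 G0 cG circle_le).
Qed.

(** On the diameter [1 - |x| <= 1 - x^2]. *)
Lemma diameter_weight_le :
  (\int[mu]_(x in `](-1)%R, 1%R[) ((1 - `|x|) `^ (alpha + 1) * N (x, 0%R) `^ p)%R%:E <=
   \int[mu]_(x in `](-1)%R, 1%R[) ((1 - x ^+ 2) `^ (alpha + 1) * N (x, 0%R) `^ p)%R%:E)%E.
Proof.
have mdiam : measurable (`](-1)%R, 1%R[%classic : set R) by exact: measurable_itv.
have a0 : 0 < alpha + 1 by rewrite -ltrBlDr sub0r.
have mN : measurable_fun (`](-1)%R, 1%R[%classic : set R) (fun x => N (x, 0) `^ p).
  apply: open_continuous_measurable_fun; first exact: interval_open.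
  move=> x /set_mem; rewrite /= in_itv/= => /andP[? ?].
  apply: (@continuous_powR_ge0 _ _ _ (fun x => N (x, 0))) => //.
  have cNx : {for (x, 0), continuous (fun w : R * R => N (w.1, w.2))}.
    rewrite (_ : (fun w : R * R => N (w.1, w.2)) = N); last by apply/funext => -[].
    by apply: cN; rewrite /= expr0n/= addr0; nra.
  exact: (@continuous_comp2 _ _ (fun x y => N (x, y)) id (cst 0) x cNx (fun=> id)
    (@cst_continuous _ _ (0 : R) x)).
have mq (q : R -> R) : continuous q ->
    measurable_fun (`](-1)%R, 1%R[%classic : set R) (fun x => (q x `^ (alpha + 1) * N (x, 0) `^ p)%:E).
  move=> cq; apply: (iffRL (@measurable_EFinP _ _ R _ (fun x => q x `^ (alpha + 1) * N (x, 0) `^ p))).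
  apply: measurable_funM => //; apply: (measurableT_comp (@measurable_powR R (alpha + 1))).
  by apply: measurable_funTS; exact: continuous_measurable_fun.
have m1 := mq (fun x => 1 - `|x|) ltac:(by move=> x; apply: cvgB; [exact: cst_continuous|exact: norm_continuous]).
have m2 := mq (fun x => 1 - x ^+ 2) ltac:(by move=> x; apply: cvgB; [exact: cst_continuous|rewrite expr2; apply: cvgM; exact: cvg_id]).
have f0 (x : R) : `](-1)%R, 1%R[%classic x -> (0 <= ((1 - `|x|) `^ (alpha + 1) * N (x, 0%R) `^ p)%R%:E)%E.
  by move=> _; rewrite lee_fin mulr_ge0 ?powR_ge0.
apply: (ge0_le_integral mu mdiam f0 m1 m2) => x; rewrite /= in_itv/= -ltr_norml => x1.
have x0 := normr_ge0 x; have x2 := real_normK (num_real x).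
rewrite lee_fin; apply: ler_wpM2r; first exact: powR_ge0.
by apply: ge0_ler_powR; rewrite ?nnegrE ?(ltW a0)//; nra.
Qed.

End area_inequality.

Unset Implicit Arguments.
Local Open Scope complex_scope.
Local Open Scope ring_scope.

Theorem theorem1p2 (R : realType) (p alpha : R) (f : R[i] -> R[i])
    (hp : 1 < p) (halpha : -1 < alpha) (hf : harmonic_bergman p alpha f) :
  (\int[@lebesgue_measure R]_(x in `](-1)%R, 1%R[%classic)
      ((1 - `|x|) `^ (alpha + 1) * normc (f x%:C) `^ p)%:E
   <= (pi * sec (pi / (2 * p)) `^ p)%:E
      * disk_integral alpha (fun z => normc (f z) `^ p)%R)%E.
Proof.
have [hf0 _] := hf.
have piC (c : R) : pi * c * pi^-1 = c by rewrite mulrAC mulfV ?mul1r// lt0r_neq0 ?pi_gt0.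
have secE : sec (pi / (2 * p)) = (cos (p^-1 * (pi / 2)))^-1.
  by congr (cos _)^-1; field; apply: lt0r_neq0; exact: lt_trans hp.
have JE : (\int[(@lebesgue_measure R \x @lebesgue_measure R)%E]_(w in
      @of_coord R @^-1` @unit_disk R)
      ((alpha + 1) * (1 - normc (of_coord w) ^+ 2) `^ alpha
        * normc (f (of_coord w)) `^ p)%:E =
    \int[(@lebesgue_measure R \x @lebesgue_measure R)%E]_(w in
      [set w : R * R | (w.1 ^+ 2 + w.2 ^+ 2 < 1)%R])
      ((alpha + 1) * (1 - (w.1 ^+ 2 + w.2 ^+ 2)) `^ alpha
        * normc (f (of_coord (w.1, w.2))) `^ p)%:E)%E.
  rewrite unit_disk_coord; apply: eq_integral => -[x y] _.
  by rewrite /of_coord /= sqr_sqrtr// addr_ge0 ?sqr_ge0.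
have := le_trans (diameter_weight_le hp halpha hf0) (harmonic_area_le hp halpha hf0).
rewrite -JE -secE => area.
by rewrite /disk_integral muleA -EFinM piC; exact: area.
Qed.
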